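(* Let $U\subset\mathbb{R}^n$ and $V\subset\mathbb{R}^m$ be bounded domains and let $f\in W^{1,n}(U,V)$. Then for any smooth differential form $\beta$ defined on a neighborhood of $V$, we have $f^*\beta\in\Omega_{\mathrm{conf}}^{\bullet}(U)$ and $f^*(d\beta)=d(f^*\beta)$.
   Context: $U$ carries the Euclidean metric, and $f=(f^1,\dots,f^m)\in W^{1,n}(U,V)$ means that $f$ is a measurable map $U\to V$ whose components $f^j$ lie in $L^n(U)$ and have weak differentials $df^j\in L^n(U,\Lambda^1)$. For a form $\beta=\sum_I b_I(y)\,dy^{i_1}\wedge\cdots\wedge dy^{i_k}$, the pull-back is $f^*\beta=\sum_I(b_I\circ f)\,df^{i_1}\wedge\cdots\wedge df^{i_k}$, with weak differentials $df^j$. $L^p(U,\Lambda^k)$ denotes the measurable $k$-forms on $U$ whose pointwise norm is in $L^p$. A form $\theta\in L^1_{loc}(U,\Lambda^{k+1})$ is the weak exterior differential of $\phi\in L^1_{loc}(U,\Lambda^k)$, written $d\phi=\theta$, if $\int_W\theta\wedge\omega=(-1)^{k+1}\int_W\phi\wedge d\omega$ for every oriented open $W\subset U$ and every smooth $(n-k-1)$-form $\omega$ with compact support in $W$. For $0\le k\le n$ (with $L^{n/0}=L^\infty$), $\Omega_{\mathrm{conf}}^k(U)=\{\omega\in L^{n/k}(U,\Lambda^k): d\omega\in L^{n/(k+1)}(U,\Lambda^{k+1})\}$ (for $k=n$ the condition on $d\omega$ is void, since forms of degree greater than $n$ on $U$ are zero), and $\Omega_{\mathrm{conf}}^{\bullet}(U)=\bigoplus_{k=0}^n\Omega_{\mathrm{conf}}^k(U)$.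 In the claim, $d(f^*\beta)$ is the weak exterior differential.
   Formalization: The form β is assumed smooth on an open set containing the closure of V, not merely V; otherwise the claim fails, e.g. U = V = (0,1), f = id, β = 1/y, where f^*β = 1/x is not in L^∞(U). *)

(* Defs.v *)
From HB Require Import structures.
From mathcomp Require Import all_boot all_order all_algebra.
From mathcomp Require Import all_classical all_reals all_analysis.
From mathcomp Require Import measurable_realfun.

Set Implicit Arguments.
Unset Strict Implicit.
Unset Printing Implicit Defensive.

Import Order.TTheory GRing.Theory Num.Theory.
Import numFieldNormedType.Exports.

Local Open Scope classical_set_scope.
Local Open Scope ring_scope.

(* The product sigma-algebra (as for tuples in the library); it is shown below
   to be the Borel one, see [measurable_rVE]. *)
Section measurable_rV.
Context (R : realType) (n : nat).

Definition rV_coord (i : 'I_n) (x : 'rV[R]_n) : R := x ord0 i.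

Let rV_set0 : g_sigma_preimage rV_coord set0.
Proof. exact: sigma_algebra0. Qed.

Let rV_setC A : g_sigma_preimage rV_coord A -> g_sigma_preimage rV_coord (~` A).
Proof. exact: sigma_algebraC. Qed.

Let rV_bigcup (F : (set 'rV[R]_n)^nat) :
  (forall i, g_sigma_preimage rV_coord (F i)) ->
  g_sigma_preimage rV_coord (\bigcup_i (F i)).
Proof. exact: sigma_algebra_bigcup. Qed.

HB.instance Definition _ := @isMeasurable.Build default_measure_display
  'rV[R]_n (g_sigma_preimage rV_coord) rV_set0 rV_setC rV_bigcup.

Lemma measurable_coord (i : 'I_n) :
  measurable_fun [set: 'rV[R]_n] (fun x : 'rV[R]_n => x ord0 i).
Proof.
move=> _ Y mY; rewrite setTI; apply: sub_sigma_algebra => /=.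
rewrite -bigcup_seq/=; exists i => /=; first by rewrite mem_index_enum.
by exists Y => //; rewrite setTI.
Qed.

Lemma measurable_fun_rVP d (T : measurableType d) (f : T -> 'rV[R]_n) :
  measurable_fun [set: T] f <->
  forall i, measurable_fun [set: T] (fun x => f x ord0 i).
Proof.
split=> [mf i|mf].
  exact: (measurableT_comp (measurable_coord i) mf).
move=> _ Y; rewrite /measurable /= => mY; rewrite setTI.
suff : g_sigma_preimage rV_coord `<=` [set Y | measurable (f @^-1` Y)] by apply.
apply: smallest_sub.
  split=> /=.
  - by rewrite preimage_set0; exact: measurable0.
  - by move=> A mA; rewrite setTD -preimage_setC; exact: measurableC.
  - by move=> F mF; rewrite preimage_bigcup; exact: bigcup_measurable.
move=> A; rewrite -bigcup_seq => -[i _ [B mB <-]] /=.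
rewrite setTI -comp_preimage -[X in measurable X]setTI.
exact: mf.
Qed.

End measurable_rV.

Section lebesgue_step.
Context (R : realType) (n : nat).

Definition rV_cons (xv : R * 'rV[R]_n) : 'rV[R]_n.+1 :=
  \row_(i < n.+1) oapp (xv.2 ord0) xv.1 (unlift ord0 i).

Lemma rV_cons0 xv : rV_cons xv ord0 ord0 = xv.1.
Proof. by rewrite mxE unlift_none. Qed.

Lemma rV_consS xv i : rV_cons xv ord0 (lift ord0 i) = xv.2 ord0 i.
Proof. by rewrite mxE liftK. Qed.

Definition rV_uncons (x : 'rV[R]_n.+1) : R * 'rV[R]_n :=
  (x ord0 ord0, \row_(i < n) x ord0 (lift ord0 i)).

Lemma rV_consK : cancel rV_cons rV_uncons.
Proof.
move=> [a v]; rewrite /rV_uncons rV_cons0; congr pair.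
by apply/rowP => i; rewrite mxE rV_consS.
Qed.

Lemma rV_unconsK : cancel rV_uncons rV_cons.
Proof.
move=> x; apply/rowP => i; have [j ->|->] := unliftP ord0 i.
  by rewrite rV_consS mxE.
by rewrite rV_cons0.
Qed.

Lemma measurable_rV_cons : measurable_fun [set: measurableTypeR R * 'rV[R]_n]
  (rV_cons : measurableTypeR R * 'rV[R]_n -> 'rV[R]_n.+1).
Proof.
apply/measurable_fun_rVP => i; have [j ->|->] := unliftP ord0 i.
  under eq_fun do rewrite rV_consS.
  exact: (measurableT_comp (measurable_coord j) measurable_snd).
by under eq_fun do rewrite rV_cons0; exact: measurable_fst.
Qed.

Lemma measurable_rV_uncons : measurable_fun [set: 'rV[R]_n.+1]
  (rV_uncons : 'rV[R]_n.+1 -> measurableTypeR R * 'rV[R]_n).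
Proof.
apply: measurable_fun_pair; first exact: (measurable_coord ord0).
apply/measurable_fun_rVP => i; under eq_fun do rewrite mxE.
exact: measurable_coord.
Qed.

Context (mu : {sigma_finite_measure set 'rV[R]_n -> \bar R}).

Definition lebesgue_step : set 'rV[R]_n.+1 -> \bar R :=
  pushforward (lebesgue_measure \x mu)%E
    (rV_cons : measurableTypeR R * 'rV[R]_n -> 'rV[R]_n.+1).

Let measurable_preimage_cons (A : set 'rV[R]_n.+1) :
  measurable A -> measurable (rV_cons @^-1` A).
Proof. by move=> mA; rewrite -[X in measurable X]setTI; exact: measurable_rV_cons. Qed.

Let lebesgue_step0 : lebesgue_step set0 = 0%E.
Proof. by rewrite /lebesgue_step /pushforward preimage_set0 measure0. Qed.

Let lebesgue_step_ge0 A : (0 <= lebesgue_step A)%E.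
Proof. by rewrite /lebesgue_step /pushforward; exact: measure_ge0. Qed.

Let lebesgue_step_sigma_additive : semi_sigma_additive lebesgue_step.
Proof.
move=> F mF tF mUF; rewrite /lebesgue_step /pushforward preimage_bigcup.
apply: measure_semi_sigma_additive.
- by move=> k; exact: measurable_preimage_cons.
- apply/trivIsetP => /= i j _ _ ij; rewrite -preimage_setI.
  by move/trivIsetP : tF => /(_ _ _ _ _ ij) ->//; rewrite preimage_set0.
- by rewrite -preimage_bigcup; exact: measurable_preimage_cons.
Qed.

HB.instance Definition _ := isMeasure.Build _ _ _ lebesgue_step
  lebesgue_step0 lebesgue_step_ge0 lebesgue_step_sigma_additive.

Let lebesgue_step_sigma_finite : sigma_finite setT lebesgue_step.
Proof.
have /sigma_finiteP[F [TF ndF Foo]] := sigma_finiteT (@lebesgue_measure R).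
have /sigma_finiteP[G [TG ndG Goo]] := sigma_finiteT mu.
exists (fun k => rV_uncons @^-1` (F k `*` G k)).
  rewrite -preimage_bigcup -[LHS](preimage_setT rV_uncons); congr (_ @^-1` _).
  rewrite -setXTT TF TG predeqE => -[x y]; split.
    move=> [/= [a _ Fax] [b _ Gby]]; exists (maxn a b) => //; split.
    - by move: x Fax; exact/subsetPset/ndF/leq_maxl.
    - by move: y Gby; exact/subsetPset/ndG/leq_maxr.
  by move=> [a _ []/= ? ?]; split; exists a.
move=> k; have [mFk Fkoo] := Foo k; have [mGk Gkoo] := Goo k; split.
  rewrite -[X in measurable X]setTI; apply: measurable_rV_uncons => //.
  exact: measurableX.
rewrite /lebesgue_step /pushforward -comp_preimage.
rewrite (_ : rV_uncons \o rV_cons = id); last by apply/funext => x; exact: rV_consK.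
rewrite preimage_id product_measure1E//.
by rewrite lte_mul_pinfty// ge0_fin_numE.
Qed.

HB.instance Definition _ := Measure_isSigmaFinite.Build _ _ _ lebesgue_step
  lebesgue_step_sigma_finite.

End lebesgue_step.

Section lebesgue_rV.
Context (R : realType).

Fixpoint lebesgue_rV (n : nat) : {sigma_finite_measure set 'rV[R]_n -> \bar R} :=
  match n with
  | 0 => (\d_(0 : 'rV[R]_0) : {sigma_finite_measure set 'rV[R]_0 -> \bar R})
  | n'.+1 => (lebesgue_step (lebesgue_rV n') :
               {sigma_finite_measure set 'rV[R]_n'.+1 -> \bar R})
  end.

Lemma lebesgue_rV_box n (A : 'I_n -> set R) :
  (forall i, measurable (A i : set (measurableTypeR R))) ->
  lebesgue_rV n [set x | forall i, A i (x ord0 i)] =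
  (\prod_(i < n) lebesgue_measure (A i))%E.
Proof.
elim: n A => [|n IH] A mA /=.
  by rewrite big_ord0 diracE mem_set// => -[].
rewrite big_ord_recl -(IH (fun i => A (lift ord0 i)))//.
rewrite /lebesgue_step /pushforward.
pose B := [set x : 'rV[R]_n | forall i, A (lift ord0 i) (x ord0 i)].
rewrite -[X in (_ * X)%E]/(lebesgue_rV n B).
rewrite (_ : _ @^-1` _ = A ord0 `*` B); last first.
  apply/seteqP; split=> [[a v] /= Av|[a v] /= [Aa Bv] i].
    split=> /=; first by have := Av ord0; rewrite rV_cons0.
    by move=> i; have := Av (lift ord0 i); rewrite rV_consS.
  have [j ->|->] := unliftP ord0 i; last by rewrite rV_cons0.
  by rewrite rV_consS.
rewrite product_measure1E//.
rewrite (_ : B = \bigcap_(i in [set: 'I_n]) ((fun x : 'rV[R]_n => x ord0 i) @^-1` A (lift ord0 i))).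
  apply: fin_bigcap_measurable => // i _.
  by rewrite -[X in measurable X]setTI; apply: measurable_coord => //; exact: mA.
by apply/seteqP; split=> x Bx i; [move=> _; exact: Bx|exact: (Bx i I)].
Qed.

Lemma measurable_rVE n :
  (measurable : set (set 'rV[R]_n)) = <<s (@open 'rV[R]_n) >>.
Proof.
apply/seteqP; split; last first.
  apply: smallest_sub; first exact: sigma_algebra_measurable.
  move=> O oO.
  pose rv (q : 'rV[rat]_n) : 'rV[R]_n := \row_i ratr (q ord0 i).
  pose F (qk : 'rV[rat]_n * nat) : set 'rV[R]_n :=
    if `[< ball (rv qk.1) qk.2.+1%:R^-1 `<=` O >]
    then ball (rv qk.1) qk.2.+1%:R^-1 else set0.
  have -> : O = \bigcup_qk F qk.
    apply/seteqP; split=> [x Ox|x [qk _]]; last first.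
      by rewrite /F; case: asboolP => // + xqk; exact.
    have /nbhs_ballP[e /= e0 xeO] := open_nbhs_nbhs (conj oO Ox).
    have [k _ ke] : exists2 k, True & k.+1%:R^-1 < e / 2 :> R.
      by have [k] := near_infty_natSinv_lt (PosNum (divr_gt0 e0 (ltr0n R 2)));
        move=> _ /(_ k (leqnn k)) /= ?; exists k.
    have k0 : 0 < k.+1%:R^-1 :> R by rewrite invr_gt0.
    have xq i : {q : rat | x ord0 i - k.+1%:R^-1 < ratr q < x ord0 i + k.+1%:R^-1}.
      apply: cid; have [|q] := @rat_in_itvoo R (x ord0 i - k.+1%:R^-1) (x ord0 i + k.+1%:R^-1).
        by rewrite ltrBlDr -addrA ltrDl addr_gt0.
      by rewrite in_itv/=; exists q.
    exists (\row_i sval (xq i), k) => //; rewrite /F /=.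
    have bx : ball (rv (\row_i sval (xq i))) k.+1%:R^-1 x.
      split=> // a i; rewrite !mxE (ord1 a) /ball /= distrC ltr_distlC.
      by case: (xq i).
    rewrite asboolT// => y xy; apply: xeO.
    by rewrite [e]splitr; apply: ball_triangle; apply: le_ball (ltW ke) _ _;
      [exact: ball_sym bx|exact: xy].
  apply: countable_bigcupT_measurable => [|[q k]]; first exact: countableP.
  rewrite /F; case: ifP => _; last exact: measurable0.
  set e := (_%:R^-1 : R).
  rewrite (_ : ball _ _ = \bigcap_(i in [set: 'I_n])
      ((fun x : 'rV[R]_n => x ord0 i) @^-1` ball (rv q ord0 i) e)).
    apply: fin_bigcap_measurable => // i _.
    rewrite -[X in measurable X]setTI; apply: measurable_coord => //.
  by rewrite ball_itv; exact: measurable_itv.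
  apply/seteqP; split=> [x [_ qx] i _|x qx]; first exact: qx.
  by split=> [|a i]; [rewrite invr_gt0|rewrite (ord1 a); exact: qx].
apply: smallest_sub; first exact: smallest_sigma_algebra.
move=> A; rewrite -bigcup_seq => -[i _ [B mB <-]]; rewrite setTI /=.
have := @measurability _ _ (g_sigma_algebraType (@open 'rV[R]_n)) (measurableTypeR R)
  setT (@rV_coord R n i) _ (RGenOpens.measurableE R) .
move=> /(_ _) => H; rewrite -[X in _ X]setTI; apply: H => //.
move=> _ [_ [a [b ->] <-]]; rewrite setTI.
apply: sub_sigma_algebra; apply: open_comp.
  by move=> x _; exact: coord_continuous.
exact: interval_open.
Qed.

End lebesgue_rV.

(* [a I] is the coefficient of dx^{i_1} /\ ... /\ dx^{i_k}, where
   I = {i_1 < ... < i_k}. *)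
Definition ext (R : realType) (n : nat) := {ffun {set 'I_n} -> R}.

Section exterior_algebra.
Context {R : realType} {n : nat}.
Implicit Types (a b : ext R n) (I J K : {set 'I_n}).

Definition ext_homog (k : nat) a := forall I, #|I| != k -> a I = 0.

(* Parity of the permutation sorting the concatenation of I and J: the sign in
   dx^I /\ dx^J = (-1)^(inversions I J) dx^(I :|: J), for disjoint I and J. *)
Definition inversions I J : nat :=
  #|[set p : 'I_n * 'I_n | [&& p.1 \in I, p.2 \in J & (p.2 < p.1)%N]]%SET|.

Definition wedge a b : ext R n :=
  [ffun K : {set 'I_n} => \sum_(I : {set 'I_n} | I \subset K)
    (-1) ^+ inversions I (K :\: I) * a I * b (K :\: I)].

Definition ext_one : ext R n := [ffun I : {set 'I_n} => (I == finset.set0)%:R].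

Definition dcoord (i : 'I_n) : ext R n := [ffun I : {set 'I_n} => (I == [set i]%SET)%:R].

(* The Euclidean norm for which the dx^I are orthonormal. *)
Definition ext_norm a : R := Num.sqrt (\sum_(I : {set 'I_n}) a I ^+ 2).

Definition ext_comp (k : nat) a : ext R n :=
  [ffun I : {set 'I_n} => if #|I| == k then a I else 0].

End exterior_algebra.

Section smooth.
Context {R : realType} {n : nat}.
Implicit Types (O : set 'rV[R]_n) (g : 'rV[R]_n -> R) (w : 'rV[R]_n -> ext R n).

Definition basis_vec (i : 'I_n) : 'rV[R]_n := delta_mx ord0 i.

Fixpoint Cr (r : nat) O g : Prop :=
  {in O, continuous g} /\
  if r is r'.+1 then
    forall i : 'I_n, (forall x, O x -> derivable g x (basis_vec i)) /\
                     Cr r' O (fun x => 'D_(basis_vec i) g x)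
  else True.

(* Meaningful for O open: derivatives are taken in the ambient space. *)
Definition smooth_on O g := forall r, Cr r O g.

Definition smooth_form_on O (k : nat) w :=
  (forall x, O x -> ext_homog k (w x)) /\
  (forall I, smooth_on O (fun x => w x I)).

Definition partial_form (i : 'I_n) w (x : 'rV[R]_n) : ext R n :=
  [ffun I : {set 'I_n} => 'D_(basis_vec i) (fun y => w y I) x].

Definition extd w (x : 'rV[R]_n) : ext R n :=
  \sum_(i < n) wedge (dcoord i) (partial_form i w x).

Definition compact_support_in (W : set 'rV[R]_n) w :=
  exists K, [/\ compact K, K `<=` W & forall x, ~ K x -> w x = 0].

End smooth.

Section weak_forms.
Context {R : realType} {n : nat}.
Implicit Types (U W : set 'rV[R]_n) (w phi theta : 'rV[R]_n -> ext R n).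

Local Notation leb := (lebesgue_rV R n).

Definition measurable_form U (k : nat) w :=
  (forall x, U x -> ext_homog k (w x)) /\
  (forall I, measurable_fun U (fun x => w x I : measurableTypeR R)).

Definition Lp_form U (p : \bar R) (k : nat) w :=
  measurable_form U k w /\
  (Lnorm leb p ((fun x => (ext_norm (w x))%:E) \_ U) < +oo)%E.

Definition L1loc_form U (k : nat) w :=
  measurable_form U k w /\
  forall K, compact K -> K `<=` U ->
    (\int[leb]_(x in K) (ext_norm (w x))%:E < +oo)%E.

(* An orientation of the open set W, compared with the standard one. *)
Definition orientation W (o : 'rV[R]_n -> R) :=
  {in W, continuous o} /\ forall x, W x -> o x = 1 \/ o x = -1.

(* The integral over W, oriented by o, of the degree-n part of w. *)
Definition form_integral W (o : 'rV[R]_n -> R) w : \bar R :=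
  (\int[leb]_(x in W) (o x * w x [set: 'I_n]%SET)%:E)%E.

(* For k >= n there are no test forms, and theta = 0 on U by homogeneity. *)
Definition weak_d U (k : nat) phi theta :=
  [/\ L1loc_form U k phi,
      L1loc_form U k.+1 theta &
      forall (W : set 'rV[R]_n) (o : 'rV[R]_n -> R) (l : nat)
        (w : 'rV[R]_n -> ext R n),
        open W -> W `<=` U -> orientation W o ->
        (k + l.+1)%N = n ->
        smooth_form_on [set: 'rV[R]_n] l w -> compact_support_in W w ->
        form_integral W o (fun x => wedge (theta x) (w x)) =
        ((-1) ^+ k.+1)%:E *
          form_integral W o (fun x => wedge (phi x) (extd w x))]%E.

(* The exponent n / k, with n / 0 = +oo. *)
Definition conf_exponent (k : nat) : \bar R :=
  if k == 0%N then +oo%E else (n%:R / k%:R)%:E.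

Definition Omega_conf U (k : nat) w :=
  Lp_form U (conf_exponent k) k w /\
  ((k < n)%N -> exists theta,
     weak_d U k w theta /\ Lp_form U (conf_exponent k.+1) k.+1 theta).

(* The direct sum of the [Omega_conf U k], inside forms of mixed degree. *)
Definition Omega_conf_sum U w :=
  forall k, (k <= n)%N -> Omega_conf U k (fun x => ext_comp k (w x)).

Definition form0 (g : 'rV[R]_n -> R) (x : 'rV[R]_n) : ext R n :=
  [ffun I : {set 'I_n} => if I == finset.set0 then g x else 0].

End weak_forms.

Section sobolev.
Context {R : realType} {n m : nat}.

Definition bounded_domain (p : nat) (U : set 'rV[R]_p) :=
  [/\ open U, connected U, U !=set0 & bounded_set U].

(* f is in W^{1,n}(U, V), and df j is a representative of the weak differential
   of its j-th component. *)
Definition W1n (U : set 'rV[R]_n) (V : set 'rV[R]_m) (f : 'rV[R]_n -> 'rV[R]_m)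
    (df : 'I_m -> 'rV[R]_n -> ext R n) :=
  [/\ measurable_fun U f,
      (forall x, U x -> V (f x)) &
      forall j, [/\ Lp_form U n%:R%:E 0 (form0 (fun x => f x ord0 j)),
                    weak_d U 0 (form0 (fun x => f x ord0 j)) (df j) &
                    Lp_form U n%:R%:E 1 (df j)]].

(* [enum I] lists I in increasing order. *)
Definition pullback (f : 'rV[R]_n -> 'rV[R]_m) (df : 'I_m -> 'rV[R]_n -> ext R n)
    (b : 'rV[R]_m -> ext R m) (x : 'rV[R]_n) : ext R n :=
  [ffun K : {set 'I_n} => \sum_(I : {set 'I_m})
    b (f x) I * foldr wedge ext_one [seq df j x | j <- enum I] K].

End sobolev.

(* Main.v *)
Require Import Defs.
From HB Require Import structures.
From mathcomp Require Import all_boot all_order all_algebra.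
From mathcomp Require Import all_classical all_reals all_analysis.
From mathcomp Require Import measurable_realfun ess_sup_inf ring lra.

(** Write f = (f^1, ..., f^m) and let G = 1 + |df^1| + ... + |df^m|. Since U is
bounded, G lies in L^n(U); since V is bounded, so is each f^j. Every form of
degree k that occurs below is at most a multiple of G^k ([growth]), hence lies in
L^(n/k), and the product of a form of degree j and one of degree k has the
growth expected in degree j + k. This is the reason for the exponents n/k, and
it makes every integral below absolutely convergent ([W1n_growth]).

A weak differential can be tested on the forms psi dx^(~: J), with psi a smooth
compactly supported function. In terms of coefficients this is an integration
by parts formula without orientations or wedge products, [coef_weak_d]. It is
equivalent to [weak_d] ([weak_d_coef] and [coef_weak_d_weak_d]) because an
orientation is locally constant, and so can be absorbed into the test form.

Three facts about [coef_weak_d] carry the proof.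
- The Leibniz rule [coef_weak_d_mul]: if u is bounded, |du| is at most a
  multiple of G, and phi and d phi have the growth of degrees k < n and k + 1,
  then d (u phi) = du /\ phi + u d phi. For smooth u this is the hypothesis on
  phi tested against u psi. In general u is replaced by its mollifications
  rho_l * u. By Jensen's inequality |d (rho_l * u)|^n is at most
  rho_l * |du|^n, which converges in L1, so that a subsequence has an
  integrable majorant ([mollification_sequence]) and dominated convergence
  applies.
- d d = 0 ([coef_weak_d_closed]), by the symmetry of the second derivatives of
  test functions.
- The chain rule for b o f with b smooth and compactly supported
  ([weak_partial_comp]), again by mollifying f. A function that is smooth near
  the compact closure of V agrees near that closure with such a b
  ([smooth_extension]), so the rule applies to the coefficients of beta.

The form df^I = df^(i_1) /\ ... /\ df^(i_k) is closed by induction on k: it is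
the differential of f^(i_1) df^(i_2) /\ ... /\ df^(i_k), by the Leibniz rule,
and d d = 0 ([coef_weak_d_diff_prod]). If beta is the sum of the b_I dy^I, then
the Leibniz rule with u = b_I o f and phi = df^I, together with the chain rule,
gives d (f^* beta) as the sum over I and j of the terms
(d_j b_I) o f df^j /\ df^I, and this is f^* (d beta) once the one-forms
df^j /\ df^I are sorted ([wedge_wprod_enum], [coef_weak_d_pullback]). The
integrability of f^* beta and of f^* (d beta) is their growth in degrees k and
k + 1. In degree n there is nothing to test, and in degrees above n the
pull-back vanishes on U. *)

Set Implicit Arguments.
Unset Strict Implicit.
Unset Printing Implicit Defensive.

Import Order.TTheory GRing.Theory Num.Theory.
Import numFieldNormedType.Exports.

Local Open Scope classical_set_scope.
Local Open Scope ring_scope.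


(** * Lebesgue measure on row vectors *)

Section measure_basics.
Context {R : realType} {n : nat}.
Implicit Types (U K : set 'rV[R]_n) (g : 'rV[R]_n -> R).

Lemma measurable_open_rV U : open U -> measurable U.
Proof. by move=> oU; rewrite measurable_rVE; exact: sub_sigma_algebra. Qed.

Lemma measurable_closed_rV K : closed K -> measurable K.
Proof.
by move=> cK; rewrite -(setCK K); apply: measurableC; apply: measurable_open_rV; exact: closed_openC.
Qed.

Lemma compact_closed_rV K : compact K -> closed K.
Proof. by apply: compact_closed; exact: norm_hausdorff. Qed.

Lemma measurable_compact_rV K : compact K -> measurable K.
Proof. by move=> /compact_closed_rV/measurable_closed_rV. Qed.

Lemma measurable_continuous_rV g : continuous g -> measurable_fun setT g.
Proof.
move=> cg.
have := @measurability _ _ _ (measurableTypeR R) setT g _ (RGenOpens.measurableE R).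
apply => //.
move=> _ [_ [a [b ->] <-]]; rewrite setTI.
apply: measurable_open_rV; apply: open_comp; last exact: interval_open.
by move=> x _; exact: cg.
Qed.

Lemma measurable_addr (a : 'rV[R]_n) : measurable_fun setT (fun x : 'rV[R]_n => x + a).
Proof.
apply/measurable_fun_rVP => i; under eq_fun do rewrite mxE.
by apply: measurable_funD => //; exact: measurable_coord.
Qed.

End measure_basics.

Section translation.
Context {R : realType}.

(** A shift preserves the lengths of intervals, which determine Lebesgue measure. *)
Lemma lebesgue_shift_set (a : R) (A : set R) : measurable A ->
  lebesgue_measure ((fun x => x + a) @^-1` A) = lebesgue_measure A.
Proof.
pose f (x : measurableTypeR R) : measurableTypeR R := x + a.
have mf : measurable_fun setT f by apply: measurable_funD.
pose m := measure_function_pushforward__canonical__measure_function_Measure lebesgue_measure mf.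
move=> mA; rewrite [RHS](@lebesgue_measure_unique R m)// => X [[b c] _ <-]/=.
rewrite /m /= /pushforward.
have -> : f @^-1` `]b, c] = `]b - a, c - a]%classic.
  by apply/seteqP; split=> x; rewrite /f /= !in_itv/= ltrBlDr lerBrDr.
rewrite !lebesgue_measure_itv/= !lte_fin ltrD2r.
by case: ifP => // _; rewrite -!EFinB; congr (_%:E); ring.
Qed.

Lemma lebesgue_shift (a : R) (F : R -> \bar R) : measurable_fun setT F ->
  (forall x, 0 <= F x)%E ->
  (\int[lebesgue_measure]_x F (x + a)%R = \int[lebesgue_measure]_x F x)%E.
Proof.
move=> mF F0.
pose f (x : measurableTypeR R) : measurableTypeR R := x + a.
have mf : measurable_fun setT f by apply: measurable_funD.
rewrite -[LHS](ge0_integral_pushforward mf _ measurableT mF)//.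
apply: eq_measure_integral => A mA _; exact: lebesgue_shift_set.
Qed.

Lemma lebesgue_rV_ge0_integralS n (F : 'rV[R]_n.+1 -> \bar R) :
  measurable_fun setT F -> (forall x, 0 <= F x)%E ->
  (\int[lebesgue_rV R n.+1]_x F x =
   \int[lebesgue_measure]_t \int[lebesgue_rV R n]_v F (rV_cons (t, v)))%E.
Proof.
move=> mF F0.
rewrite [LHS](ge0_integral_pushforward (@measurable_rV_cons R n) _ measurableT mF)//.
rewrite preimage_setT fubini_tonelli1//; last by move=> x; exact: F0.
by apply: measurableT_comp => //; exact: measurable_rV_cons.
Qed.

Lemma rV_cons_add n (t : R) (v : 'rV[R]_n) (a : 'rV[R]_n.+1) :
  rV_cons (t, v) + a = rV_cons (t + (rV_uncons a).1, v + (rV_uncons a).2).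
Proof.
apply/rowP => i; rewrite mxE; have [j ->|->] := unliftP ord0 i.
  by rewrite !rV_consS /= !mxE.
by rewrite !rV_cons0 /=.
Qed.

(** The measure is an iterated product, so that each coordinate can be translated
in turn. *)
Lemma lebesgue_rV_shift n (a : 'rV[R]_n) (F : 'rV[R]_n -> \bar R) :
  measurable_fun setT F -> (forall x, 0 <= F x)%E ->
  (\int[lebesgue_rV R n]_x F (x + a)%R = \int[lebesgue_rV R n]_x F x)%E.
Proof.
elim: n a F => [|n IH] a F mF F0.
  by apply: eq_integral => x _; congr F; apply/rowP => -[].
rewrite !lebesgue_rV_ge0_integralS//; last first.
  by apply: measurableT_comp => //; exact: measurable_addr.
pose b := (rV_uncons a).1; pose w := (rV_uncons a).2.
pose G t := (\int[lebesgue_rV R n]_v F (rV_cons (t, v)))%E.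
have mFc : measurable_fun setT (fun z : measurableTypeR R * 'rV[R]_n => F (rV_cons z)).
  by apply: measurableT_comp => //; exact: measurable_rV_cons.
have mG : measurable_fun setT G.
  exact: (measurable_fun_fubini_tonelli_F (fun z => F (rV_cons z))).
have G0 t : (0 <= G t)%E by exact: integral_ge0.
rewrite -(lebesgue_shift b mG G0); apply: eq_integral => t _.
rewrite /G -[RHS](IH w); last 2 first.
- exact: (measurableT_comp mFc (pair1_measurable _)).
- by [].
by apply: eq_integral => v _; rewrite rV_cons_add.
Qed.

End translation.

(** * Functions of class C^r *)

Section directional_derivatives.
Context {R : realType} {n : nat}.
Implicit Types (g h : 'rV[R]_n -> R) (x v : 'rV[R]_n).

(** Reduces directional derivatives to derivatives of functions of one variable. *)
Lemma is_derive_line g x v (t d : R) :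
  is_derive (x + t *: v) v g d <-> is_derive t 1 (fun s : R => g (x + s *: v)) d.
Proof.
have E : (fun h : R => h^-1 *: ((g \o shift (x + t *: v)) (h *: v) - g (x + t *: v)))
  = (fun h : R => h^-1 *: (((fun s : R => g (x + s *: v)) \o shift t) (h *: 1)
       - (fun s : R => g (x + s *: v)) t)).
  apply/funext => k /=; congr (_ *: (g _ - _)).
  by rewrite addrCA scalerDl scaler1.
split=> -[H1 H2]; split; rewrite /derivable /derive in H1 H2 *.
- by rewrite -E.
- by rewrite -E.
- by rewrite E.
- by rewrite E.
Qed.

Lemma is_derive_comp (eta : R -> R) g x v (a b : R) :
  is_derive (g x) 1 eta a -> is_derive x v g b ->
  is_derive x v (eta \o g) (a * b).
Proof.
move=> ea gb.
have := @is_derive_line (eta \o g) x v 0 (a * b).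
rewrite scale0r addr0 => ->.
apply: (@is_derive1_comp _ eta (fun s => g (x + s *: v))).
  by rewrite scale0r addr0.
by apply/(is_derive_line g x v 0 b); rewrite scale0r addr0.
Qed.

Lemma MVT_line g (dg : 'rV[R]_n -> R) x v (t : R) :
  (forall s, is_derive (x + s *: v) v g (dg (x + s *: v))) ->
  exists2 s, `|s| <= `|t| & g (x + t *: v) - g x = dg (x + s *: v) * t.
Proof.
move=> gd; pose G s := g (x + s *: v); pose dG s := dg (x + s *: v).
have Gd (s : R) : is_derive s 1 G (dG s) by apply/is_derive_line.
have Gc (a b : R) : {within `[a, b], continuous G}.
  apply: continuous_subspaceT => s; apply: differentiable_continuous.
  by apply/derivable1_diffP; case: (Gd s).
have -> : g x = G 0 by rewrite /G scale0r addr0.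
have [t0|t0] := leP 0 t.
  have [c] := MVT_segment t0 (fun s _ => Gd s) (Gc _ _).
  rewrite in_itv/= => /andP[c0 ct] E; exists c; first by rewrite !ger0_norm.
  by rewrite E subr0.
have [c] := MVT_segment (ltW t0) (fun s _ => Gd s) (Gc _ _).
rewrite in_itv/= => /andP[c0 ct] E; exists c; first by rewrite !ler0_norm ?lerN2// ltW.
by rewrite -[LHS]opprB E sub0r mulrN opprK.
Qed.

End directional_derivatives.

Section Cr_theory.
Context {R : realType} {n : nat}.
Implicit Types (O W : set 'rV[R]_n) (g h : 'rV[R]_n -> R) (r : nat).

Local Notation e_ := (@basis_vec R n).

Lemma Cr_continuous r O g : Cr r O g -> forall x, O x -> {for x, continuous g}.
Proof. by case: r => [|r] [cg _] x Ox; apply: cg; exact: mem_set. Qed.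

Lemma Cr_derive r O g : Cr r.+1 O g ->
  forall i x, O x -> is_derive x (e_ i) g ('D_(e_ i) g x).
Proof. by move=> [_ dg] i x Ox; have [d _] := dg i; exact/derivableP/d. Qed.

(** This allows smooth functions to be defined by cases. *)
Lemma Cr_local r O g :
  (forall x, O x -> exists W h, [/\ open W, W x, Cr r W h & {in W, g =1 h}]) ->
  Cr r O g.
Proof.
have near_gh (f h : 'rV[R]_n -> R) (x : 'rV[R]_n) W :
    open W -> W x -> {in W, f =1 h} -> \forall y \near x, f y = h y.
  move=> oW Wx fh; apply: filterS (open_nbhs_nbhs (conj oW Wx)) => y Wy.
  by apply: fh; exact: mem_set.
have near_hg (f h : 'rV[R]_n -> R) (x : 'rV[R]_n) W :
    open W -> W x -> {in W, f =1 h} -> \forall y \near x, h y = f y.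
  by move=> oW Wx fh; apply: (near_gh _ _ _ W) => // y Wy; rewrite fh.
elim: r O g => [|r IH] O g loc.
  split=> // x /set_mem/loc[W [h [oW Wx ch gh]]].
  have gx : g x = h x by apply: gh; exact: mem_set.
  have hc : h y @[y --> x] --> h x := Cr_continuous ch Wx.
  rewrite /continuous_at gx.
  exact: (cvg_trans (near_eq_cvg (near_hg _ _ _ _ oW Wx gh)) hc).
split=> [x /set_mem/loc[W [h [oW Wx ch gh]]]|i].
  have gx : g x = h x by apply: gh; exact: mem_set.
  have hc : h y @[y --> x] --> h x := Cr_continuous ch Wx.
  rewrite /continuous_at gx.
  exact: (cvg_trans (near_eq_cvg (near_hg _ _ _ _ oW Wx gh)) hc).
split=> [x /loc[W [h [oW Wx ch gh]]]|].
  have [hd _] := Cr_derive ch i Wx.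
  apply: near_eq_derivable hd.
  exact: (near_hg _ _ _ _ oW Wx gh).
apply: IH => x /loc[W [h [oW Wx ch gh]]].
exists W, (fun x => 'D_(e_ i) h x); split=> //.
  by case: ch => _ /(_ i)[].
by move=> y /set_mem Wy; apply: near_eq_derive; exact: (near_gh _ _ _ _ oW Wy gh).
Qed.

Lemma eq_Cr r O g h : open O -> {in O, g =1 h} -> Cr r O h -> Cr r O g.
Proof. by move=> oO gh ch; apply: Cr_local => x Ox; exists O, h. Qed.

(** The converse of [Cr_derive]: the partial derivatives may be given by any
expression, of which only the regularity on O has to be known. *)
Lemma CrS r O g (dg : 'I_n -> 'rV[R]_n -> R) : open O ->
  {in O, continuous g} ->
  (forall i x, O x -> is_derive x (e_ i) g (dg i x)) ->
  (forall i, Cr r O (dg i)) -> Cr r.+1 O g.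
Proof.
move=> oO cg gd cd; split=> // i; split=> [x Ox|]; first by case: (gd i x Ox).
by apply: eq_Cr oO _ (cd i) => x /set_mem Ox; case: (gd i x Ox).
Qed.

Lemma CrW r O g : Cr r.+1 O g -> Cr r O g.
Proof.
elim: r g => [|r IH] g [cg dg]; split=> // i; have [d1 d2] := dg i.
by split=> //; exact: IH.
Qed.

Lemma Cr_cst r O (c : R) : open O -> Cr r O (fun=> c).
Proof.
move=> oO; elim: r c => [|r IH] c.
  by split=> // x xO; exact: cst_continuous.
apply: (@CrS _ _ _ (fun _ _ => 0) oO).
- by move=> x _; exact: cst_continuous.
- by move=> i; exact (IH 0).
Qed.

Lemma CrD r O g h : open O -> Cr r O g -> Cr r O h -> Cr r O (fun x => g x + h x).
Proof.
move=> oO; elim: r g h => [|r IH] g h cg ch.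
  split=> // x /set_mem Ox.
  exact: (cvgD (Cr_continuous cg Ox) (Cr_continuous ch Ox)).
apply: (@CrS _ _ _ (fun i x => 'D_(e_ i) g x + 'D_(e_ i) h x) oO) => [x /set_mem Ox|i x Ox|i].
- exact: (cvgD (Cr_continuous cg Ox) (Cr_continuous ch Ox)).
- by apply: is_deriveD; [exact: (Cr_derive cg _ Ox)|exact: (Cr_derive ch _ Ox)].
- by apply: IH; [case: cg => _ /(_ i)[]|case: ch => _ /(_ i)[]].
Qed.

Lemma is_deriveM_rV g h (x v : 'rV[R]_n) (a b : R) :
  is_derive x v g a -> is_derive x v h b ->
  is_derive x v (fun y => g y * h y) (g x * b + a * h x).
Proof. by move=> ga hb; have := is_deriveM ga hb; rewrite /GRing.scale/= [h x * a]mulrC. Qed.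

Lemma CrM r O g h : open O -> Cr r O g -> Cr r O h -> Cr r O (fun x => g x * h x).
Proof.
move=> oO; elim: r g h => [|r IH] g h cg ch.
  split=> // x /set_mem Ox.
  exact: (cvgM (Cr_continuous cg Ox) (Cr_continuous ch Ox)).
apply: (@CrS _ _ _ (fun i x => g x * 'D_(e_ i) h x + 'D_(e_ i) g x * h x) oO) =>
  [x /set_mem Ox|i x Ox|i].
- exact: (cvgM (Cr_continuous cg Ox) (Cr_continuous ch Ox)).
- by apply: is_deriveM_rV; [exact: (Cr_derive cg _ Ox)|exact: (Cr_derive ch _ Ox)].
- have cDg : Cr r O (fun x => 'D_(e_ i) g x) by case: cg => _ /(_ i)[].
  have cDh : Cr r O (fun x => 'D_(e_ i) h x) by case: ch => _ /(_ i)[].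
  by apply: CrD => //; apply: IH => //; exact: CrW.
Qed.

Lemma Cr_sum r O (I : Type) (s : seq I) (P : pred I) (g : I -> 'rV[R]_n -> R) :
  open O -> (forall i, Cr r O (g i)) -> Cr r O (fun x => \sum_(i <- s | P i) g i x).
Proof.
move=> oO cg; elim: s => [|i s IH].
  by under eq_fun do rewrite big_nil; exact: Cr_cst.
under eq_fun do rewrite big_cons.
by case: (P i) => //; exact: CrD.
Qed.

Lemma Cr_prod r O (I : Type) (s : seq I) (P : pred I) (g : I -> 'rV[R]_n -> R) :
  open O -> (forall i, Cr r O (g i)) -> Cr r O (fun x => \prod_(i <- s | P i) g i x).
Proof.
move=> oO cg; elim: s => [|i s IH].
  by under eq_fun do rewrite big_nil; exact: Cr_cst.
under eq_fun do rewrite big_cons.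
by case: (P i) => //; exact: CrM.
Qed.

Lemma is_derive_coord (i : 'I_n) (x v : 'rV[R]_n) :
  is_derive x v (fun y => y ord0 i) (v ord0 i).
Proof.
have := @is_derive_line R n (fun y => y ord0 i) x v 0 (v ord0 i).
rewrite scale0r addr0 => ->.
have -> : (fun s : R => (x + s *: v) ord0 i) = (fun s => x ord0 i + v ord0 i * s).
  by apply/funext => s; rewrite !mxE mulrC.
have := is_deriveD (is_derive_cst (x ord0 i) (0 : R) 1)
  (is_deriveZ (v ord0 i) (is_derive_id (0 : R) 1)).
by rewrite add0r scaler1.
Qed.

Lemma Cr_coord r O (i : 'I_n) : open O -> Cr r O (fun x => x ord0 i).
Proof.
move=> oO; case: r => [|r]; first by split=> // x _; exact: coord_continuous.
apply: (@CrS _ _ _ (fun j _ => e_ j ord0 i) oO) => [x _|j x Ox|j].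
- exact: coord_continuous.
- exact: is_derive_coord.
- exact: Cr_cst.
Qed.

(** The k-th derivative of [eta 0] is [eta k]. Giving the whole sequence lets the
induction on r pass from [eta k] to [eta k.+1]. *)
Lemma Cr_comp1 r O (eta : nat -> R -> R) g : open O ->
  (forall k (t : R), is_derive t 1 (eta k) (eta k.+1 t)) ->
  Cr r O g -> Cr r O (fun x => eta 0%N (g x)).
Proof.
move=> oO eta_d.
have eta_c k : continuous (eta k).
  move=> t; apply: differentiable_continuous.
  by apply/derivable1_diffP; case: (eta_d k t).
have cc s k : Cr s O g -> {in O, continuous (fun x => eta k (g x))}.
  move=> cg x /set_mem Ox; apply: continuous_comp; last exact: eta_c.
  exact: (Cr_continuous cg Ox).
suff H k : Cr r O g -> Cr r O (fun x => eta k (g x)) by exact: H.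
elim: r k => [|r IH] k cg; first by split=> //; exact: cc cg.
apply: (@CrS _ _ _ (fun i x => eta k.+1 (g x) * 'D_(e_ i) g x) oO) => [|i x Ox|i].
- exact: cc cg.
- exact: (@is_derive_comp _ _ (eta k) g) (Cr_derive cg i Ox).
- apply: CrM => //; last by case: cg => _ /(_ i)[].
  by apply: IH; exact: CrW.
Qed.

End Cr_theory.

(** * Smooth bumps *)

Section flat_function.
Context {R : realType}.
Implicit Types (p : {poly R}).

(** The functions p(1/x) exp(-1/x) on x > 0, extended by 0. Allowing a polynomial
factor makes the family stable under differentiation. *)
Definition flat p (x : R) : R :=
  if 0 < x then p.[x^-1] * expR (- x^-1) else 0.

(** The derivative of p(1/x) exp(-1/x) is x^(-2) (p - p')(1/x) exp(-1/x). *)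
Definition flat_next p : {poly R} := 'X^2 * (p - p^`()).

Lemma exprn_expR_le (k : nat) (y : R) : 0 <= y ->
  y ^+ k * expR (- y) <= k`!%:R.
Proof.
move=> y0; rewrite expRN ler_pdivrMr ?expR_gt0//.
case: k => [|k]; first by rewrite fact0 mul1r expr0 -[leLHS]expR0 ler_expR.
rewrite -ler_pdivrMl ?ltr0n ?fact_gt0// mulrC.
by apply: le_trans (expR_ge1Dxn k y0); rewrite lerDr.
Qed.

(** At 0, a quadratic bound is what differentiability requires. It comes from the
inequality y^k exp(-y) <= k! at y = 1/x. *)
Lemma flat_sqr_le p : exists2 C, 0 <= C & forall x, `|flat p x| <= C * x ^+ 2.
Proof.
exists (\sum_(i < size p) `|p`_i| * i.+2`!%:R).
  by apply: sumr_ge0 => i _; rewrite mulr_ge0.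
move=> x; rewrite /flat; case: ifPn => [x0|_]; last first.
  by rewrite normr0 mulr_ge0 ?sqr_ge0// sumr_ge0// => i _; rewrite mulr_ge0.
rewrite normrM (ger0_norm (expR_ge0 _)) -ler_pdivrMr ?exprn_gt0// mulrAC.
have y0 : 0 < x^-1 by rewrite invr_gt0.
set y := x^-1 in y0 *.
rewrite -[(x ^+ 2)^-1]exprVn -/y horner_coef.
apply: (@le_trans _ _ (\sum_(i < size p) `|p`_i| * y ^+ i * y ^+ 2 * expR (- y))).
  rewrite -!mulr_suml ler_wpM2r ?expR_ge0// ler_wpM2r ?exprn_ge0 ?(ltW y0)//.
  apply: le_trans (ler_norm_sum _ _ _) _; apply: ler_sum => i _.
  by rewrite normrM (ger0_norm (exprn_ge0 _ (ltW y0))).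
apply: ler_sum => i _; have -> : `|p`_i| * y ^+ i * y ^+ 2 * expR (- y) = `|p`_i| * (y ^+ i.+2 * expR (- y)).
  by rewrite -[in RHS]addn2 exprD; ring.
by rewrite ler_wpM2l// exprn_expR_le// ltW.
Qed.

Lemma is_derive_flat p (x : R) : is_derive x 1 (flat p) (flat (flat_next p) x).
Proof.
have [x0|x0|->] := ltgtP x 0.
- have -> : flat (flat_next p) x = 0 by rewrite /flat ltNge (ltW x0).
  apply: (near_eq_is_derive (f := fun=> (0:R))).
  near=> y; rewrite /flat ifN// -leNgt ltW//; near: y; exact: lt_nbhsl.
- have xn0 : x != 0 by rewrite gt_eqF.
  have dV : is_derive x 1 (fun y : R => y^-1) (- x ^- 2 *: 1).
    exact: (@is_deriveV _ id).
  have dN : is_derive x 1 (fun y : R => - y^-1) (- (- x ^- 2 *: 1)).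
    exact: is_deriveN.
  have d1 := @is_derive1_comp _ (horner p) (fun y => y^-1) x _ _ (is_derive_poly p x^-1) dV.
  have d2 := @is_derive1_comp _ expR (fun y => - y^-1) x _ _ (is_derive_expR (- x^-1)) dN.
  have dM : is_derive x 1 (fun y : R => p.[y^-1] * expR (- y^-1)) (flat (flat_next p) x).
    apply: is_derive_eq (is_deriveM d1 d2) _.
    rewrite /flat x0 /flat_next hornerM hornerXn hornerD hornerN /GRing.scale/=.
    by rewrite exprVn; ring.
  apply: near_eq_is_derive dM.
  by near=> y; rewrite /flat ifT//; near: y; exact: lt_nbhsr.
- have -> : flat (flat_next p) 0 = 0 by rewrite /flat ltxx.
  have [C C0 HC] := flat_sqr_le p.
  have lim0 : (fun h : R => h^-1 *: ((flat p \o shift 0) (h *: 1) - flat p 0)) @ 0^' --> (0 : R).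
    apply/cvgr0Pnorm_le => e e0; near=> h.
    have h0 : h != 0 by near: h; exact: nbhs_dnbhs_neq.
    rewrite /= addr0 scaler1 [flat p 0]/flat ltxx subr0 /GRing.scale/= normrM normfV.
    rewrite ler_pdivrMl ?normr_gt0//.
    apply: le_trans (HC h) _; rewrite -real_normK ?num_real//.
    have hC : `|h| <= e / (C + 1).
      near: h; apply: dnbhs0_le.
      by rewrite divr_gt0// ltr_wpDl.
    rewrite expr2 mulrCA ler_wpM2l// (le_trans (ler_wpM2l C0 hC))//.
    rewrite mulrCA -[leRHS]mulr1 ler_wpM2l ?(ltW e0)//.
    by rewrite ler_pdivrMr ?mul1r ?lerDl// ltr_wpDl.
  by split; [apply/cvg_ex; exists 0|apply: cvg_lim].
Unshelve. all: by end_near. Qed.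

End flat_function.

Section bumps.
Context {R : realType} {n : nat}.
Local Notation mu := (lebesgue_rV R n).

Lemma le_coord_norm (x : 'rV[R]_n) i : `|x ord0 i| <= `|x|.
Proof.
rewrite -[`|x|]/(mx_norm x) mx_normrE.
exact: (le_bigmax _ (fun ij : 'I_1 * 'I_n => `|x ij.1 ij.2|) (ord0, i)).
Qed.

Lemma norm_lt_coord (x : 'rV[R]_n) (r : R) : 0 < r ->
  (forall i, `|x ord0 i| < r) -> `|x| < r.
Proof.
move=> r0 h; rewrite -[`|x|]/(mx_norm x) mx_normrE.
by apply/bigmax_ltP; split=> // -[i j] _ /=; rewrite ord1.
Qed.

Lemma norm_le_coord (x : 'rV[R]_n) (r : R) : 0 <= r ->
  (forall i, `|x ord0 i| <= r) -> `|x| <= r.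
Proof.
move=> r0 h; rewrite -[`|x|]/(mx_norm x) mx_normrE.
by apply/bigmax_leP; split=> // -[i j] _ /=; rewrite ord1.
Qed.

Lemma lebesgue_cube (r : R) : 0 < r ->
  mu [set x | forall i, `|x ord0 i| < r] = ((r *+ 2) ^+ n)%:E.
Proof.
move=> r0.
rewrite [X in mu X](_ : _ =
    [set x : 'rV[R]_n | forall i, `]-r, r[%classic (x ord0 i)]); last first.
  by apply/seteqP; split=> x /= h i; have := h i; rewrite in_itv/= ltr_norml.
rewrite (@lebesgue_rV_box R n (fun=> `]-r, r[%classic))//.
rewrite lebesgue_measure_itv/= lte_fin gtrN// -EFinB opprK -mulr2n.
by rewrite prodEFin prodr_const card_ord.
Qed.

Lemma bounded_finite_measure (A : set 'rV[R]_n) :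
  bounded_set A -> measurable A -> (mu A < +oo)%E.
Proof.
move=> [M [_ HM]] mA.
have M0 : 0 < `|M| + 1 by rewrite ltr_wpDl.
have mN : M < `|M| + 1 by rewrite (le_lt_trans (ler_norm M)) ?ltrDl.
have lt2 : (0 < `|M| + 2 :> R) by rewrite ltr_wpDl.
apply: (@le_lt_trans _ _ (mu [set x | forall i, `|x ord0 i| < `|M| + 2])); last first.
  by rewrite lebesgue_cube// ltry.
apply: le_measure; rewrite ?inE//.
  rewrite [X in measurable X](_ : _ = \bigcap_(i in [set: 'I_n])
      ((fun x : 'rV[R]_n => `|x ord0 i|) @^-1` `]-oo, `|M| + 2[%classic)); last first.
    by apply/seteqP; split=> x /= h i; [move=> _; rewrite /= in_itv/= h|have := h i I; rewrite /= in_itv].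
  apply: fin_bigcap_measurable => // i _.
  rewrite -[X in measurable X]setTI.
  exact: (measurableT_comp (@normr_measurable R setT) (measurable_coord i)).
move=> x Ax i /=.
have := HM _ mN x Ax => /= xM; apply: (@le_lt_trans _ _ (`|M| + 1)); last by rewrite ltrD2l ltr1n.
by apply: le_trans xM; exact: le_coord_norm.
Qed.

(** The factors vanish unless all coordinates are smaller than r in absolute value,
so that the support is a ball of the sup norm. *)
Definition bump (r : R) (x : 'rV[R]_n) : R :=
  \prod_(i < n) flat 1 (r ^+ 2 - x ord0 i ^+ 2).

Lemma smooth_bump (r : R) : smooth_on setT (bump r).
Proof.
move=> k; apply: Cr_prod; first exact: openT.
move=> i; pose eta j : R -> R := flat (iter j flat_next 1).
apply: (@Cr_comp1 _ _ _ _ eta (fun x : 'rV[R]_n => r ^+ 2 - x ord0 i ^+ 2)).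
- exact: openT.
- by move=> j t; rewrite /eta iterS; exact: is_derive_flat.
- have -> : (fun x : 'rV[R]_n => r ^+ 2 - x ord0 i ^+ 2) =
     (fun x => r ^+ 2 + -1 * (x ord0 i * x ord0 i)).
    by apply/funext => x; rewrite expr2 [x _ _ ^+ 2]expr2 mulN1r.
  apply: CrD; [exact: openT|exact (Cr_cst _ _ openT)|].
  apply: CrM; [exact: openT|exact (Cr_cst _ _ openT)|].
  by apply: CrM; [exact: openT|exact (Cr_coord _ _ openT)..].
Qed.

Lemma flat1_ge0 (x : R) : 0 <= flat 1 x.
Proof. by rewrite /flat; case: ifP => // _; rewrite hornerC mul1r expR_ge0. Qed.

Lemma flat1_le1 (x : R) : flat 1 x <= 1.
Proof.
rewrite /flat; case: ifP => // x0; rewrite hornerC mul1r -expR0 ler_expR.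
by rewrite oppr_le0 invr_ge0 ltW.
Qed.

Lemma flat1_eq0 (x : R) : (flat 1 x == 0) = (x <= 0).
Proof.
rewrite /flat; case: ltP => [x0|]; last by rewrite eqxx.
by rewrite hornerC mul1r gt_eqF ?expR_gt0.
Qed.

Lemma bump_ge0 r x : 0 <= bump r x.
Proof. by apply: prodr_ge0 => i _; exact: flat1_ge0. Qed.

Lemma bump_neq0 r x : 0 < r -> (bump r x != 0) <-> (forall i, `|x ord0 i| < r).
Proof.
move=> r0; have E i : (flat 1 (r ^+ 2 - x ord0 i ^+ 2) != 0) = (`|x ord0 i| < r).
  rewrite flat1_eq0 subr_le0 -ltNge -(@real_normK _ (x ord0 i)) ?num_real//.
  by rewrite ltr_pXn2r// nnegrE// ltW.
split=> [/prodf_neq0 h i|h]; first by rewrite -E; exact: h.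
by apply/prodf_neq0 => i _; rewrite E.
Qed.

Lemma bumpN r x : bump r (- x) = bump r x.
Proof. by apply: eq_bigr => i _; rewrite mxE sqrrN. Qed.

Lemma smooth_continuous (g : 'rV[R]_n -> R) : smooth_on setT g -> continuous g.
Proof. by move=> /(_ 0%N) [cg _] x; apply: cg; rewrite inE. Qed.

(** Evenness gives [rho (x - y)] integral 1 as a function of y as well as of x, by
translation invariance alone. *)
Definition mollifier (r : R) (rho : 'rV[R]_n -> R) :=
  [/\ smooth_on setT rho, (forall x, 0 <= rho x), (forall x, rho (- x) = rho x),
      (forall x, rho x != 0 -> `|x| < r) &
      (\int[mu]_x (rho x)%:E = 1)%E].

(** The integral of the bump is positive, as the bump is positive on a cube of
positive measure, and finite, as the bump is at most 1. *)
Lemma exists_mollifier (r : R) : 0 < r -> exists rho, mollifier r rho.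
Proof.
move=> r0; pose Q := [set x : 'rV[R]_n | forall i, `|x ord0 i| < r].
have muQ : mu Q = ((r *+ 2) ^+ n)%:E := lebesgue_cube r0.
have mb : measurable_fun setT (bump r).
  by apply: measurable_continuous_rV; apply: smooth_continuous; exact: smooth_bump.
have mQ : measurable Q.
  have -> : Q = bump r @^-1` [set~ 0].
    by apply/seteqP; split=> x /=; [move=> h; apply/eqP/(bump_neq0 _ r0)|move=> /eqP/(bump_neq0 _ r0); apply].
  by rewrite -[X in measurable X]setTI; apply: mb => //; apply: measurableC.
pose J := (\int[mu]_x (bump r x)%:E)%E.
have b0 x : (0 <= (bump r x)%:E)%E by rewrite lee_fin bump_ge0.
have JE : J = (\int[mu]_(x in Q) (bump r x)%:E)%E.
  rewrite /J [in RHS]integral_mkcond; apply: eq_integral => x _.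
  rewrite patchE; case: ifPn => // /negP xQ.
  have [->//|/(bump_neq0 _ r0) h] := eqVneq (bump r x) 0.
  by exfalso; apply: xQ; rewrite inE; apply: h.
have Joo : (J < +oo)%E.
  rewrite JE; apply: (@le_lt_trans _ _ (\int[mu]_(x in Q) (cst 1 x)))%E.
    apply: ge0_le_integral => //.
    - by apply/measurable_EFinP; apply: measurable_funTS.
    - move=> x _; rewrite lee_fin; apply: prodr_ile1 => i _.
      by rewrite flat1_ge0 flat1_le1.
  by rewrite integral_cst// mul1e [ltLHS]muQ ltry.
(* a vanishing integral would make the cube Q negligible *)
have J0 : (0 < J)%E.
  rewrite lt_neqAle integral_ge0 ?andbT//; apply/eqP => J0.
  have : (\int[mu]_x `|(bump r x)%:E| = 0)%E.
    by rewrite J0; apply: eq_integral => x _; rewrite gee0_abs.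
  move/(ae_eq_integral_abs mu measurableT) => [|N [mN N0 sN]]; first exact/measurable_EFinP.
  have : (mu Q <= mu N)%E.
    apply: le_measure; rewrite ?inE// => x Qx; apply: sN => /= /(_ I) [].
    by apply/eqP/(bump_neq0 _ r0).
  by rewrite N0 muQ lee_fin leNgt exprn_gt0// pmulrn_lgt0.
pose c := fine J.
have JEc : J = c%:E by rewrite /c fineK// ge0_fin_numE// integral_ge0.
have c0 : 0 < c by rewrite -lte_fin -JEc.
exists (fun x => c^-1 * bump r x); split.
- move=> k; apply: CrM; [exact: openT|exact (Cr_cst _ _ openT)|exact: smooth_bump].
- by move=> x; rewrite mulr_ge0 ?invr_ge0 ?bump_ge0// ltW.
- by move=> x; rewrite bumpN.
- move=> x; rewrite mulf_eq0 negb_or => /andP[_ /(bump_neq0 _ r0) h].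
  by apply: norm_lt_coord => //; exact: h.
- under eq_integral do rewrite EFinM.
  rewrite ge0_integralZl//; last by rewrite lee_fin invr_ge0 ltW.
  + by rewrite -/J JEc -EFinM mulVf// gt_eqF.
  + exact/measurable_EFinP.
Qed.

End bumps.

(** * Mean value theorem and chain rule in several variables *)

Lemma cvg_sumr {R : realType} (T I : Type) (F : set_system T) {FF : Filter F}
    (s : seq I) (P : pred I) (f : I -> T -> R) (l : I -> R) :
  (forall i, f i x @[x --> F] --> l i) ->
  \sum_(i <- s | P i) f i x @[x --> F] --> \sum_(i <- s | P i) l i.
Proof.
move=> fl; elim: s => [|i s IH].
  by rewrite big_nil; under eq_fun do rewrite big_nil; exact: cvg_cst.
rewrite big_cons; under eq_fun do rewrite big_cons.
by case: (P i) => //; exact: cvgD.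
Qed.

Section mean_value.
Context {R : realType} {m : nat}.
Local Notation e_ := (@basis_vec R m).

(** Go from x to y along a path whose j-th edge is parallel to the j-th axis, and
apply the mean value theorem on every edge. *)
Lemma mean_value_rV (g : 'rV[R]_m -> R) (dg : 'I_m -> 'rV[R]_m -> R) :
  (forall i x, is_derive x (e_ i) g (dg i x)) ->
  forall x y, exists xi : 'I_m -> 'rV[R]_m,
    (forall j, `|xi j - x| <= `|y - x|) /\
    g y - g x = \sum_(j < m) dg j (xi j) * (y ord0 j - x ord0 j).
Proof.
move=> gd x y.
(* the j-th vertex: the first j coordinates are those of y *)
pose p (j : nat) : 'rV[R]_m := \row_(i < m) if (i < j)%N then y ord0 i else x ord0 i.
have p0 : p 0%N = x by apply/rowP => i; rewrite mxE.
have pm : p m = y by apply/rowP => i; rewrite mxE ltn_ord.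
have pS (j : 'I_m) : p j.+1 = p j + (y ord0 j - x ord0 j) *: e_ j.
  apply/rowP => i; rewrite !mxE eqxx/= ltnS leq_eqVlt.
  have [->|ij] := eqVneq i j; first by rewrite eqxx ltnn mulr1 addrC subrK.
  by rewrite -(inj_eq val_inj) in ij; rewrite (negPf ij) mulr0 addr0.
have mv (j : 'I_m) : exists xi, `|xi - x| <= `|y - x| /\
    g (p j.+1) - g (p j) = dg j xi * (y ord0 j - x ord0 j).
  rewrite pS; have [s sle ->] := MVT_line (y ord0 j - x ord0 j) (fun s => gd j (p j + s *: e_ j)).
  exists (p j + s *: e_ j); split=> //.
  apply: norm_le_coord => // i; rewrite !mxE eqxx/=.
  have le i' : `|y ord0 i' - x ord0 i'| <= `|y - x|.
    by have := le_coord_norm (y - x) i'; rewrite !mxE.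
  have [->|ij] := eqVneq i j.
    by rewrite ltnn mulr1 addrC addKr (le_trans sle).
  by rewrite mulr0 addr0; case: ifP => // _; rewrite subrr normr0.
have [xi xiP] := choice mv.
exists xi; split=> [j|]; first by case: (xiP j).
rewrite -{1}pm -{1}p0 -(telescope_sumr (fun j => g (p j)) (leq0n m)) big_mkord.
by apply: eq_bigr => j _; case: (xiP j).
Qed.

Lemma lipschitz_rV (g : 'rV[R]_m -> R) (dg : 'I_m -> 'rV[R]_m -> R) (M : R) :
  (forall i x, is_derive x (e_ i) g (dg i x)) ->
  (forall i x, `|dg i x| <= M) ->
  forall x y, `|g y - g x| <= M *+ m * `|y - x|.
Proof.
move=> gd dgM x y; have [xi [_ ->]] := mean_value_rV gd x y.
apply: le_trans (ler_norm_sum _ _ _) _.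
have -> : M *+ m * `|y - x| = \sum_(j < m) M * `|y - x|.
  by rewrite sumr_const card_ord mulrnAl.
apply: ler_sum => j _; rewrite normrM; apply: ler_pM => //.
by have := le_coord_norm (y - x) j; rewrite !mxE.
Qed.

(** The increment of b along F is a sum over j of increments of the j-th coordinate
of F, multiplied by values of [db j] at points that tend to [F x]. *)
Lemma is_derive_comp_rV (b : 'rV[R]_m -> R) (db : 'I_m -> 'rV[R]_m -> R)
    n (F : 'rV[R]_n -> 'rV[R]_m) (dF : 'I_m -> R) (x v : 'rV[R]_n) :
  (forall i y, is_derive y (e_ i) b (db i y)) ->
  (forall i, continuous (db i)) ->
  (forall j, is_derive x v (fun y => F y ord0 j) (dF j)) ->
  is_derive x v (fun y => b (F y)) (\sum_(j < m) db j (F x) * dF j).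
Proof.
move=> bd dbc Fd.
pose q (j : 'I_m) (h : R) := h^-1 *: (F (h *: v + x) ord0 j - F x ord0 j).
have qcvg j : q j @ 0^' --> dF j.
  by have [d1 <-] := Fd j; exact: d1.
have [xi xiP] := choice (fun h : R => mean_value_rV bd (F x) (F (h *: v + x))).
have Fc : `|F (h *: v + x) - F x| @[h --> 0^'] --> (0 : R).
  have coord0 j : h * q j h @[h --> 0^'] --> (0 : R).
    rewrite -[X in _ --> X](mul0r (dF j)); apply: cvgM; last exact: qcvg.
    by apply: cvg_within; exact: cvg_id.
  apply/cvgr0Pnorm_le => e e0.
  have : \forall h \near 0^', forall j, `|h * q j h| <= e.
    by apply: filter_forall => j; move/cvgr0Pnorm_le: (coord0 j); exact.
  apply: filter_app; apply: nearW => h h0 H; rewrite normr_id norm_le_coord ?(ltW e0)// => j.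
  by have := H j; rewrite /q /GRing.scale/= mulrA divff// mul1r !mxE.
have xic j : xi h j @[h --> 0^'] --> F x.
  apply/cvgrPdist_le => e e0; move/cvgr0Pnorm_le: Fc => /(_ e e0).
  apply: filter_app; apply: nearW => h _ H.
  have [xih _] := xiP h; rewrite distrC; apply: le_trans (xih j) _.
  by move: H; rewrite normr_id distrC.
have lim0 : (fun h : R => h^-1 *: (((fun y => b (F y)) \o shift x) (h *: v) - b (F x))) @ 0^'
   --> \sum_(j < m) db j (F x) * dF j.
  have -> : (fun h : R => h^-1 *: (((fun y => b (F y)) \o shift x) (h *: v) - b (F x))) =
    (fun h : R => \sum_(j < m) db j (xi h j) * q j h).
    apply/funext => h /=; have [_ ->] := xiP h; rewrite scaler_sumr.
    by apply: eq_bigr => j _; rewrite /q /GRing.scale/= mulrCA.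
  apply: cvg_sumr => j; apply: cvgM; last exact: qcvg.
  exact: (continuous_cvg _ (dbc j (F x)) (xic j)).
by split; [apply/cvg_ex; eexists; exact: lim0|apply: cvg_lim].
Qed.

End mean_value.

(** * Integrable functions and test functions *)

Section L1.
Context {R : realType} {n : nat}.
Local Notation mu := (lebesgue_rV R n).
Implicit Types (g h : 'rV[R]_n -> R).

Definition L1 g := mu.-integrable [set: 'rV[R]_n] (EFin \o g).

Definition Int g : R := \int[mu]_x g x.

Lemma L1_measurable g : L1 g -> measurable_fun setT g.
Proof. by move=> /measurable_int /measurable_EFinP. Qed.

Lemma L1_le h g : measurable_fun setT g -> (forall x, `|g x| <= h x) -> L1 h -> L1 g.
Proof.
move=> mg gh; apply: le_integrable => //; first exact/measurable_EFinP.
by move=> x _ /=; rewrite lee_fin (le_trans (gh x))// ler_norm.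
Qed.

Lemma L1D g h : L1 g -> L1 h -> L1 (fun x => g x + h x).
Proof. by move=> ig ih; exact: (integrableD measurableT ig ih). Qed.

Lemma L1B g h : L1 g -> L1 h -> L1 (fun x => g x - h x).
Proof. by move=> ig ih; exact: (integrableB measurableT ig ih). Qed.

Lemma L1Z (c : R) g : L1 g -> L1 (fun x => c * g x).
Proof. by move=> ig; exact: (integrableZl measurableT c ig). Qed.

Lemma L1_abs g : L1 g -> L1 (fun x => `|g x|).
Proof. by move=> ig; exact: (integrable_abse ig). Qed.

Lemma L10 : L1 (fun=> 0).
Proof. exact: integrable0. Qed.

Lemma L1_sum (I : Type) (s : seq I) (P : pred I) (g : I -> 'rV[R]_n -> R) :
  (forall i, P i -> L1 (g i)) -> L1 (fun x => \sum_(i <- s | P i) g i x).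
Proof.
move=> ig; elim: s => [|i s IH].
  by under eq_fun do rewrite big_nil; exact: L10.
under eq_fun do rewrite big_cons.
by case Pi: (P i) => //; apply: L1D => //; exact: ig.
Qed.

Lemma L1_bounded_mul (M : R) h g : measurable_fun setT h -> (forall x, `|h x| <= M) ->
  L1 g -> L1 (fun x => h x * g x).
Proof.
move=> mh hM ig; apply: (@L1_le (fun x => M * `|g x|)).
- by apply: measurable_funM => //; exact: L1_measurable.
- by move=> x; rewrite normrM ler_wpM2r.
- by apply: L1Z; exact: L1_abs.
Qed.

Lemma eq_Int g h : g =1 h -> Int g = Int h.
Proof. by move=> gh; apply: eq_Rintegral => x _. Qed.

Lemma EFin_Int g : L1 g -> (Int g)%:E = (\int[mu]_x (g x)%:E)%E.
Proof. by move=> ig; rewrite /Int /Rintegral fineK//; exact: integrable_fin_num ig. Qed.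

Lemma IntD g h : L1 g -> L1 h -> Int (fun x => g x + h x) = Int g + Int h.
Proof. by move=> ig ih; exact: RintegralD. Qed.

Lemma IntB g h : L1 g -> L1 h -> Int (fun x => g x - h x) = Int g - Int h.
Proof. by move=> ig ih; exact: RintegralB. Qed.

Lemma IntZ (c : R) g : L1 g -> Int (fun x => c * g x) = c * Int g.
Proof. by move=> ig; exact: RintegralZl. Qed.

Lemma Int0 : Int (fun=> 0) = 0.
Proof. by rewrite /Int /Rintegral integral0. Qed.

Lemma Int_sum (I : Type) (s : seq I) (P : pred I) (g : I -> 'rV[R]_n -> R) :
  (forall i, P i -> L1 (g i)) ->
  Int (fun x => \sum_(i <- s | P i) g i x) = \sum_(i <- s | P i) Int (g i).
Proof.
move=> ig; elim: s => [|i s IH].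
  by rewrite big_nil; apply: etrans Int0; apply: eq_Int => x; rewrite big_nil.
rewrite big_cons -IH; transitivity (Int (fun x => if P i
    then g i x + \sum_(j <- s | P j) g j x else \sum_(j <- s | P j) g j x)).
  by apply: eq_Int => x; rewrite big_cons.
by case Pi: (P i) => //; rewrite IntD//; [exact: ig|exact: L1_sum].
Qed.

Lemma Int_ge0 g : (forall x, 0 <= g x) -> 0 <= Int g.
Proof. by move=> g0; apply: Rintegral_ge0. Qed.

Lemma Int_le g h : L1 g -> L1 h -> (forall x, g x <= h x) -> Int g <= Int h.
Proof. by move=> ig ih gh; apply: le_Rintegral. Qed.

Lemma Int_abs_le g : L1 g -> `|Int g| <= Int (fun x => `|g x|).
Proof. by move=> ig; exact: le_normr_Rintegral. Qed.

Lemma L1_ge0P g : measurable_fun setT g -> (forall x, 0 <= g x) ->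
  L1 g <-> (\int[mu]_x (g x)%:E < +oo)%E.
Proof.
move=> mg g0; have E : (\int[mu]_x `|(g x)%:E| = \int[mu]_x (g x)%:E)%E.
  by apply: eq_integral => x _; rewrite gee0_abs// lee_fin.
split=> [/integrableP[_ ]|ioo]; first by rewrite E.
by apply/integrableP; split; [exact/measurable_EFinP|rewrite E].
Qed.

Lemma L1_shift g (a : 'rV[R]_n) : L1 g -> L1 (fun x => g (x + a)).
Proof.
move=> /integrableP[/= mg ioo]; apply/integrableP; split.
  exact: (measurableT_comp mg (measurable_addr a)).
rewrite (lebesgue_rV_shift a (F := fun x => `|(g x)%:E|%E))//.
exact: measurableT_comp.
Qed.

Lemma Int_shift g (a : 'rV[R]_n) : L1 g -> Int (fun x => g (x + a)) = Int g.
Proof.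
move=> /integrableP[/= mg _]; rewrite /Int /Rintegral; congr fine.
rewrite integralE [RHS]integralE; congr (_ - _)%E.
  rewrite -(lebesgue_rV_shift a (measurable_funepos mg) (@funepos_ge0 _ _ _)).
  by apply: eq_integral => x _; rewrite !funeposE.
rewrite -(lebesgue_rV_shift a (measurable_funeneg mg) (@funeneg_ge0 _ _ _)).
by apply: eq_integral => x _; rewrite !funenegE.
Qed.

Lemma bounded_L1 (M : R) (A : set 'rV[R]_n) g : bounded_set A -> measurable A ->
  measurable_fun setT g -> (forall x, `|g x| <= M) -> (forall x, ~ A x -> g x = 0) ->
  L1 g.
Proof.
move=> bA mA mg gM g0; apply: (@L1_le (fun x => M * \1_A x)) => //.
  move=> x; rewrite indicE; have [xA|xA] := boolP (x \in A); first by rewrite mulr1.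
  by rewrite g0 ?normr0 ?mulr0// => /mem_set; apply/negP.
apply: L1Z; apply/L1_ge0P => //.
by rewrite integral_indic// setIT; exact: bounded_finite_measure.
Qed.

End L1.

Section test_functions.
Context {R : realType} {n : nat}.
Local Notation e_ := (@basis_vec R n).
Implicit Types (g h : 'rV[R]_n -> R) (U : set 'rV[R]_n).

Definition test_function U g := smooth_on setT g /\
  exists K, [/\ compact K, K `<=` U & forall x, ~ K x -> g x = 0].

Lemma smooth_is_derive g i x : smooth_on setT g -> is_derive x (e_ i) g ('D_(e_ i) g x).
Proof. by move=> sg; apply: (Cr_derive (sg 1%N)). Qed.

Lemma smooth_derive (O : set 'rV[R]_n) g i : smooth_on O g -> smooth_on O ('D_(e_ i) g).
Proof. by move=> sg r; have [_ /(_ i)[]] := sg r.+1. Qed.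

(** A derivative depends only on the values near the point. *)
Lemma derive_vanish (O : set 'rV[R]_n) g (v x : 'rV[R]_n) :
  open O -> (forall x, O x -> g x = 0) -> O x -> 'D_v g x = 0.
Proof.
move=> oO g0 Ox; rewrite -[RHS](derive_cst (0 : R) x v); apply: near_eq_derive.
by apply: filterS (open_nbhs_nbhs (conj oO Ox)) => y /g0.
Qed.

Lemma derive_off_support g (K : set 'rV[R]_n) (v x : 'rV[R]_n) : compact K ->
  (forall x, ~ K x -> g x = 0) -> ~ K x -> 'D_v g x = 0.
Proof.
move=> cK gK; apply: (@derive_vanish (~` K)) => //.
by apply: closed_openC; exact: compact_closed_rV.
Qed.

Lemma test_derive U g i : test_function U g -> test_function U ('D_(e_ i) g).
Proof.
move=> [sg [K [cK KU gK]]]; split; first exact: smooth_derive.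
by exists K; split=> // x; exact: derive_off_support.
Qed.

Lemma compact_support_bounded g (K : set 'rV[R]_n) : continuous g -> compact K ->
  (forall x, ~ K x -> g x = 0) -> exists M, forall x, `|g x| <= M.
Proof.
move=> cg cK gK.
have /compact_bounded[M [_ HM]] : compact (g @` K).
  by apply: continuous_compact => //; exact: continuous_subspaceT.
have M0 : M < `|M| + 1 by rewrite (le_lt_trans (ler_norm M)) ?ltrDl.
exists (`|M| + 1) => x; have [Kx|Kx] := pselect (K x); first by apply: HM M0 _ _; exists x.
by rewrite gK// normr0.
Qed.

Lemma test_bounded U g : test_function U g -> exists M, forall x, `|g x| <= M.
Proof.
move=> [sg [K [cK _ gK]]]; apply: compact_support_bounded cK gK.
exact: smooth_continuous.
Qed.

Lemma smooth_measurable g : smooth_on setT g -> measurable_fun setT g.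
Proof. by move=> sg; apply: measurable_continuous_rV; exact: smooth_continuous. Qed.

Lemma continuous_L1 g (K : set 'rV[R]_n) : continuous g -> compact K ->
  (forall x, ~ K x -> g x = 0) -> L1 g.
Proof.
move=> cg cK gK; have [M gM] := compact_support_bounded cg cK gK.
apply: (bounded_L1 (compact_bounded cK)) gM gK; first exact: measurable_compact_rV.
exact: measurable_continuous_rV.
Qed.

Lemma test_L1 U g : test_function U g -> L1 g.
Proof.
move=> [sg [K [cK _ gK]]]; apply: continuous_L1 cK gK; exact: smooth_continuous.
Qed.

Lemma testM U h g : smooth_on setT h -> test_function U g -> test_function U (fun x => h x * g x).
Proof.
move=> sh [sg [K [cK KU gK]]]; split; first by move=> r; apply: CrM => //; exact: openT.
by exists K; split=> // x /gK ->; rewrite mulr0.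
Qed.

Lemma testS U U' g : U `<=` U' -> test_function U g -> test_function U' g.
Proof. by move=> UU' [sg [K [cK KU gK]]]; split=> //; exists K; split=> // x /KU/UU'. Qed.

(** The partial derivatives of a test function are again test functions, hence
bounded. *)
Lemma test_lipschitz U g : test_function U g ->
  exists2 L, 0 <= L & forall x y, `|g y - g x| <= L * `|y - x|.
Proof.
move=> tg; have dM i := test_bounded (test_derive i tg).
have [M HM] := choice dM.
pose L := \big[Order.max/0]_(i < n) M i.
have L0 : 0 <= L by apply: bigmax_ge_id.
exists (L *+ n); first by rewrite mulrn_wge0.
apply: (lipschitz_rV (dg := fun i => 'D_(e_ i) g)).
  by move=> i x; apply: smooth_is_derive; case: tg.
by move=> i x; apply: le_trans (HM i x) _; apply: le_bigmax.
Qed.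

End test_functions.

(** * Convolution with a smooth kernel *)

Section convolution.
Context {R : realType} {n : nat}.
Local Notation e_ := (@basis_vec R n).
Implicit Types (g h kappa rho : 'rV[R]_n -> R).

Lemma norm_basis_vec i : `|e_ i| <= 1.
Proof.
apply: norm_le_coord => // j; rewrite mxE eqxx/=.
by case: (j == i); rewrite ?normr1 ?normr0.
Qed.

Definition conv kappa g (x : 'rV[R]_n) : R := Int (fun y => kappa (x - y) * g y).

Lemma continuous_rsub kappa x : continuous kappa -> continuous (fun y : 'rV[R]_n => kappa (x - y)).
Proof.
move=> ck y; apply: (continuous_comp (f := fun y : 'rV[R]_n => x - y)); last exact: ck.
apply: (@continuousB _ _ _ (cst x) id); [exact: cst_continuous|exact: cvg_id].
Qed.

Lemma conv_L1 kappa g x : test_function setT kappa -> L1 g ->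
  L1 (fun y => kappa (x - y) * g y).
Proof.
move=> tk ig; have [M kM] := test_bounded tk.
apply: (@L1_bounded_mul _ _ M) => //.
by apply: measurable_continuous_rV; apply: continuous_rsub; apply: smooth_continuous; case: tk.
Qed.

Lemma is_derive_quadratic (f : 'rV[R]_n -> R) (x v : 'rV[R]_n) (d C : R) :
  (forall t : R, `|f (x + t *: v) - f x - t * d| <= C * t ^+ 2) -> is_derive x v f d.
Proof.
move=> fC.
have C0 : 0 <= C by have := le_trans (normr_ge0 _) (fC 1); rewrite expr1n mulr1.
have lim0 : (fun t : R => t^-1 *: ((f \o shift x) (t *: v) - f x)) @ 0^' --> (d : R).
  apply/cvgrPdist_le => e e0; near=> t.
  have t0 : t != 0 by near: t; exact: nbhs_dnbhs_neq.
  have tC : `|t| <= e / (C + 1).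
    near: t; apply: dnbhs0_le.
    by rewrite divr_gt0// ltr_wpDl.
  rewrite /= [t *: v + x]addrC /GRing.scale/= distrC.
  have -> : t^-1 * (f (x + t *: v) - f x) - d = t^-1 * (f (x + t *: v) - f x - t * d).
    by rewrite [in RHS]mulrBr mulKf.
  rewrite normrM normfV ler_pdivrMl ?normr_gt0//.
  apply: le_trans (fC t) _; rewrite -real_normK ?num_real//.
  rewrite expr2 mulrCA ler_wpM2l// (le_trans (ler_wpM2l C0 tC))//.
  rewrite mulrCA -[leRHS]mulr1 ler_wpM2l ?(ltW e0)//.
  by rewrite ler_pdivrMr ?mul1r ?lerDl// ltr_wpDl.
by split; [apply/cvg_ex; exists d|apply: cvg_lim].
Unshelve. all: by end_near. Qed.

(** The first order Taylor remainder of kappa along e_i is at most L t^2, where L is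
a Lipschitz constant of the derivative. Integrated against g, this bound remains
quadratic in t. *)
Lemma is_derive_conv kappa g i x : test_function setT kappa -> L1 g ->
  is_derive x (e_ i) (conv kappa g) (conv ('D_(e_ i) kappa) g x).
Proof.
move=> tk ig; have tdk := test_derive i tk.
have [L L0 HL] := test_lipschitz tdk.
apply: (@is_derive_quadratic _ _ _ _ (L * Int (fun y => `|g y|))) => t.
pose a y := kappa (x + t *: e_ i - y) * g y; pose b y := kappa (x - y) * g y.
pose c y := 'D_(e_ i) kappa (x - y) * g y.
have [ia ib ic] : [/\ L1 a, L1 b & L1 c] 
  by split; [exact: (conv_L1 _ tk ig)|exact: (conv_L1 _ tk ig)|exact: (conv_L1 _ tdk ig)].
have -> : conv kappa g (x + t *: e_ i) - conv kappa g x - t * conv ('D_(e_ i) kappa) g x =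
    Int (fun y => a y - b y - t * c y).
  by rewrite IntB ?IntB ?IntZ//; [exact: L1B|exact: L1Z].
apply: le_trans (Int_abs_le _) _.
  by apply: L1B; [exact: L1B|exact: L1Z].
have -> : L * Int (fun y => `|g y|) * t ^+ 2 = Int (fun y => L * t ^+ 2 * `|g y|).
  by rewrite IntZ; [ring|exact: L1_abs].
apply: Int_le.
- by apply/L1_abs/L1B; [exact: L1B|exact: L1Z].
- by apply: L1Z; exact: L1_abs.
move=> y; rewrite /a /b /c [x + t *: e_ i - y]addrAC.
have [s sle E] := MVT_line (dg := 'D_(e_ i) kappa) (x := x - y) t (fun s => smooth_is_derive i (x - y + s *: e_ i) tk.1).
have -> : kappa (x - y + t *: e_ i) * g y - kappa (x - y) * g y - t * ('D_(e_ i) kappa (x - y) * g y)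
  = (kappa (x - y + t *: e_ i) - kappa (x - y) - t * 'D_(e_ i) kappa (x - y)) * g y.
  by ring.
rewrite normrM; apply: ler_wpM2r => //.
rewrite E [_ * t]mulrC -mulrBr normrM -[t ^+ 2]real_normK ?num_real// expr2 mulrCA.
apply: ler_wpM2l => //; apply: le_trans (HL _ _) _; apply: ler_wpM2l => //.
rewrite addrAC subrr add0r normrZ.
by rewrite -[leRHS]mulr1 ler_pM// norm_basis_vec.
Qed.

Lemma continuous_conv kappa g : test_function setT kappa -> L1 g -> continuous (conv kappa g).
Proof.
move=> tk ig x; have [L L0 HL] := test_lipschitz tk.
pose C := L * Int (fun y => `|g y|).
have C0 : 0 <= C by rewrite mulr_ge0// Int_ge0.
have lip y : `|conv kappa g x - conv kappa g y| <= C * `|x - y|.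
  pose a z := kappa (x - z) * g z; pose b z := kappa (y - z) * g z.
  have [ia ib] : L1 a /\ L1 b.
    by split; [exact: (conv_L1 _ tk ig)|exact: (conv_L1 _ tk ig)].
  have -> : conv kappa g x - conv kappa g y = Int (fun z => a z - b z) by rewrite IntB.
  apply: le_trans (Int_abs_le _) _; first exact: L1B.
  have -> : C * `|x - y| = Int (fun z => L * `|x - y| * `|g z|).
    by rewrite IntZ; [rewrite /C; ring|exact: L1_abs].
  apply: Int_le.
  - by apply/L1_abs/L1B.
  - by apply: L1Z; exact: L1_abs.
  move=> z; rewrite /a /b -mulrBl normrM; apply: ler_wpM2r => //.
  apply: le_trans (HL _ _) _; apply: ler_wpM2l => //.
  by rewrite opprB addrA subrK.
apply/(@cvgrPdist_le _ _ _ (nbhs x)) => e e0.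
have h0 : 0 < e / (C + 1) by rewrite divr_gt0// ltr_wpDl.
apply/nbhs_ballP; exists (e / (C + 1)) => // y; rewrite mx_norm_ball /ball_/= => /ltW xy.
apply: le_trans (lip y) _; apply: (le_trans (ler_wpM2l C0 xy)).
rewrite mulrCA -[leRHS]mulr1 ler_wpM2l ?(ltW e0)//.
by rewrite ler_pdivrMr ?mul1r ?lerDl// ltr_wpDl.
Qed.

(** All derivatives fall on the kernel, so that g need only be integrable. *)
Lemma smooth_conv kappa g : test_function setT kappa -> L1 g -> smooth_on setT (conv kappa g).
Proof.
move=> + ig r; elim: r kappa => [|r IH] kappa tk.
  by split=> // x _; exact: continuous_conv.
apply: (@CrS _ _ _ _ _ (fun i => conv ('D_(e_ i) kappa) g)).
- exact: openT.
- by move=> x _; exact: continuous_conv.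
- by move=> i x _; exact: is_derive_conv.
- by move=> i; apply: IH; exact: test_derive.
Qed.

Lemma conv_measurable kappa g : test_function setT kappa -> L1 g -> measurable_fun setT (conv kappa g).
Proof. by move=> tk ig; apply: smooth_measurable; exact: smooth_conv. Qed.

Lemma convD kappa g h : test_function setT kappa -> L1 g -> L1 h ->
  conv kappa (fun x => g x + h x) =1 (fun x => conv kappa g x + conv kappa h x).
Proof.
move=> tk ig ih x.
rewrite -[RHS](@IntD R n _ _ (conv_L1 x tk ig) (conv_L1 x tk ih)).
by apply: eq_Int => y; rewrite mulrDr.
Qed.

Lemma convZ kappa (c : R) g : test_function setT kappa -> L1 g ->
  conv kappa (fun x => c * g x) =1 (fun x => c * conv kappa g x).
Proof.
move=> tk ig x.
rewrite -[RHS](@IntZ R n _ _ (conv_L1 x tk ig)).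
by apply: eq_Int => y; rewrite mulrCA.
Qed.

Lemma convB kappa g h : test_function setT kappa -> L1 g -> L1 h ->
  conv kappa (fun x => g x - h x) =1 (fun x => conv kappa g x - conv kappa h x).
Proof.
move=> tk ig ih x.
rewrite -[RHS](@IntB R n _ _ (conv_L1 x tk ig) (conv_L1 x tk ih)).
by apply: eq_Int => y; rewrite mulrBr.
Qed.

End convolution.

Section mollification.
Context {R : realType} {n : nat}.
Local Notation mu := (lebesgue_rV R n).
Implicit Types (g h rho : 'rV[R]_n -> R).

Lemma closed_ball_compact_rV (x : 'rV[R]_n) (r : R) : compact [set y | `|y - x| <= r].
Proof.
apply: bounded_closed_compact.
  exists (r + `|x|); split; first exact: num_real.
  move=> M rM y /= yx; apply: le_trans (ltW rM).
  by rewrite -(subrK x y) (le_trans (ler_normD _ _))// lerD2r.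
have -> : [set y : 'rV[R]_n | `|y - x| <= r] = (fun y => `|y - x|) @^-1` [set t | t <= r] by [].
apply: closed_comp; last exact: closed_le.
move=> y _; apply: (continuous_comp (f := fun y : 'rV[R]_n => y - x)); last exact: norm_continuous.
by apply: (@continuousB _ _ _ id (cst x)); [exact: cvg_id|exact: cst_continuous].
Qed.

Lemma compact_closure_bounded (V : set 'rV[R]_n) :
  bounded_set V -> compact (closure V).
Proof.
move=> [M [_ /(_ (M + 1))VM]].
have cB := @closed_ball_compact_rV 0 (M + 1).
apply: (subclosed_compact (@closed_closure _ V) cB).
rewrite [X in _ `<=` X](closure_id _).1; last exact: compact_closed_rV.
by apply: closure_subset => y Vy /=; rewrite subr0; apply: VM; rewrite ?ltrDl.
Qed.
Lemma mollifier_test r rho : mollifier r rho -> test_function setT rho.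
Proof.
move=> [sr _ _ supp _]; split=> //; exists [set y | `|y - 0| <= r]; split => //.
  exact: closed_ball_compact_rV.
move=> x /= xr; apply: contrapT => /eqP /supp xr'; apply: xr.
by rewrite subr0 ltW.
Qed.

Lemma mollifier_Int r rho : mollifier r rho -> Int rho = 1.
Proof. by move=> [_ _ _ _ I1]; rewrite /Int /Rintegral I1. Qed.

Lemma Int_mollifier_sub r rho x : mollifier r rho -> Int (fun y => rho (x - y)) = 1.
Proof.
move=> mr; have tr := mollifier_test mr; have [_ _ ev _ _] := mr.
rewrite -(mollifier_Int mr) -[RHS](Int_shift (- x) (test_L1 tr)).
by apply: eq_Int => y; rewrite -ev opprB.
Qed.

Lemma measurable_rsub : measurable_fun [set: 'rV[R]_n * 'rV[R]_n]
  (fun z : 'rV[R]_n * 'rV[R]_n => z.1 - z.2).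
Proof.
apply/measurable_fun_rVP => i; under eq_fun do rewrite !mxE.
apply: measurable_funB.
  exact: (measurableT_comp (measurable_coord i) measurable_fst).
exact: (measurableT_comp (measurable_coord i) measurable_snd).
Qed.

(** Fubini, and the translation invariance of the integral of rho. *)
Lemma mollify_ge0 r rho g : mollifier r rho -> L1 g -> (forall x, 0 <= g x) ->
  L1 (conv rho g) /\ Int (conv rho g) = Int g.
Proof.
move=> mr ig g0; have tr := mollifier_test mr; have [sr r0 _ _ I1] := mr.
have c0 x : 0 <= conv rho g x by apply: Int_ge0 => y; rewrite mulr_ge0.
have mc := conv_measurable tr ig; have mg := L1_measurable ig.
pose F (z : 'rV[R]_n * 'rV[R]_n) : \bar R := (rho (z.1 - z.2) * g z.2)%:E.
have mF : measurable_fun setT F.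
  apply/measurable_EFinP; apply: measurable_funM.
    exact: (measurableT_comp (smooth_measurable sr) measurable_rsub).
  exact: (measurableT_comp mg measurable_snd).
have E : (\int[mu]_x (conv rho g x)%:E = \int[mu]_x (g x)%:E)%E.
  transitivity (\int[mu]_x \int[mu]_y F (x, y))%E.
    apply: eq_integral => x _; rewrite EFin_Int//; exact: (conv_L1 _ tr ig).
  rewrite (fubini_tonelli (m1 := mu) (m2 := mu) F mF); last first.
    by move=> z; rewrite lee_fin mulr_ge0.
  apply: eq_integral => y _; rewrite /F /=.
  under eq_integral do rewrite EFinM.
  rewrite ge0_integralZr//; last 3 first.
  - apply/measurable_EFinP.
    exact: (measurableT_comp (smooth_measurable sr) (measurable_addr (- y))).
  - by move=> x _; rewrite lee_fin.
  - by rewrite lee_fin.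
  have -> : (\int[mu]_x (rho (x - y))%:E = 1)%E; last by rewrite mul1e.
  rewrite -I1; apply: (lebesgue_rV_shift (- y) (F := fun x => (rho x)%:E)) => //.
  by apply/measurable_EFinP; exact: smooth_measurable.
split; last by rewrite /Int /Rintegral E.
by apply/L1_ge0P => //; rewrite E; apply/L1_ge0P.
Qed.

Lemma conv_le_abs r rho g x : mollifier r rho -> L1 g ->
  `|conv rho g x| <= conv rho (fun y => `|g y|) x.
Proof.
move=> mr ig; have tr := mollifier_test mr; have [_ r0 _ _ _] := mr.
apply: le_trans (Int_abs_le (conv_L1 x tr ig)) _.
rewrite le_eqVlt; apply/orP; left; apply/eqP; apply: eq_Int => y.
by rewrite normrM ger0_norm.
Qed.

Lemma mollify_L1 r rho g : mollifier r rho -> L1 g ->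
  L1 (conv rho g) /\ Int (fun x => `|conv rho g x|) <= Int (fun x => `|g x|).
Proof.
move=> mr ig; have tr := mollifier_test mr.
have [ia Ia] := mollify_ge0 mr (L1_abs ig) (fun x => normr_ge0 (g x)).
have ic : L1 (conv rho g).
  apply: (L1_le (h := conv rho (fun y => `|g y|))) => //; first exact: conv_measurable.
  by move=> x; exact: conv_le_abs mr ig.
split=> //; rewrite -Ia; apply: Int_le => //; first exact: L1_abs.
by move=> x; exact: conv_le_abs mr ig.
Qed.

End mollification.

(** * Convergence of mollifications in L1 *)

Lemma squeeze0 {R : realType} (u v : nat -> R) :
  (forall k, 0 <= u k <= v k) -> v k @[k --> \oo] --> (0 : R) ->
  u k @[k --> \oo] --> (0 : R).
Proof.
move=> uv v0; apply: (@squeeze_cvgr _ _ _ _ (fun=> 0) v) => //; last exact: cvg_cst.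
exact: nearW.
Qed.

Lemma cvg0_le {R : realType} (u : nat -> R) : (forall k, 0 <= u k) ->
  (forall e, 0 < e -> exists N, forall k, (N <= k)%N -> u k <= e) ->
  u k @[k --> \oo] --> (0 : R).
Proof.
move=> u0 H; apply/cvgr0Pnorm_le => e e0; have [N HN] := H e e0.
by exists N => // k /= Nk; rewrite ger0_norm//; exact: HN.
Qed.

Lemma cvg0_leP {R : realType} (u : nat -> R) (e : R) : 0 < e ->
  u k @[k --> \oo] --> (0 : R) -> exists N, forall k, (N <= k)%N -> `|u k| <= e.
Proof.
move=> e0 /cvgr0Pnorm_le/(_ e e0)[N _ HN]; exists N => k Nk; exact: HN.
Qed.

Section dominated.
Context {R : realType} {n : nat}.
Local Notation mu := (lebesgue_rV R n).

Lemma dominated_Int (f_ : nat -> 'rV[R]_n -> R) (f g : 'rV[R]_n -> R) :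
  (forall k, measurable_fun setT (f_ k)) -> measurable_fun setT f ->
  {ae mu, forall x, f_ k x @[k --> \oo] --> f x} ->
  L1 g -> {ae mu, forall x k, `|f_ k x| <= g x} ->
  [/\ L1 f, Int (fun x => `|f_ k x - f x|) @[k --> \oo] --> (0 : R) &
      Int (f_ k) @[k --> \oo] --> Int f].
Proof.
move=> mf_ mf fcvg ig fg.
have [] := @dominated_convergence _ _ _ mu setT measurableT
  (fun k x => (f_ k x)%:E) (EFin \o f) (EFin \o g).
- by move=> k; apply/measurable_EFinP.
- exact/measurable_EFinP.
- by apply: filterS fcvg => x fx _; apply/cvg_EFin => //; exact: nearW.
- exact: ig.
- by apply: filterS fg => x fx k _; rewrite lee_fin.
move=> if_ c1 c2.
split=> //.
- move/fine_cvgP: c1 => [_]; apply: cvg_trans; apply: near_eq_cvg; apply: nearW => k.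
  by rewrite /Int /Rintegral /=.
- have : (\int[mu]_x (EFin \o f) x)%E = (Int f)%:E by rewrite EFin_Int.
  by move=> E; rewrite E in c2; move/fine_cvgP: c2 => [_].
Qed.

End dominated.

Import HBSimple.

Section mollification_cvg.
Context {R : realType} {n : nat}.
Variables (rho : nat -> 'rV[R]_n -> R).
Hypothesis mrho : forall k, mollifier k.+1%:R^-1 (rho k).

(** The functions to which their mollifications converge in L1. The aim is that all
integrable functions which vanish off a bounded set are of this kind. *)
Definition approximable g :=
  L1 g /\ Int (fun x => `|conv (rho k) g x - g x|) @[k --> \oo] --> (0 : R).

Let trho k : test_function setT (rho k).
Proof. exact: mollifier_test (mrho k). Qed.

Lemma approx_L1 k g : L1 g -> L1 (fun x => conv (rho k) g x - g x).
Proof. by move=> ig; apply: L1B => //; have [] := mollify_L1 (mrho k) ig. Qed.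

Lemma approximableD g h : approximable g -> approximable h ->
  approximable (fun x => g x + h x).
Proof.
move=> [ig cg] [ih ch]; split; first exact: L1D.
have igh := L1D ig ih.
apply: squeeze0; last by rewrite -[X in _ --> X](addr0 0); apply: cvgD; [exact: cg|exact: ch].
move=> k; rewrite Int_ge0//= -[leRHS](@IntD R n); last 2 first.
- by apply: L1_abs; exact: approx_L1.
- by apply: L1_abs; exact: approx_L1.
apply: Int_le.
- by apply: L1_abs; exact: approx_L1.
- by apply: L1D; apply: L1_abs; exact: approx_L1.
by move=> x; rewrite convD// opprD addrACA ler_normD.
Qed.

Lemma approximableZ (c : R) g : approximable g -> approximable (fun x => c * g x).
Proof.
move=> [ig cg]; split; first exact: L1Z.
have -> : (fun k => Int (fun x => `|conv (rho k) (fun x => c * g x) x - c * g x|)) =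
          (fun k => `|c| * Int (fun x => `|conv (rho k) g x - g x|)).
  apply/funext => k; rewrite -IntZ; last by apply: L1_abs; exact: approx_L1.
  by apply: eq_Int => x; rewrite convZ// -mulrBr normrM.
by rewrite -[X in _ --> X](mulr0 `|c|); apply: cvgM => //; exact: cvg_cst.
Qed.

Lemma approximable_sum (I : Type) (s : seq I) (g : I -> 'rV[R]_n -> R) :
  (forall i, approximable (g i)) -> approximable (fun x => \sum_(i <- s) g i x).
Proof.
move=> ag; elim: s => [|i s IH].
  under eq_fun do rewrite big_nil; split; first exact: L10.
  have -> : (fun k => Int (fun x => `|conv (rho k) (fun=> 0) x - 0|)) = (fun=> 0).
    apply/funext => k; rewrite -[RHS](@Int0 R n); apply: eq_Int => x.
    rewrite subr0 /conv; have -> : Int (fun y => rho k (x - y) * 0) = 0.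
      by rewrite -[RHS](@Int0 R n); apply: eq_Int => y; rewrite mulr0.
    by rewrite normr0.
  exact: cvg_cst.
by under eq_fun do rewrite big_cons; exact: approximableD.
Qed.

(** Mollification is a contraction of L1, so that an error of e / 3 in
approximating g by h costs at most two thirds of e. *)
Lemma approximable_closed g : L1 g ->
  (forall e, 0 < e -> exists2 h, approximable h & Int (fun x => `|g x - h x|) <= e) ->
  approximable g.
Proof.
move=> ig H; split=> //; apply: cvg0_le => [k|e e0]; first exact: Int_ge0.
have e3 : 0 < e / 3 by rewrite divr_gt0.
have [h [ih ch] gh] := H _ e3.
have [N HN] := cvg0_leP e3 ch; exists N => k Nk.
have igh : L1 (fun x => g x - h x) by exact: L1B.
have [ic Ic] := mollify_L1 (mrho k) igh.
have b1 := HN k Nk; rewrite ger0_norm ?Int_ge0// in b1.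
have E : Int (fun x => `|conv (rho k) g x - g x|) <=
  Int (fun x => `|conv (rho k) (fun y => g y - h y) x| + `|conv (rho k) h x - h x| + `|g x - h x|).
  apply: Int_le.
  - by apply: L1_abs; exact: approx_L1.
  - by apply: L1D; [apply: L1D|]; apply: L1_abs => //; exact: approx_L1.
  move=> x; rewrite convB//.
  have -> : conv (rho k) g x - g x = (conv (rho k) g x - conv (rho k) h x)
    + (conv (rho k) h x - h x) - (g x - h x) by ring.
  by rewrite (le_trans (ler_normB _ _))// lerD2r ler_normD.
apply: le_trans E _; rewrite IntD ?IntD; last 4 first.
- by apply: L1_abs.
- by apply: L1_abs; exact: approx_L1.
- by apply: L1D; apply: L1_abs => //; exact: approx_L1.
- by apply: L1_abs.
by rewrite (_ : e = e / 3 + e / 3 + e / 3) ?lerD// ?(le_trans Ic)//; field.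
Qed.

Lemma eq_approximable g h : g =1 h -> approximable g -> approximable h.
Proof. by move=> /funext ->. Qed.

Lemma indic_L1 (A : set 'rV[R]_n) : bounded_set A -> measurable A -> L1 (\1_A : _ -> R).
Proof.
move=> bA mA; apply: (bounded_L1 (M := 1) bA mA) => //.
- by move=> x; rewrite indicE; case: (x \in A); rewrite ?normr1 ?normr0.
- by move=> x xA; rewrite indicE memNset.
Qed.

(** Let g be the indicator of A. The positive part p k of g - rho_k * g is at most g
and tends to 0: it vanishes off A, and rho_k * g equals 1 at a point of A once the
support of rho_k is small. So its integral tends to 0. The negative part has
the same integral, because mollification preserves the integral of g. *)
Lemma approximable_open (A : set 'rV[R]_n) : bounded_set A -> open A ->
  approximable (\1_A).
Proof.
move=> bA oA; have mA := measurable_open_rV oA; have iA := indic_L1 bA mA.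
split=> //; set g := \1_A.
have g01 x : 0 <= g x <= 1 by rewrite /g indicE; case: (x \in A); rewrite ?lexx ?ler01.
pose p k x := Num.max (g x - conv (rho k) g x) 0.
have ic k : L1 (conv (rho k) g) by have [] := mollify_L1 (mrho k) iA.
have c0 k x : 0 <= conv (rho k) g x.
  by apply: Int_ge0 => y; apply: mulr_ge0; [case: (mrho k)|case/andP: (g01 y)].
have mp k : measurable_fun setT (p k).
  apply: measurable_maxr => //; apply: measurable_funB; exact: L1_measurable.
have pg k x : `|p k x| <= g x.
  rewrite /p ger0_norm ?le_max ?lexx ?orbT// ge_max gerBl c0/=.
  by case/andP: (g01 x).
have ip k : L1 (p k) by apply: (L1_le (h := g)) => //; exact: mp.
have E k : Int (fun x => `|conv (rho k) g x - g x|) = 2 * Int (p k).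
  have E1 : Int (fun x => conv (rho k) g x - g x) = 0.
    have g0 x : 0 <= g x by case/andP: (g01 x).
    rewrite IntB; [|exact: ic|exact: iA]; have [_ ->] := mollify_ge0 (mrho k) iA g0.
    by rewrite subrr.
  have i1 : L1 (fun x => 2 * p k x) by exact/L1Z/ip.
  have i2 : L1 (fun x => conv (rho k) g x - g x) by apply: L1B.
  rewrite -(IntZ _ (ip k)) -[RHS]addr0 -E1 -(IntD i1 i2).
  apply: eq_Int => x; rewrite /p; case: (leP (g x - conv (rho k) g x) 0) => H.
    by rewrite mulr0 add0r ger0_norm// -oppr_le0 opprB.
  by rewrite distrC gtr0_norm//; ring.
have [_ _ ] : [/\ @L1 R n (fun=> 0), Int (fun x => `|p k x - 0|) @[k --> \oo] --> (0 : R) &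
      Int (p k) @[k --> \oo] --> @Int R n (fun=> 0)].
  apply: (@dominated_Int R n p (fun=> 0) g) => //; last by apply: aeW => x k.
  apply: aeW => x; have [Ax|Ax] := pselect (A x); last first.
    have -> : (fun k => p k x) = fun=> 0; last exact: cvg_cst.
    apply/funext => k; rewrite /p /g indicE memNset//= sub0r.
    by apply/max_idPr; rewrite oppr_le0.
  have /nbhs_ballP[e /= e0] := open_nbhs_nbhs (conj oA Ax).
  rewrite mx_norm_ball => xeA.
  have [N _ Ne] := near_infty_natSinv_lt (PosNum e0).
  apply: cvg_trans (_ : (fun=> 0 : R) @ \oo --> (0 : R)); last exact: cvg_cst.
  apply: near_eq_cvg; exists N => // k /= Nk.
  rewrite /p; have -> : conv (rho k) g x = 1.
    rewrite -(Int_mollifier_sub x (mrho k)); apply: eq_Int => y.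
    have [->|] := eqVneq (rho k (x - y)) 0; first by rewrite mul0r.
    have [_ _ _ supp _] := mrho k => /supp xy.
    rewrite /g indicE mem_set ?mulr1//; apply: xeA; rewrite /ball_/=.
    exact: lt_trans xy (Ne k Nk).
  by rewrite /g indicE mem_set// subrr maxxx.
rewrite Int0 => H.
have -> : (fun k => Int (fun x => `|conv (rho k) g x - g x|)) = (fun k => 2 * Int (p k)).
  by apply/funext.
by rewrite -[X in _ --> X](mulr0 2); apply: cvgM => //; exact: cvg_cst.
Qed.

(** The open sets generate the sigma-algebra and are stable under intersection, so
that Dynkin induction extends [approximable_open]. Intersecting with Q keeps the
measures finite. *)
Lemma approximable_measurable (Q A : set 'rV[R]_n) : bounded_set Q -> open Q ->
  measurable A -> approximable (\1_(A `&` Q)).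
Proof.
move=> bQ oQ; have mQ := measurable_open_rV oQ.
have bI (B : set 'rV[R]_n) : bounded_set (B `&` Q).
  by have [M [Mr HM]] := bQ; exists M; split=> // x Mx y [_ Qy]; exact: HM Mx y Qy.
have sG := @measurable_rVE R n.
have H := @dynkin_induction _ _ (@open 'rV[R]_n) (fun A => approximable (\1_(A `&` Q))) sG.
rewrite sG; move: A; apply: H => [A B oA oB|||A mA aA|F mF tF aF].
- exact: openI.
- by rewrite setTI; exact: approximable_open.
- by move=> A oA; apply: approximable_open => //; exact: openI.
- apply: (@eq_approximable (fun x => \1_Q x + -1 * \1_(A `&` Q) x)).
    move=> x; rewrite !indicE !in_setI in_setC.
    by case: (x \in A); case: (x \in Q); rewrite /=; ring.
  by apply: approximableD; [exact: approximable_open|exact: approximableZ].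
(* the countable union is the limit of the finite ones, dominated by \1_Q *)
pose h N x : R := \sum_(k < N) \1_(F k `&` Q) x.
pose g : 'rV[R]_n -> R := \1_(\bigcup_k F k `&` Q).
have mU : measurable (\bigcup_k F k) by exact: bigcup_measurable.
have ah N : approximable (h N) by exact: approximable_sum.
have hx0 x N : ~ (\bigcup_k F k `&` Q) x -> h N x = 0.
  move=> xF; rewrite /h big1// => k _; rewrite indicE memNset// => -[Fx Qx].
  by apply: xF; split=> //; exists k.
have hx1 x N k0 : F k0 x -> Q x -> h N x = (k0 < N)%:R.
  move=> Fx Qx; case: ltnP => kN.
    rewrite /h (bigD1 (Ordinal kN))//= indicE mem_set// big1 ?addr0// => k kk.
    rewrite indicE memNset// => -[Fkx _]; move/eqP: kk; apply; apply: val_inj => /=.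
    by apply: (tF _ _ I I); exists x.
  rewrite /h big1// => k _; rewrite indicE memNset// => -[Fkx _].
  have E : k = k0 :> nat by apply: (tF _ _ I I); exists x.
  by move: (ltn_ord k); rewrite E ltnNge kN.
have gx1 x k0 : F k0 x -> Q x -> g x = 1.
  by move=> Fx Qx; rewrite /g indicE mem_set//; split=> //; exists k0.
have iQ := indic_L1 bQ mQ.
have [ig c1 _] : [/\ L1 g, Int (fun x => `|h k x - g x|) @[k --> \oo] --> (0 : R) &
      Int (h k) @[k --> \oo] --> Int g].
  apply: (@dominated_Int R n h g (\1_Q)) => //.
  - by move=> N; apply: L1_measurable; case: (ah N).
  - by apply: measurable_indic; exact: measurableI.
  - apply: aeW => x; have [|xF] := pselect ((\bigcup_k F k `&` Q) x).
      move=> [[k0 _ Fx] Qx]; rewrite (gx1 x k0)//.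
      apply: cvg_trans (_ : (fun=> 1 : R) @ \oo --> (1 : R)); last exact: cvg_cst.
      apply: near_eq_cvg; exists k0.+1 => // k /= k0k.
      by rewrite (hx1 _ _ k0)// k0k.
    have -> : (fun k => h k x) = (fun=> 0) by apply/funext => k; exact: hx0.
    by rewrite /g indicE memNset//; exact: cvg_cst.
  - apply: aeW => x N; have [|xF] := pselect ((\bigcup_k F k `&` Q) x).
      move=> [[k0 _ Fx] Qx]; rewrite (hx1 _ _ k0)// indicE mem_set//.
      by case: (_ < _)%N; rewrite ?normr1 ?normr0.
    by rewrite hx0// normr0 indicE ler0n.
apply: approximable_closed => // e e0; have [N HN] := cvg0_leP e0 c1.
exists (h N) => //; have := HN N (leqnn N); rewrite ger0_norm ?Int_ge0//.
by apply: le_trans; rewrite le_eqVlt; apply/orP; left; apply/eqP/eq_Int => x; rewrite distrC.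
Qed.

(** Simple functions are dense in L1. *)
Theorem mollification_cvg (A : set 'rV[R]_n) g : bounded_set A ->
  (forall x, ~ A x -> g x = 0) -> L1 g ->
  Int (fun x => `|conv (rho k) g x - g x|) @[k --> \oo] --> (0 : R).
Proof.
move=> [M [_ HM]] gA ig; suff [] : approximable g by [].
have M0 : M < `|M| + 1 by rewrite (le_lt_trans (ler_norm M)) ?ltrDl.
pose Q : set 'rV[R]_n := ball_ (fun x : 'rV[R]_n => `|x|) 0 (`|M| + 2).
have oQ : open Q by rewrite /Q -mx_norm_ball; apply: ball_open; rewrite ltr_wpDl.
have bQ : bounded_set Q.
  exists (`|M| + 2); split; first exact: num_real.
  by move=> r Mr x; rewrite /Q /ball_/= sub0r normrN => /ltW xM; apply: le_trans (ltW Mr).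
have gQ x : ~ Q x -> g x = 0.
  move=> xQ; apply: gA => Ax; apply: xQ; rewrite /Q /ball_/= sub0r normrN.
  by rewrite (le_lt_trans (HM _ M0 x Ax))// ltrD2l ltr1n.
have mQ := measurable_open_rV oQ.
have [s_ [is_ _]] := approximation_sfun_integrable measurableT ig.
move=> /fine_cvgP[_ s0].
apply: approximable_closed => // e e0; have [N HN] := cvg0_leP e0 s0.
have [p [c [B [mB sE]]]] : exists p (c : 'I_p -> R) (B : 'I_p -> set 'rV[R]_n),
    (forall i, measurable (B i)) /\ forall x, s_ N x = \sum_(i < p) c i * \1_(B i) x.
  do 3 eexists; split; last exact: (fimfunEord (s_ N)).
  by move=> i; rewrite -[X in measurable X]setTI; apply: measurable_funP.
exists (fun x => s_ N x * \1_Q x).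
  apply: (@eq_approximable (fun x => \sum_(i < p) c i * \1_(B i `&` Q) x)).
    move=> x; rewrite sE mulr_suml; apply: eq_bigr => i _.
    by rewrite indicI mulrA.
  apply: approximable_sum => i; apply: approximableZ; exact: approximable_measurable.
have is' : L1 (s_ N) by exact: is_.
have isQ : L1 (fun x => s_ N x * \1_Q x).
  apply: (L1_le (h := fun x => `|s_ N x|)); last exact: L1_abs.
    by apply: measurable_funM => //; exact: measurable_indic.
  move=> x; rewrite normrM indicE; case: (x \in Q); first by rewrite normr1 mulr1.
  by rewrite normr0 mulr0.
have igs : L1 (fun x => g x - s_ N x) by exact: L1B.
apply: (@le_trans _ _ (Int (fun x => `|g x - s_ N x|))).
  apply: Int_le; [by apply: L1_abs; exact: L1B|exact: L1_abs|].
  move=> x; rewrite indicE; have [|/negP xQ] := boolP (x \in Q); first by rewrite mulr1.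
  by rewrite mulr0 gQ ?subr0 ?normr0// => Qx; apply: xQ; rewrite inE.
have := HN N (leqnn N); rewrite ger0_norm; first exact.
by apply: fine_ge0; apply: integral_ge0.
Qed.

End mollification_cvg.

(** * Mollification of weak derivatives *)

Section jensen.
Context {R : realType} {n : nat}.

(** The graph of the convex function t^(p+1) lies above its tangent at a. *)
Lemma exprn_tangent (p : nat) (a t : R) : 0 <= a -> 0 <= t ->
  a ^+ p.+1 + p.+1%:R * a ^+ p * (t - a) <= t ^+ p.+1.
Proof.
move=> a0 t0; elim: p => [|p IH]; first by rewrite !expr1 expr0 !mul1r addrC subrK.
rewrite [t ^+ p.+2]exprS; apply: le_trans (ler_wpM2l t0 IH).
have -> : t * (a ^+ p.+1 + p.+1%:R * a ^+ p * (t - a)) =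
   a ^+ p.+2 + p.+2%:R * a ^+ p.+1 * (t - a) + p.+1%:R * a ^+ p * (t - a) ^+ 2.
  by rewrite !exprS -[p.+2%:R]natr1; ring.
by rewrite lerDl; apply: mulr_ge0; [apply: mulr_ge0; [exact: ler0n|exact: exprn_ge0]|exact: sqr_ge0].
Qed.

(** Jensen's inequality for the probability density rho (x - y): integrate the tangent
inequality at the point a = (rho * g)(x). *)
Lemma conv_expr_le (p : nat) (r : R) (rho g : 'rV[R]_n -> R) x : mollifier r rho -> L1 g ->
  (forall y, 0 <= g y) -> L1 (fun y => g y ^+ p.+1) ->
  conv rho g x ^+ p.+1 <= conv rho (fun y => g y ^+ p.+1) x.
Proof.
move=> mr ig g0 igp; have tr := mollifier_test mr; have [_ r0 _ _ _] := mr.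
set a := conv rho g x; have a0 : 0 <= a by apply: Int_ge0 => y; rewrite mulr_ge0.
have irho : L1 (fun y => rho (x - y)).
  have [_ _ ev _ _] := mr.
  have -> : (fun y => rho (x - y)) = (fun y => rho (y - x)).
    by apply/funext => y; rewrite -ev opprB.
  exact: L1_shift (test_L1 tr).
have i1 := conv_L1 x tr ig; have ip := conv_L1 x tr igp.
pose c := p.+1%:R * a ^+ p.
have E : Int (fun y => (a ^+ p.+1 - c * a) * rho (x - y) + c * (rho (x - y) * g y)) = a ^+ p.+1.
  rewrite IntD ?IntZ//; [|exact: L1Z|exact: L1Z].
  by rewrite (Int_mollifier_sub x mr) mulr1 -/(conv rho g x) -/a subrK.
rewrite -E; apply: Int_le => //; first by apply: L1D; exact: L1Z.
move=> y; have := ler_wpM2l (r0 (x - y)) (exprn_tangent p a0 (g0 y)).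
by apply: le_trans; rewrite le_eqVlt; apply/orP; left; apply/eqP; rewrite /c; ring.
Qed.

End jensen.

Section weak_partial.
Context {R : realType} {n : nat}.
Local Notation e_ := (@basis_vec R n).
Implicit Types (g u v psi : 'rV[R]_n -> R) (U : set 'rV[R]_n).

Definition weak_partial U (i : 'I_n) u v := forall psi, test_function U psi ->
  Int (fun x => v x * psi x) = - Int (fun x => u x * 'D_(e_ i) psi x).

Lemma is_derive_reflect g (x y : 'rV[R]_n) i : smooth_on setT g ->
  is_derive y (e_ i) (fun z => g (x - z)) (- 'D_(e_ i) g (x - y)).
Proof.
move=> sg.
have -> : - 'D_(e_ i) g (x - y) = \sum_(j < n) 'D_(e_ j) g (x - y) * - (e_ i) ord0 j.
  rewrite (bigD1 i)//= mxE !eqxx big1 ?addr0 ?mulrN1// => j ji.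
  by rewrite mxE (negPf ji) andbF oppr0 mulr0.
apply: (is_derive_comp_rV (F := fun z => x - z) (db := fun j => 'D_(e_ j) g)).
- by move=> j z; exact: smooth_is_derive.
- by move=> j; apply: smooth_continuous; exact: smooth_derive.
- move=> j; have -> : (fun z : 'rV[R]_n => (x - z) ord0 j) = (fun z => x ord0 j - z ord0 j).
    by apply/funext => z; rewrite !mxE.
  have := is_deriveB (is_derive_cst (x ord0 j) y (e_ i)) (is_derive_coord j y (e_ i)).
  by rewrite sub0r.
Qed.

Lemma smooth_reflect g x : smooth_on setT g -> smooth_on setT (fun y => g (x - y)).
Proof.
move=> sg r; elim: r g sg => [|r IH] g sg.
  by split=> // y _; apply: continuous_rsub; exact: smooth_continuous.
apply: (@CrS _ _ _ _ _ (fun i y => - 1 * 'D_(e_ i) g (x - y))).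
- exact: openT.
- by move=> y _; apply: continuous_rsub; exact: smooth_continuous.
- by move=> i y _; rewrite mulN1r; exact: is_derive_reflect.
- move=> i; apply: CrM; [exact: openT|exact (Cr_cst _ _ openT)|].
  exact (IH ('D_(e_ i) g) (smooth_derive i sg)).
Qed.

(** The function y |-> rho (x - y) is itself a test function on U, as its support
is a ball about x that lies in U. *)
Lemma derive_mollify U (r : R) rho i u v x : mollifier r rho -> L1 u ->
  weak_partial U i u v -> [set y | `|y - x| <= r] `<=` U ->
  'D_(e_ i) (conv rho u) x = conv rho v x.
Proof.
move=> mr iu wp xU; have tr := mollifier_test mr; have [sr _ _ supp _] := mr.
have [_ ->] := is_derive_conv i x tr iu.
pose psi y := rho (x - y).
have tpsi : test_function U psi.
  split; first exact: smooth_reflect.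
  exists [set y | `|y - x| <= r]; split=> //; first exact: closed_ball_compact_rV.
  move=> y /= yr; apply: contrapT => /eqP/supp; rewrite distrC => /ltW; exact: yr.
have -> : conv rho v x = Int (fun y => v y * psi y).
  by apply: eq_Int => y; rewrite mulrC.
rewrite (wp _ tpsi) -[RHS]mulN1r -IntZ; last first.
  have tdpsi := test_derive i tpsi; have [M HM] := test_bounded tdpsi.
  have -> : (fun y => u y * 'D_(e_ i) psi y) = (fun y => 'D_(e_ i) psi y * u y).
    by apply/funext => y; rewrite mulrC.
  by apply: (L1_bounded_mul _ HM iu); apply: smooth_measurable; case: tdpsi.
apply: eq_Int => y; have [_ ->] := is_derive_reflect x y i sr.
by ring.
Qed.

End weak_partial.

Section subsequence.
Context {R : realType} {n : nat}.
Local Notation mu := (lebesgue_rV R n).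

(** Choose the subsequence so that the distances to the limits are summable. Then the
sum of the errors is integrable, which bounds all the terms, and finite almost
everywhere, which forces convergence. The family h is finite so that its members
share the subsequence and the majorant. *)
Lemma L1_subsequence (B : finType) (h : B -> nat -> 'rV[R]_n -> R) (h0 : B -> 'rV[R]_n -> R) :
  (forall b k, L1 (h b k)) -> (forall b, L1 (h0 b)) ->
  (forall b, Int (fun x => `|h b k x - h0 b x|) @[k --> \oo] --> (0 : R)) ->
  exists (s : nat -> nat) (S : 'rV[R]_n -> R),
    [/\ L1 S, {ae mu, forall x b, h b (s k) x @[k --> \oo] --> h0 b x} &
        {ae mu, forall x b k, `|h b (s k) x| <= S x}].
Proof.
move=> ih ih0 hcvg.
pose d k x := \sum_(b in B) `|h b k x - h0 b x|.
have id k : L1 (d k) by apply: L1_sum => b _; apply: L1_abs; exact: L1B.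
have d0 k x : 0 <= d k x by exact: sumr_ge0.
have dcvg : Int (d k) @[k --> \oo] --> (0 : R).
  have -> : (fun k => Int (d k)) = (fun k => \sum_(b in B) Int (fun x => `|h b k x - h0 b x|)).
    by apply/funext => k; rewrite Int_sum// => b _; apply: L1_abs; exact: L1B.
  have E0 : \sum_(b in B) 0 = 0 :> R by rewrite big1.
  by rewrite -[X in _ --> X]E0; apply: cvg_sumr; exact: hcvg.
have ex_s k : exists j, Int (d j) <= 1 / (2 ^ (k + 0.+1))%:R.
  have e0 : 0 < 1 / (2 ^ (k + 0.+1))%:R :> R by rewrite divr_gt0// ltr0n expn_gt0.
  have [N HN] := cvg0_leP e0 dcvg; exists N.
  by have := HN N (leqnn N); rewrite ger0_norm// Int_ge0.
have [s sP] := choice ex_s.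
(* the sum of the errors, infinite at most on a negligible set *)
pose T x := (\sum_(k <oo) (d (s k) x)%:E)%E.
have T0 x : (0 <= T x)%E by apply: nneseries_ge0 => k _ _; rewrite lee_fin.
have md k : measurable_fun setT (fun x => (d (s k) x)%:E).
  by apply/measurable_EFinP; exact: L1_measurable.
have mT : measurable_fun setT T.
  by apply: ge0_emeasurable_sum => // k x _ _; rewrite lee_fin.
have IT : (\int[mu]_x T x < +oo)%E.
  rewrite /T integral_nneseries//; last by move=> k x _; rewrite lee_fin.
  apply: (@le_lt_trans _ _ (\sum_(k <oo) (1 / (2 ^ (k + 0.+1))%:R)%:E)%E).
    apply: lee_nneseries => k _; first by move=> _; apply: integral_ge0 => x _; rewrite lee_fin.
    by rewrite -EFin_Int// lee_fin.
  have /cvg_lim : eseries (fun k => (1 / (2 ^ (k + 0.+1))%:R)%:E) @ \oo --> ((1 : R) / 2 ^+ 0)%:E.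
    exact: cvg_geometric_eseries_half.
  by move=> -> //; rewrite ltry.
have iT : mu.-integrable setT T.
  apply/integrableP; split=> //.
  by under eq_integral do rewrite gee0_abs//.
have Tfin : {ae mu, forall x, T x \is a fin_num}.
  by apply: filterS (integrable_ae measurableT iT) => x /(_ I).
pose S x := \sum_(b in B) `|h0 b x| + fine (T x).
have dT x k : T x \is a fin_num -> d (s k) x <= fine (T x).
  move=> Tx; rewrite -lee_fin fineK//.
  apply: le_trans (nneseries_lim_ge (m := 0) k.+1 _); last by move=> j _ _; rewrite lee_fin.
  by rewrite big_nat_recr//= leeDr// sume_ge0// => j _; rewrite lee_fin.
have le_d b k x : `|h b k x - h0 b x| <= d k x.
  by rewrite /d (bigD1 b)//= lerDl sumr_ge0.
exists s, S; split.
- apply: L1D; first by apply: L1_sum => b _; exact: L1_abs.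
  have mf : measurable_fun setT (fun x => fine (T x)).
    by apply: measurableT_comp => //; exact: measurable_fine.
  apply/L1_ge0P => //; first by move=> x; exact: fine_ge0.
  apply: le_lt_trans IT; apply: ge0_le_integral => //.
  - by move=> x _; rewrite lee_fin fine_ge0.
  - exact/measurable_EFinP.
  - by move=> x _; move: (T0 x); case: (T x) => //= _; rewrite leey.
- apply: filterS Tfin => x Tx b.
  have : d (s k) x @[k --> \oo] --> (0 : R).
    apply: cvg_series_cvg_0; apply: nnseries_is_cvg => //.
    by rewrite -/(T x) -ge0_fin_numE.
  move=> dx; apply/subr_cvg0/norm_cvg0P.
  apply: squeeze0 dx => k.
  by rewrite normr_ge0/= le_d.
- apply: filterS Tfin => x Tx b k.
  rewrite -(subrK (h0 b x) (h b (s k) x)) (le_trans (ler_normD _ _))//.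
  rewrite /S addrC lerD//.
    by rewrite (bigD1 b)//= lerDl sumr_ge0.
  exact: le_trans (le_d _ _ _) (dT _ _ Tx).
Qed.

End subsequence.

(** * Integration by parts and symmetry of second derivatives *)

Section integration_by_parts.
Context {R : realType} {n : nat}.
Local Notation e_ := (@basis_vec R n).
Implicit Types (g h : 'rV[R]_n -> R).

Lemma harmonic_dnbhs : (k.+1%:R^-1 : R) @[k --> \oo] --> (0 : R)^'.
Proof.
move=> P; rewrite /dnbhs /within/= => HP.
have [N _ HN] : \forall k \near \oo, (fun x : R => x != 0 -> P x) (k.+1%:R^-1).
  exact: (@cvg_harmonic R _ HP).
by exists N => // k /= Nk; apply: (HN k Nk); rewrite invr_eq0 pnatr_eq0.
Qed.

Lemma is_derive_harmonic g (x v : 'rV[R]_n) (d : R) : is_derive x v g d ->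
  (k.+1%:R * (g (x + k.+1%:R^-1 *: v) - g x)) @[k --> \oo] --> d.
Proof.
move=> [d1 d2].
have gd : (fun h : R => h^-1 *: ((g \o shift x) (h *: v) - g x)) @ 0^' --> d.
  by rewrite -d2; exact: d1.
have -> : (fun k => k.+1%:R * (g (x + k.+1%:R^-1 *: v) - g x)) =
    (fun h : R => h^-1 *: ((g \o shift x) (h *: v) - g x)) \o (fun k => k.+1%:R^-1).
  by apply/funext => k; rewrite /= invrK [x + _]addrC.
exact: cvg_comp harmonic_dnbhs gd.
Qed.

(** The difference quotients of g in the direction e_i have integral 0 by translation
invariance. They are bounded, by the mean value theorem, and converge to dg. *)
Lemma Int_partial0 g (dg : 'rV[R]_n -> R) i (K : set 'rV[R]_n) :
  compact K -> (forall x, ~ K x -> g x = 0) -> continuous g ->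
  (forall x, is_derive x (e_ i) g (dg x)) -> continuous dg ->
  Int dg = 0.
Proof.
move=> cK gK cg gd cdg.
have dgK x : ~ K x -> dg x = 0.
  by move=> xK; have [_ <-] := gd x; exact: derive_off_support cK gK xK.
have ig := continuous_L1 cg cK gK.
have [M dgM] := compact_support_bounded cdg cK dgK.
have M0 : 0 <= M by exact: le_trans (normr_ge0 _) (dgM 0).
pose q k x := k.+1%:R * (g (x + k.+1%:R^-1 *: e_ i) - g x).
have iq k : L1 (q k) by apply/L1Z/L1B => //; exact: L1_shift.
have Iq k : Int (q k) = 0.
  rewrite IntZ; last by apply: L1B => //; exact: L1_shift.
  by rewrite IntB//; [rewrite Int_shift// subrr mulr0|exact: L1_shift].
have /compact_bounded[N [_ HN]] := cK.
have N0 : N < `|N| + 1 by rewrite (le_lt_trans (ler_norm N)) ?ltrDl.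
pose B := [set y : 'rV[R]_n | `|y - 0| <= `|N| + 2].
have cB : compact B by exact: closed_ball_compact_rV.
pose H x := M * \1_B x : R.
have iH : L1 H by apply: L1Z; apply: indic_L1; [exact: compact_bounded|exact: measurable_compact_rV].
have qM k x : `|q k x| <= M.
  have [s _ E] := MVT_line (g := g) (dg := dg) (x := x) (v := e_ i) k.+1%:R^-1 (fun s => gd _).
  rewrite /q E mulrCA mulfV ?mulr1//; exact: dgM.
have qB k x : ~ B x -> q k x = 0.
  move=> xB; have xN : `|N| + 2 < `|x| by rewrite ltNge; apply/negP => H1; apply: xB; rewrite /B/= subr0.
  have K1 y : `|N| + 1 < `|y| -> g y = 0.
    by move=> yN; apply: gK => /(HN _ N0 y)/=; rewrite leNgt yN.
  rewrite /q !K1 ?subrr ?mulr0//; first by apply: lt_trans xN; rewrite ltrD2l ltr1n.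
  have : `|x| <= `|x + k.+1%:R^-1 *: e_ i| + 1.
    rewrite -{1}(addrK (k.+1%:R^-1 *: e_ i) x) (le_trans (ler_normB _ _))// lerD2l.
    rewrite normrZ ger0_norm ?invr_ge0 ?ler0n// -[leRHS]mulr1 ler_pM ?norm_basis_vec//.
    by rewrite invf_le1 ?ler1n ?ltr0n.
  rewrite -lerBlDr; apply: lt_le_trans; rewrite ltrBrDr (le_lt_trans _ xN)//.
  by rewrite -addrA.
have [_ _] : [/\ L1 dg, Int (fun x => `|q k x - dg x|) @[k --> \oo] --> (0 : R) &
      Int (q k) @[k --> \oo] --> Int dg].
  apply: (@dominated_Int R n q dg H) => //.
  - by move=> k; apply: L1_measurable.
  - exact: measurable_continuous_rV.
  - by apply: aeW => x; exact: is_derive_harmonic.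
  - apply: aeW => x k; rewrite /H indicE; have [|/negP xB] := boolP (x \in B).
      by rewrite mulr1.
    by rewrite qB ?normr0 ?mulr0// => /mem_set.
move=> lim1; have lim0 : Int (q k) @[k --> \oo] --> (0 : R).
  have -> : (fun k => Int (q k)) = fun=> 0 by apply/funext.
  exact: cvg_cst.
by apply: (cvg_unique _ lim1 lim0).
Qed.

Lemma Int_derive_test (U : set 'rV[R]_n) psi i : test_function U psi -> Int ('D_(e_ i) psi) = 0.
Proof.
move=> [spsi [K [cK KU psiK]]].
apply: (@Int_partial0 psi _ i K) => //.
- exact: smooth_continuous.
- by move=> x; exact: smooth_is_derive.
- by apply: smooth_continuous; exact: smooth_derive.
Qed.

(** Used when a mean value theorem provides the points y1 and y2 at which two
continuous functions agree, without control on their position. *)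
Lemma eq_of_near_values (D1 D2 : 'rV[R]_n -> R) x : continuous D1 -> continuous D2 ->
  (forall t, 0 < t -> exists y1 y2, [/\ `|y1 - x| <= t, `|y2 - x| <= t & D1 y1 = D2 y2]) ->
  D1 x = D2 x.
Proof.
move=> c1 c2 H.
have near_c (D : 'rV[R]_n -> R) : continuous D -> forall e, 0 < e -> exists2 r, 0 < r & forall y, `|y - x| < r ->
    `|D x - D y| <= e.
  move=> cD e e0.
  have /(@cvgrPdist_le _ _ _ (nbhs x)) /(_ _ e0) /nbhs_ballP[r r0 Hr] := cD x.
  by exists r => // y yr; apply: Hr; rewrite mx_norm_ball /ball_/= distrC.
apply/eqP; rewrite -subr_eq0 -normr_eq0 eq_le normr_ge0 andbT.
apply/ler_addgt0Pl => e e0; rewrite addr0.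
have e2 : 0 < e / 2 by rewrite divr_gt0.
have [r1 r10 H1] := near_c _ c1 _ e2; have [r2 r20 H2] := near_c _ c2 _ e2.
pose t := Num.min r1 r2 / 2.
have m0 : 0 < Num.min r1 r2 by rewrite lt_min r10 r20.
have t0 : 0 < t by rewrite divr_gt0.
have tm : t < Num.min r1 r2 by rewrite /t; lra.
have [y1 [y2 [y1t y2t E]]] := H t t0.
have b1 : `|D1 x - D1 y1| <= e / 2.
  by apply: H1; apply: lt_le_trans (le_lt_trans y1t tm) _; rewrite ge_min lexx.
have b2 : `|D2 x - D2 y2| <= e / 2.
  by apply: H2; apply: lt_le_trans (le_lt_trans y2t tm) _; rewrite ge_min lexx orbT.
have -> : D1 x - D2 x = (D1 x - D1 y1) - (D2 x - D2 y2) by rewrite E opprB addrA subrK.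
by rewrite (splitr e) (le_trans (ler_normB _ _))// lerD.
Qed.

(** Near x, both mixed derivatives take the value of the second difference of g over
a square of side t, divided by t^2. *)
Lemma derive_commute g i j x : smooth_on setT g ->
  'D_(e_ i) ('D_(e_ j) g) x = 'D_(e_ j) ('D_(e_ i) g) x.
Proof.
move=> sg.
have main a b t : exists2 y, `|y - x| <= `|t| *+ 2 &
    g (x + t *: e_ a + t *: e_ b) - g (x + t *: e_ b) - g (x + t *: e_ a) + g x
    = 'D_(e_ b) ('D_(e_ a) g) y * t * t.
  pose G y := g (y + t *: e_ b) - g y.
  have dG y : is_derive y (e_ a) G ('D_(e_ a) g (y + t *: e_ b) - 'D_(e_ a) g y).
    apply: is_deriveB; last exact: smooth_is_derive.
    have := smooth_is_derive a (y + t *: e_ b) sg => H.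
    have := @is_derive_line R n (fun z => g (z + t *: e_ b)) y (e_ a) 0 ('D_(e_ a) g (y + t *: e_ b)).
    rewrite scale0r addr0 => ->.
    have -> : (fun s : R => g (y + s *: e_ a + t *: e_ b)) = (fun s => g (y + t *: e_ b + s *: e_ a)).
      by apply/funext => s; rewrite addrAC.
    by apply/is_derive_line; rewrite scale0r addr0.
  have [s sle E] := MVT_line (g := G)
    (dg := fun y => 'D_(e_ a) g (y + t *: e_ b) - 'D_(e_ a) g y) (x := x) (v := e_ a) t (fun s => dG _).
  have [s' sle' E'] := MVT_line (g := 'D_(e_ a) g) (dg := 'D_(e_ b) ('D_(e_ a) g))
    (x := x + s *: e_ a) (v := e_ b) t (fun s' => smooth_is_derive _ _ (smooth_derive a sg)).
  exists (x + s *: e_ a + s' *: e_ b).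
    rewrite -(addrA x) [x + _]addrC addrK (le_trans (ler_normD _ _))// mulr2n lerD// normrZ.
      by rewrite -[leRHS]mulr1 ler_pM// norm_basis_vec.
    by rewrite -[leRHS]mulr1 ler_pM// norm_basis_vec.
  by rewrite -E' -E /G; ring.
have cont a b : continuous ('D_(e_ b) ('D_(e_ a) g)).
  by apply: smooth_continuous; do 2 apply: smooth_derive.
apply: (@eq_of_near_values ('D_(e_ i) ('D_(e_ j) g)) ('D_(e_ j) ('D_(e_ i) g))) => // t t0.
have t2 : 0 < t / 2 by rewrite divr_gt0.
have tE : `|t / 2| *+ 2 = t by rewrite gtr0_norm// mulr2n -splitr.
have [y1 y1t E1] := main j i (t / 2); have [y2 y2t E2] := main i j (t / 2).
rewrite tE in y1t y2t.
exists y1, y2; split; [exact: y1t|exact: y2t|].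
have t0' : t / 2 != 0 by rewrite gt_eqF.
have E : 'D_(e_ i) ('D_(e_ j) g) y1 * (t / 2) * (t / 2) =
    'D_(e_ j) ('D_(e_ i) g) y2 * (t / 2) * (t / 2).
  apply: (etrans (esym E1)); apply: etrans _ E2.
  rewrite [x + (t / 2) *: e_ j + _]addrAC.
  move: (g (x + t / 2 *: e_ i + t / 2 *: e_ j)) (g (x + t / 2 *: e_ i)) (g (x + t / 2 *: e_ j)) => a b c.
  by rewrite [a - b - c]addrAC.
exact: (mulIf t0' (mulIf t0' E)).
Qed.

End integration_by_parts.

(** * Smooth approximation of weakly differentiable functions *)

Section approximation.
Context {R : realType} {n : nat}.
Local Notation mu := (lebesgue_rV R n).
Local Notation e_ := (@basis_vec R n).
Implicit Types (U K : set 'rV[R]_n).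

Lemma compact_neighborhood K U : compact K -> open U -> K `<=` U ->
  exists2 r : R, 0 < r & forall x, K x -> [set y | `|y - x| <= r] `<=` U.
Proof.
move=> /compact_near_coveringP cK oU KU.
have [|N _ HN] := cK nat \oo (fun k x => [set y | `|y - x| <= k.+1%:R^-1] `<=` U) _.
  move=> x Kx.
  have /nbhs_ballP[e /= e0 xeU] := open_nbhs_nbhs (conj oU (KU x Kx)).
  have e2 : 0 < e / 2 by rewrite divr_gt0.
  have [N _ HN] := near_infty_natSinv_lt (PosNum e2).
  exists (ball x (e / 2), [set k | (N <= k)%N]) => /=.
    by split; [exact: nbhsx_ballx|exists N].
  move=> [x' k] /= [xx' Nk] y /= yx'; apply: xeU; rewrite [e]splitr.
  apply: ball_triangle xx' _; rewrite mx_norm_ball /ball_/= distrC.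
  exact: le_lt_trans yx' (HN k Nk).
exists (N.+1%:R^-1); first by rewrite invr_gt0.
by move=> x Kx; exact: (HN N (leqnn N) x Kx).
Qed.

Lemma mollifierW (r r' : R) rho : r <= r' -> @mollifier R n r rho -> mollifier r' rho.
Proof. by move=> rr [s r0 ev su I1]; split=> // x /su xr; exact: lt_le_trans xr rr. Qed.

(** The approximations through which weak identities are deduced from smooth ones.
On K the derivative of the mollified [u a] is the mollified [v a i], once the
supports of the mollifiers are smaller than the distance from K to the complement
of U. Its power p.+1 is at most the mollification of |v a i|^(p+1), by Jensen.
The latter converges in L1, hence has an integrable majorant S along a
subsequence. *)
Lemma mollification_sequence (A : finType) U K (p : nat)
    (u : A -> 'rV[R]_n -> R) (v : A -> 'I_n -> 'rV[R]_n -> R) :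
  open U -> bounded_set U -> compact K -> K `<=` U ->
  (forall a, L1 (u a)) -> (forall a x, ~ U x -> u a x = 0) ->
  (forall a i, L1 (v a i)) -> (forall a i x, ~ U x -> v a i x = 0) ->
  (forall a i, L1 (fun x => `|v a i x| ^+ p.+1)) ->
  (forall a i, weak_partial U i (u a) (v a i)) ->
  exists (w : A -> nat -> 'rV[R]_n -> R) (S : 'rV[R]_n -> R),
    [/\ (forall a k, smooth_on setT (w a k)), L1 S,
        {ae mu, forall x, (forall a, w a k x @[k --> \oo] --> u a x) /\
           (K x -> forall a i, 'D_(e_ i) (w a k) x @[k --> \oo] --> v a i x)},
        {ae mu, forall x, K x -> forall a i k, `|'D_(e_ i) (w a k) x| ^+ p.+1 <= S x} &
        forall a M, (forall x, `|u a x| <= M) -> forall k x, `|w a k x| <= M].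
Proof.
move=> oU bU cK KU iu u0 iv v0 ivp wp.
have [r r0 KrU] := compact_neighborhood cK oU KU.
have ex_rho k : exists rho, mollifier r rho /\ @mollifier R n k.+1%:R^-1 rho.
  have r1 : 0 < Num.min r k.+1%:R^-1 by rewrite lt_min r0 invr_gt0 ltr0n.
  have [rho mrho] := @exists_mollifier R n _ r1; exists rho.
  by split; apply: mollifierW mrho; rewrite ge_min lexx ?orbT.
have [rho rhoP] := choice ex_rho.
have mr k : mollifier r (rho k) by case: (rhoP k).
have mrho k : mollifier k.+1%:R^-1 (rho k) by case: (rhoP k).
(* one family, so that u, v and |v|^(p+1) share a subsequence and a majorant *)
pose B : finType := (A + (A * 'I_n) + (A * 'I_n))%type.
pose h0 (b : B) : 'rV[R]_n -> R := match b with
  | inl (inl a) => u a | inl (inr (a, i)) => v a i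
  | inr (a, i) => fun x => `|v a i x| ^+ p.+1 end.
have ih0 b : L1 (h0 b) by case: b => [[a|[a i]]|[a i]]; [exact: iu|exact: iv|exact: ivp].
have h00 b x : ~ U x -> h0 b x = 0.
  case: b => [[a|[a i]]|[a i]] /=; [exact: u0|exact: v0|move=> /v0 ->].
  by rewrite normr0 exprS mul0r.
have ih b k : L1 (conv (rho k) (h0 b)) by have [] := mollify_L1 (mrho k) (ih0 b).
have [s [S [iS cvgS domS]]] := L1_subsequence ih ih0
  (fun b => mollification_cvg mrho bU (h00 b) (ih0 b)).
have dE a i k x : K x -> 'D_(e_ i) (conv (rho (s k)) (u a)) x = conv (rho (s k)) (v a i) x.
  by move=> Kx; apply: (derive_mollify (mr _) (iu a) (wp a i)); exact: KrU.
exists (fun a k => conv (rho (s k)) (u a)), S; split=> //.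
- by move=> a k; apply: smooth_conv => //; exact: mollifier_test (mrho _).
- apply: filterS cvgS => x cx; split=> [a|Kx a i]; first exact: (cx (inl (inl a))).
  have -> : (fun k => 'D_(e_ i) (conv (rho (s k)) (u a)) x) = (fun k => conv (rho (s k)) (v a i) x).
    by apply/funext => k; exact: dE.
  exact: (cx (inl (inr (a, i)))).
- apply: filterS domS => x dx Kx a i k; rewrite dE//.
  apply: le_trans (le_trans (ler_norm _) (dx (inr (a, i)) k)) => /=.
  apply: le_trans (conv_expr_le x (mrho _) (L1_abs (iv a i)) (fun y => normr_ge0 _) (ivp a i)).
  by rewrite lerXn2r ?nnegrE ?(conv_le_abs x (mrho _) (iv a i))// Int_ge0// => y;
    rewrite mulr_ge0//; case: (mrho (s k)).
- move=> a M uM k x; apply: le_trans (conv_le_abs x (mrho _) (iu a)) _.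
  have tr := mollifier_test (mrho (s k)); have [_ rge0 ev _ _] := mrho (s k).
  have irho : L1 (fun y => rho (s k) (x - y)).
    have -> : (fun y => rho (s k) (x - y)) = (fun y => rho (s k) (y - x)).
      by apply/funext => y; rewrite -ev opprB.
    exact: L1_shift (test_L1 tr).
  rewrite -[M]mulr1 -(Int_mollifier_sub x (mrho (s k))) -IntZ//.
  apply: Int_le; [exact: (conv_L1 _ tr (L1_abs (iu a)))|exact: L1Z|].
  by move=> y; rewrite mulrC ler_wpM2r.
Qed.

End approximation.

(** * Smooth cutoffs *)

Section cutoff.
Context {R : realType} {m : nat}.
Local Notation e_ := (@basis_vec R m).

(** Mollify the indicator of the r/2-neighbourhood of C at scale r/4: the result is 1
on the r/4-neighbourhood and 0 off the 3r/4-neighbourhood. *)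
Lemma exists_cutoff (C O : set 'rV[R]_m) : compact C -> open O -> C `<=` O ->
  exists chi : 'rV[R]_m -> R, test_function O chi /\
    exists N, [/\ open N, C `<=` N & forall y, N y -> chi y = 1].
Proof.
move=> cC oO CO; have [r r0 CrO] := compact_neighborhood cC oO CO.
pose nb (s : R) := \bigcup_(x in C) (ball x s : set 'rV[R]_m).
have nbP s y : nb s y <-> exists2 x, C x & `|y - x| < s.
  rewrite /nb; split=> [[x Cx]|[x Cx xy]].
    by rewrite mx_norm_ball /ball_/= distrC; exists x.
  by exists x => //; rewrite mx_norm_ball /ball_/= distrC.
have onb s : 0 < s -> open (nb s).
  by move=> s0; apply: bigcup_open => x _; exact: ball_open.
have bnb s : bounded_set (nb s).
  have [M [_ HM]] := compact_bounded cC.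
  have M0 : M < `|M| + 1 by rewrite (le_lt_trans (ler_norm M)) ?ltrDl.
  exists (`|M| + 1 + `|s|); split; first exact: num_real.
  move=> t Mt y /nbP[x Cx xy]; apply: le_trans (ltW Mt).
  rewrite -(subrK x y) addrC (le_trans (ler_normD _ _))// lerD//; first exact: HM M0 _ Cx.
  by rewrite (le_trans (ltW xy))// ler_norm.
have r2 : 0 < r / 2 by rewrite divr_gt0.
have r4 : 0 < r / 4 by rewrite divr_gt0.
have mA := measurable_open_rV (onb _ r2).
pose g : 'rV[R]_m -> R := \1_(nb (r / 2)).
have ig : L1 g by exact: indic_L1.
have [rho mr] := @exists_mollifier R m _ r4.
have tr := mollifier_test mr; have [_ _ _ supp _] := mr.
pose chi := conv rho g.
have schi : smooth_on setT chi by exact: smooth_conv.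
have chi_off y : chi y != 0 -> exists2 x, C x & `|y - x| < r / 2 + r / 4.
  move=> chiy; apply: contrapT => Hy; move/eqP: chiy; apply.
  rewrite /chi /conv -[RHS](@Int0 R m); apply: eq_Int => z.
  have [->|/supp yz] := eqVneq (rho (y - z)) 0; first by rewrite mul0r.
  rewrite /g indicE memNset ?mulr0// => /nbP[x Cx zx]; apply: Hy; exists x => //.
  by rewrite -(subrK z y) -addrA (le_lt_trans (ler_normD _ _))// [ltRHS]addrC ltrD.
have clos y : closure [set y | chi y != 0] y -> exists2 x, C x & `|y - x| < r.
  move=> cy; have [z [/= /chi_off[x Cx zx]]] := cy _ (nbhsx_ballx y (r / 4) r4).
  rewrite mx_norm_ball /ball_/= => yz; exists x => //.
  rewrite -(subrK z y) -addrA (le_lt_trans (ler_normD _ _))//.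
  have -> : r = r / 4 + (r / 2 + r / 4) by field.
  by rewrite ltrD.
exists chi; split; [split=> //|].
  exists (closure [set y | chi y != 0]); split.
  - apply: bounded_closed_compact; last exact: closed_closure.
    have [M [Mr HM]] := bnb r; exists M; split=> // t Mt y /clos H.
    by apply: (HM t Mt); apply/nbP.
  - by move=> y /clos[x Cx yx]; apply: (CrO x Cx) => /=; exact: ltW.
  - move=> y cy; apply: contrapT => /eqP chiy; apply: cy; exact: subset_closure.
exists (nb (r / 4)); split; first exact: onb.
  by move=> x Cx; apply/nbP; exists x => //; rewrite subrr normr0.
move=> y /nbP[x Cx yx]; rewrite -(Int_mollifier_sub y mr); apply: eq_Int => z.
have [->|/supp yz] := eqVneq (rho (y - z)) 0; first by rewrite mul0r.
rewrite /g indicE mem_set ?mulr1//; apply/nbP; exists x => //.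
rewrite -(subrK y z) -addrA (le_lt_trans (ler_normD _ _))// distrC.
have -> : r / 2 = r / 4 + r / 4 by field.
by rewrite ltrD.
Qed.

(** Multiply g by a cutoff that is 1 near C, so that the derivatives on C do not
change. *)
Lemma smooth_extension (C O : set 'rV[R]_m) (g : 'rV[R]_m -> R) :
  compact C -> open O -> C `<=` O -> smooth_on O g ->
  exists b : 'rV[R]_m -> R, [/\ test_function O b, forall y, C y -> b y = g y &
    forall i y, C y -> 'D_(e_ i) b y = 'D_(e_ i) g y].
Proof.
move=> cC oO CO sg; have [chi [[schi [K [cK KO chiK]]] [N [oN CN chiN]]]] := exists_cutoff cC oO CO.
pose b y := if `[< O y >] then chi y * g y else 0.
have near_g y : C y -> \forall z \near y, b z = g z.
  move=> Cy; apply: filterS (open_nbhs_nbhs (conj (openI oO oN) (conj (CO _ Cy) (CN _ Cy)))).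
  by move=> z [Oz Nz]; rewrite /b asboolT// chiN// mul1r.
exists b; split.
- split; last first.
    exists K; split=> // y Ky; rewrite /b; case: asboolP => // _.
    by rewrite chiK// mul0r.
  move=> r; apply: Cr_local => y _.
  have [Oy|Oy] := pselect (O y).
    exists O, (fun z => chi z * g z); split=> //.
      apply: CrM => //; apply: Cr_local => z Oz; exists setT, chi.
      by split=> //; exact: openT.
    by move=> z /set_mem Oz; rewrite /b asboolT.
  exists (~` K), (fun=> 0); split=> //.
  - by apply: closed_openC; exact: compact_closed_rV.
  - by move=> /KO.
  - exact (Cr_cst _ _ (closed_openC (compact_closed_rV cK))).
  - move=> z /set_mem Kz; rewrite /b; case: asboolP => // _.
    by rewrite chiK// mul0r.
- by move=> y /near_g/nbhs_singleton.
- by move=> i y Cy; apply: near_eq_derive; exact: near_g.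
Qed.

End cutoff.

(** * Signs in the exterior algebra *)

Section signs.
Local Close Scope classical_set_scope.
Context {R : realType} {n : nat}.
Implicit Types (A B C I J : {set 'I_n}) (i j : 'I_n).

(** The sign in dx^i /\ dx^(J \ i) = eps i J dx^J, for i in J. *)
Definition eps i J : R := (-1) ^+ inversions [set i]%SET (J :\ i).

Lemma inversionsUl A B C : [disjoint A & B] ->
  inversions (A :|: B) C = (inversions A C + inversions B C)%N.
Proof.
move=> dAB; rewrite /inversions -cardsUI.
set X := (_ :|: _ in RHS); set Y := (_ :&: _ in RHS).
have -> : Y = finset.set0.
  apply/setP => -[a c]; rewrite !inE /=; apply/negP => /andP[/and3P[aA _ _] /and3P[aB _ _]].
  by have := disjointFr dAB aA; rewrite aB.
rewrite cards0 addn0; apply: eq_card => -[a c]; rewrite !inE /=.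
by case: (a \in A); case: (a \in B); case: (c \in C); rewrite /= ?orbF ?orbb.
Qed.

Lemma inversionsUr A B C : [disjoint B & C] ->
  inversions A (B :|: C) = (inversions A B + inversions A C)%N.
Proof.
move=> dBC; rewrite /inversions -cardsUI.
set X := (_ :|: _ in RHS); set Y := (_ :&: _ in RHS).
have -> : Y = finset.set0.
  apply/setP => -[a c]; rewrite !inE /=; apply/negP => /andP[/and3P[_ aA _] /and3P[_ aB _]].
  by have := disjointFr dBC aA; rewrite aB.
rewrite cards0 addn0; apply: eq_card => -[a c]; rewrite !inE /=.
by case: (a \in A); case: (c \in B); case: (c \in C); rewrite /= ?orbF ?orbb.
Qed.

Lemma inversions11 i j : inversions [set i]%SET [set j]%SET = (j < i)%N.
Proof.
rewrite /inversions; case: ltnP => ji.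
  apply: etrans (cards1 (i, j)); apply: eq_card => -[a b]; rewrite !inE /= xpair_eqE.
  by apply/and3P/andP => [[/eqP -> /eqP -> _]|[/eqP -> /eqP ->]]; rewrite ?eqxx.
apply/eqP; rewrite cards_eq0; apply/eqP/setP => -[a b]; rewrite !inE /=.
by apply/negP => /and3P[/eqP -> /eqP ->]; rewrite ltnNge ji.
Qed.

Lemma inversions1l i A : inversions [set i]%SET A = #|[set b in A | (b < i)%N]%SET|.
Proof.
rewrite /inversions -[RHS](card_imset (f := pair i)); last by move=> a b [].
apply: eq_card => -[a b]; rewrite !inE /=; apply/and3P/imsetP.
  by move=> [/eqP -> bA bi]; exists b; rewrite ?inE ?bA.
by move=> [c]; rewrite inE => /andP[cA ci] [-> ->].
Qed.

Lemma inversions1r i A : inversions A [set i]%SET = #|[set b in A | (i < b)%N]%SET|.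
Proof.
rewrite /inversions -[RHS](card_imset (f := fun b => (b, i))); last by move=> a b [].
apply: eq_card => -[a b]; rewrite !inE /=; apply/and3P/imsetP.
  by move=> [aA /eqP -> ia]; exists a; rewrite ?inE ?aA.
by move=> [c]; rewrite inE => /andP[cA ci] [-> ->].
Qed.

Lemma inversions_flip i A : i \notin A ->
  (inversions [set i]%SET A + inversions A [set i]%SET)%N = #|A|.
Proof.
move=> iA; rewrite inversions1l inversions1r.
rewrite -(cardsID [set b : 'I_n | (b < i)%N]%SET A); congr (_ + _)%N.
  by apply: eq_card => b; rewrite !inE.
apply: eq_card => b; rewrite !inE andbC; case bA: (b \in A) => //=; rewrite ?andbF ?andbT //.
by rewrite ltn_neqAle -leqNgt; case: eqVneq => // E; rewrite -(val_inj E) in bA; rewrite bA in iA.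
Qed.

Lemma inversions0r A : inversions A finset.set0 = 0%N.
Proof.
by apply/eqP; rewrite cards_eq0; apply/eqP/setP => -[a b]; rewrite !inE /= andbF.
Qed.

Lemma eps_set1 i : eps i [set i]%SET = 1.
Proof. by rewrite /eps finset.setDv inversions0r. Qed.

Lemma inversions_D1 i j J : j \in J -> i != j ->
  inversions [set i]%SET (J :\ i) = ((j < i) + inversions [set i]%SET ((J :\ j) :\ i))%N.
Proof.
move=> jJ ij; rewrite -inversions11 -inversionsUr; last first.
  by rewrite disjoints1 !inE eqxx andbF.
congr (inversions _ _); apply/setP => x; rewrite !inE.
have [->|xj] /= := eqVneq x j; first by rewrite jJ eq_sym ij.
by [].
Qed.

(** The sign rule behind dx^i /\ dx^j = - dx^j /\ dx^i. *)
Lemma eps_swap i j J : i \in J -> j \in J -> i != j ->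
  eps i J * eps j (J :\ i) = - (eps j J * eps i (J :\ j)).
Proof.
move=> iJ jJ ij; rewrite /eps.
rewrite (inversions_D1 jJ ij) (inversions_D1 iJ); last by rewrite eq_sym.
rewrite !exprD; have : (i : nat) != j by [].
by case: ltngtP => //= _ _; rewrite expr0 expr1; ring.
Qed.

End signs.

(** * The weak differential in coefficients *)

Section weak_d_coefficients.
Context {R : realType} {n : nat}.
Local Notation e_ := (@basis_vec R n).
Implicit Types (I J : {set 'I_n}) (psi : 'rV[R]_n -> R).

(** The identity that defines d phi = theta, for the test form psi dx^(~: J), up to a
sign common to both sides. Here phi and theta are forms extended by 0 off U. *)
Definition coef_weak_d (U : set 'rV[R]_n) (k : nat) (phi theta : 'rV[R]_n -> ext R n) :=
  forall J psi, #|J| = k.+1 -> test_function U psi ->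
    Int (fun x => theta x J * psi x) =
    - \sum_(i in J) @eps R n i J * Int (fun x => phi x (J :\ i)%SET * 'D_(e_ i) psi x).

Variables (U : set 'rV[R]_n) (G : 'rV[R]_n -> R) (p : nat).
Hypotheses (oU : open U) (bU : bounded_set U).
Hypothesis G1 : forall x, 1 <= G x.
Hypothesis iG : L1 (fun x => \1_U x * G x ^+ p.+1).

(** The growth of the coefficients of a form of degree k: if G is in L^n(U), such
functions are in L^(n/k), and the degrees add up in products. The indicator
forces them to vanish off U. *)
Definition growth (k : nat) (g : 'rV[R]_n -> R) := measurable_fun setT g /\
  exists2 C, 0 <= C & forall x, `|g x| <= C * (\1_U x * G x ^+ k).

Let G0 x : 0 <= G x. Proof. exact: le_trans ler01 (G1 x). Qed.

Let ind01 x : 0 <= (\1_U x : R) <= 1.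
Proof. by rewrite indicE; case: (x \in U); rewrite ?lexx ?ler01. Qed.

Let ind0 x : 0 <= (\1_U x : R). Proof. by case/andP: (ind01 x). Qed.

Let ind1 x : (\1_U x : R) <= 1. Proof. by case/andP: (ind01 x). Qed.

Lemma growth_off k g x : growth k g -> ~ U x -> g x = 0.
Proof.
move=> [_ [C _ gC]] Ux; apply/normr0_eq0/le_anti; rewrite normr_ge0 andbT.
by apply: le_trans (gC x) _; rewrite indicE memNset// mul0r mulr0.
Qed.

Lemma growthW k k' g : (k <= k')%N -> growth k g -> growth k' g.
Proof.
move=> kk' [mg [C C0 gC]]; split=> //; exists C => // x.
apply: le_trans (gC x) _; apply: ler_wpM2l => //; apply: ler_wpM2l => //; exact: ler_weXn2l.
Qed.

Lemma growthM j k g h : growth j g -> growth k h -> growth (j + k) (fun x => g x * h x).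
Proof.
move=> [mg [C C0 gC]] [mh [D D0 hD]]; split; first exact: measurable_funM.
exists (C * D) => [|x]; first exact: mulr_ge0.
rewrite normrM; apply: le_trans (ler_pM _ _ (gC x) (hD x)) _ => //.
have [Ux|Ux] := boolP (x \in U); rewrite !indicE ?Ux ?(negPf Ux) ?mul1r ?mul0r ?mulr0//.
by rewrite exprD mulrACA.
Qed.

Lemma growth0 k : growth k (fun=> 0).
Proof. by split=> //; exists 0 => // x; rewrite normr0 mul0r. Qed.

Lemma growthD k g h : growth k g -> growth k h -> growth k (fun x => g x + h x).
Proof.
move=> [mg [C C0 gC]] [mh [D D0 hD]]; split; first exact: measurable_funD.
exists (C + D) => [|x]; first exact: addr_ge0.
by rewrite (le_trans (ler_normD _ _))// mulrDl lerD.
Qed.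

Lemma growth_sum k (A : Type) (s : seq A) (P : pred A) (g : A -> 'rV[R]_n -> R) :
  (forall a, P a -> growth k (g a)) -> growth k (fun x => \sum_(a <- s | P a) g a x).
Proof.
move=> bg; elim: s => [|a s IH]; first by under eq_fun do rewrite big_nil; exact: growth0.
under eq_fun do rewrite big_cons.
by case Pa: (P a) => //; apply: growthD => //; exact: bg.
Qed.

Lemma growthZ k (c : R) g : growth k g -> growth k (fun x => c * g x).
Proof.
move=> [mg [C C0 gC]]; split; first exact: measurable_funM.
exists (`|c| * C) => [|x]; first exact: mulr_ge0.
by rewrite normrM -mulrA ler_wpM2l.
Qed.

Lemma growth_L1 k g : (k <= p.+1)%N -> growth k g -> L1 g.
Proof.
move=> kp /(growthW kp) [mg [C C0 gC]].
by apply: (L1_le (h := fun x => C * (\1_U x * G x ^+ p.+1))) => //; exact: L1Z.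
Qed.

Lemma growth_expr_L1 g : growth 1 g -> L1 (fun x => `|g x| ^+ p.+1).
Proof.
move=> [mg [C C0 gC]].
apply: (L1_le (h := fun x => C ^+ p.+1 * (\1_U x * G x ^+ p.+1))).
- by apply: measurable_funX; exact: measurableT_comp.
- move=> x; rewrite ger0_norm ?exprn_ge0//.
  apply: (@le_trans _ _ ((C * (\1_U x * G x ^+ 1)) ^+ p.+1)).
    by rewrite lerXn2r ?nnegrE// !mulr_ge0// expr1.
  rewrite expr1 !exprMn ler_wpM2l ?exprn_ge0// indicE; case: (x \in U).
    by rewrite expr1n.
  by rewrite expr0n mul0r.
- exact: L1Z.
Qed.

Lemma bounded_mul_L1 k g psi : (k <= p.+1)%N -> growth k g -> smooth_on setT psi ->
  (exists M, forall x, `|psi x| <= M) -> L1 (fun x => g x * psi x).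
Proof.
move=> kp bg spsi [M psiM].
have -> : (fun x => g x * psi x) = (fun x => psi x * g x) by apply/funext => x; rewrite mulrC.
by apply: (L1_bounded_mul (smooth_measurable spsi) psiM); exact: growth_L1 bg.
Qed.

(** A coarse form of Young's inequality, by which G^k |dw| is dominated as soon as
G^(p+1) and |dw|^(p+1) are. *)
Lemma expr_mul_le (k : nat) (a t : R) : (k <= p)%N -> 1 <= a -> 0 <= t ->
  a ^+ k * t <= a ^+ p.+1 + t ^+ p.+1.
Proof.
move=> kp a1 t0; have a0 : 0 <= a by exact: le_trans a1.
apply: (@le_trans _ _ (a ^+ p * t)); first by rewrite ler_wpM2r// ler_weXn2l.
have [at_|/ltW ta] := leP a t.
  apply: (@le_trans _ _ (t ^+ p.+1)); last by rewrite lerDr exprn_ge0.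
  by rewrite exprSr ler_wpM2r// lerXn2r.
apply: (@le_trans _ _ (a ^+ p.+1)); last by rewrite lerDl exprn_ge0.
by rewrite exprSr ler_wpM2l// exprn_ge0.
Qed.

(** The Leibniz rule d (u phi) = du /\ phi + u d phi. The hypothesis on phi, tested
against w psi with w a mollification of u, is an identity between three
integrals. In the two that do not differentiate w, dominated convergence applies
as w is bounded uniformly. In the third one, the integrand is bounded by a
multiple of G^k |dw|, hence of G^(p+1) + S, with S the majorant of |dw|^(p+1). *)
Lemma coef_weak_d_mul k (phi theta : 'rV[R]_n -> ext R n) (u : 'rV[R]_n -> R)
    (v : 'I_n -> 'rV[R]_n -> R) : (k <= p)%N ->
  (forall I, growth k (fun x => phi x I)) -> (forall J, growth k.+1 (fun x => theta x J)) ->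
  growth 0 u -> (forall i, growth 1 (v i)) -> (forall i, weak_partial U i u (v i)) ->
  coef_weak_d U k phi theta ->
  coef_weak_d U k (fun x => [ffun I : {set 'I_n} => u x * phi x I])
    (fun x => [ffun J : {set 'I_n} => \sum_(i in J) @eps R n i J * (v i x * phi x (J :\ i)%SET)
                + u x * theta x J]).
Proof.
move=> kp bphi btheta bu bv wp wphi J psi cJ tpsi.
have [spsi [K [cK KU psiK]]] := tpsi.
have [M psiM] := test_bounded tpsi.
have psi0 x : ~ K x -> psi x = 0 by exact: psiK.
have M0 : 0 <= M by exact: le_trans (normr_ge0 _) (psiM 0).
have kp1 : (k <= p.+1)%N by exact: leqW.
have iu : L1 u by exact: (growth_L1 (k := 0)) bu.
have iv i : L1 (v i) by exact: (growth_L1 (k := 1)) (bv i).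
have [C C0 uC] : exists2 C, 0 <= C & forall x, `|u x| <= C.
  have [_ [C C0 uC]] := bu; exists C => // x; apply: le_trans (uC x) _.
  by rewrite expr0 mulr1 -[leRHS]mulr1 ler_wpM2l.
have [w [S [sw iS wcvg wdom wM]]] := @mollification_sequence R n unit U K p
  (fun=> u) (fun=> v) oU bU cK KU (fun=> iu) (fun _ x => growth_off bu)
  (fun _ i => iv i) (fun _ i x => growth_off (bv i)) (fun _ i => growth_expr_L1 (bv i)) (fun _ i => wp i).
have wC l x : `|w tt l x| <= C by exact: wM.
have mw l : measurable_fun setT (w tt l) by exact: smooth_measurable.
have mpsi := smooth_measurable spsi.
have dpsiM i : exists M, forall x, `|'D_(e_ i) psi x| <= M by exact: test_bounded (test_derive i tpsi).
have sdpsi i : smooth_on setT ('D_(e_ i) psi) by exact: smooth_derive.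
(* the integrals in which w is not differentiated *)
have lim (k' : nat) (g q : 'rV[R]_n -> R) : (k' <= p.+1)%N -> growth k' g -> smooth_on setT q ->
    (exists M, forall x, `|q x| <= M) ->
    Int (fun x => g x * (w tt l x * q x)) @[l --> \oo] --> Int (fun x => g x * (u x * q x)).
  move=> kp' bg sq [Mq qM].
  have ig : L1 g by exact: growth_L1 bg.
  have mq := smooth_measurable sq.
  have [_ _] : [/\ L1 (fun x => g x * (u x * q x)),
    Int (fun x => `|g x * (w tt k x * q x) - g x * (u x * q x)|) @[k --> \oo] --> (0 : R) &
    Int (fun x => g x * (w tt l x * q x)) @[l --> \oo] --> Int (fun x => g x * (u x * q x))].
    apply: (@dominated_Int R n _ _ (fun x => C * Mq * `|g x|)).
    - by move=> l; apply: measurable_funM; [exact: L1_measurable|apply: measurable_funM].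
    - apply: measurable_funM; [exact: L1_measurable|apply: measurable_funM => //].
      exact: L1_measurable.
    - apply: filterS wcvg => x [cx _]; apply: cvgM; first exact: cvg_cst.
      by apply: cvgM; [exact: cx|exact: cvg_cst].
    - by apply: L1Z; exact: L1_abs.
    - apply: aeW => x l; rewrite !normrM mulrC ler_wpM2r// ler_pM//.
  by [].
(* the integrals in which w is differentiated *)
have limD i : Int (fun x => phi x (J :\ i)%SET * ('D_(e_ i) (w tt l) x * psi x)) @[l --> \oo] -->
    Int (fun x => phi x (J :\ i)%SET * (v i x * psi x)).
  have [mphi [B B0 phiB]] := bphi (J :\ i)%SET.
  have [_ _] : [/\ L1 (fun x => phi x (J :\ i)%SET * (v i x * psi x)),
    Int (fun x => `|phi x (J :\ i)%SET * ('D_(e_ i) (w tt k) x * psi x)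
        - phi x (J :\ i)%SET * (v i x * psi x)|) @[k --> \oo] --> (0 : R) &
    Int (fun x => phi x (J :\ i)%SET * ('D_(e_ i) (w tt l) x * psi x)) @[l --> \oo] -->
    Int (fun x => phi x (J :\ i)%SET * (v i x * psi x))].
    apply: (@dominated_Int R n _ _ (fun x => B * M * (\1_U x * G x ^+ p.+1 + `|S x|))).
    - move=> l; apply: measurable_funM => //; apply: measurable_funM => //.
      by apply: smooth_measurable; exact: smooth_derive.
    - by apply: measurable_funM => //; apply: measurable_funM => //; exact: L1_measurable.
    - apply: filterS wcvg => x [_ cx]; apply: cvgM; first exact: cvg_cst.
      have [Kx|Kx] := pselect (K x); first by apply: cvgM; [exact: cx|exact: cvg_cst].
      by rewrite (psi0 x Kx) mulr0; under eq_fun do rewrite mulr0; exact: cvg_cst.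
    - by apply: L1Z; apply: L1D => //; exact: L1_abs.
    - apply: filterS wdom => x dx l.
      have S0 : 0 <= \1_U x * G x ^+ p.+1 + `|S x|.
        by rewrite addr_ge0// mulr_ge0 ?exprn_ge0.
      have [Kx|Kx] := pselect (K x); last by rewrite (psi0 x Kx) !mulr0 normr0 !mulr_ge0.
      have := phiB x; rewrite !indicE mem_set ?mul1r; last exact: KU.
      move=> phiBx; rewrite mulrA normrM mulrAC ler_pM//.
      rewrite normrM; apply: le_trans (ler_wpM2r (normr_ge0 _) phiBx) _.
      rewrite -mulrA ler_wpM2l//; apply: le_trans (expr_mul_le kp (G1 x) (normr_ge0 _)) _.
      by rewrite lerD2l (le_trans (dx Kx tt i l))// ler_norm.
  by [].
have eqn l : Int (fun x => theta x J * (w tt l x * psi x)) =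
   - \sum_(i in J) @eps R n i J * (Int (fun x => phi x (J :\ i)%SET * ('D_(e_ i) (w tt l) x * psi x))
      + Int (fun x => phi x (J :\ i)%SET * (w tt l x * 'D_(e_ i) psi x))).
  have tw : test_function U (fun x => w tt l x * psi x) by exact: testM.
  rewrite (wphi J _ cJ tw); congr (- _); apply: eq_bigr => i _; congr (_ * _).
  have t1 : test_function U (fun x => 'D_(e_ i) (w tt l) x * psi x).
    by apply: testM => //; exact: smooth_derive.
  have t2 : test_function U (fun x => w tt l x * 'D_(e_ i) psi x).
    by apply: testM => //; exact: test_derive.
  rewrite -IntD; last 2 first.
  - by apply: bounded_mul_L1 (bphi _) t1.1 (test_bounded t1).
  - by apply: bounded_mul_L1 (bphi _) t2.1 (test_bounded t2).
  apply: eq_Int => x; rewrite -mulrDr; congr (_ * _).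
  have [_ ->] := is_deriveM_rV (smooth_is_derive i x (sw tt l)) (smooth_is_derive i x spsi).
  by rewrite addrC.
have limR : Int (fun x => theta x J * (w tt l x * psi x)) @[l --> \oo] -->
   - \sum_(i in J) @eps R n i J * (Int (fun x => phi x (J :\ i)%SET * (v i x * psi x))
      + Int (fun x => phi x (J :\ i)%SET * (u x * 'D_(e_ i) psi x))).
  have -> : (fun l => Int (fun x => theta x J * (w tt l x * psi x))) = _ := funext eqn.
  apply: cvgN; apply: cvg_sumr => i; apply: cvgM; first exact: cvg_cst.
  by apply: cvgD; [exact: limD|apply: (lim k)].
have limL := lim k.+1 _ psi kp (btheta J) spsi (test_bounded tpsi).
have E := cvg_unique (@norm_hausdorff _ _) limL limR.
have it : L1 (fun x => theta x J * (u x * psi x)).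
  have -> : (fun x => theta x J * (u x * psi x)) = (fun x => (theta x J * u x) * psi x).
    by apply/funext => x; rewrite mulrA.
  apply: (@bounded_mul_L1 k.+1) => //; last exact: test_bounded tpsi.
  by rewrite -[k.+1]addn0; exact: growthM.
have iphi i : L1 (fun x => phi x (J :\ i)%SET * (v i x * psi x)).
  have -> : (fun x => phi x (J :\ i)%SET * (v i x * psi x)) =
      (fun x => (phi x (J :\ i)%SET * v i x) * psi x).
    by apply/funext => x; rewrite mulrA.
  apply: (@bounded_mul_L1 k.+1) => //; last exact: test_bounded tpsi.
  by rewrite -[k.+1]addn1; exact: growthM.
transitivity (Int (fun x => \sum_(i in J) @eps R n i J * (phi x (J :\ i)%SET * (v i x * psi x))
    + theta x J * (u x * psi x))).
  apply: eq_Int => x; rewrite ffunE mulrDl mulr_suml; congr (_ + _); last by ring.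
  by apply: eq_bigr => i _; ring.
rewrite IntD//; last by apply: L1_sum => i _; exact: L1Z.
rewrite Int_sum; last by move=> i _; exact: L1Z.
have -> : \sum_(i in J) Int (fun x => @eps R n i J * (phi x (J :\ i)%SET * (v i x * psi x))) =
    \sum_(i in J) @eps R n i J * Int (fun x => phi x (J :\ i)%SET * (v i x * psi x)).
  by apply: eq_bigr => i _; rewrite IntZ.
rewrite E.
under [X in _ + - X]eq_bigr do rewrite mulrDr.
rewrite big_split/= opprD addrA subrr add0r; congr (- _); apply: eq_bigr => i _; congr (_ * _).
by apply: eq_Int => x; rewrite ffunE; ring.
Qed.

(** This is d d = 0: the terms in which the test function is differentiated along i
and j in the two orders cancel, by [eps_swap] and [derive_commute]. *)
Lemma coef_weak_d_closed k (phi theta : 'rV[R]_n -> ext R n) :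
  coef_weak_d U k phi theta -> coef_weak_d U k.+1 theta (fun=> [ffun=> 0]).
Proof.
move=> wphi J psi cJ tpsi.
have spsi : smooth_on setT psi by case: tpsi.
have -> : Int (fun x => [ffun=> 0] J * psi x) = 0.
  by rewrite -[RHS](@Int0 R n); apply: eq_Int => x; rewrite ffunE mul0r.
pose F (i j : 'I_n) := @eps R n i J * @eps R n j (J :\ i)%SET *
   Int (fun x => phi x ((J :\ i) :\ j)%SET * 'D_(e_ j) ('D_(e_ i) psi) x).
have -> : \sum_(i in J) @eps R n i J * Int (fun x => theta x (J :\ i)%SET * 'D_(e_ i) psi x) =
   - \sum_(i in J) \sum_(j in J | j != i) F i j.
  rewrite -sumrN; apply: eq_bigr => i iJ.
  rewrite (wphi _ _ _ (test_derive i tpsi)); last first.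
    by have := cardsD1 i J; rewrite iJ cJ => -[].
  rewrite mulrN mulr_sumr; congr (- _); apply: eq_big => [j|j _]; last by rewrite mulrA.
  by rewrite !inE andbC.
rewrite opprK; set T := \sum_(i in J) _.
suff TN : T = - T by move/eqP: TN; rewrite -subr_eq0 opprK -mulr2n mulrn_eq0 => /eqP.
have FE i j : i \in J -> j \in J -> i != j -> F i j = - F j i.
  move=> iJ jJ ij; rewrite /F -mulNr -(eps_swap iJ jJ ij).
  apply: (congr1 (fun t => _ * t)); apply: eq_Int => x.
  rewrite (derive_commute _ _ _ spsi); apply: (congr1 (fun A => phi x A * _)).
  by apply/setP => a; rewrite !inE andbCA.
rewrite [in RHS]/T (exchange_big_dep (mem J))/=; last by move=> i j _ /andP[].
rewrite -sumrN /T; apply: eq_bigr => j jJ; rewrite -sumrN; apply: eq_big => [i|i /andP[iJ ij]].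
  by rewrite jJ andTb; congr (_ && _); rewrite eq_sym.
by apply: FE => //; rewrite eq_sym.
Qed.

End weak_d_coefficients.

(** * The weak chain rule *)

Section chain_rule.
Context {R : realType} {n m : nat}.
Local Notation e_ := (@basis_vec R n).

Lemma row_cvg (b : 'rV[R]_m -> R) (y : nat -> 'rV[R]_m) (z : 'rV[R]_m) :
  {for z, continuous b} -> (forall j, y l ord0 j @[l --> \oo] --> z ord0 j) ->
  b (y l) @[l --> \oo] --> b z.
Proof.
move=> bz yz; have yc : y l @[l --> \oo] --> z.
  apply/(@cvgrPdist_le _ _ _ \oo) => e e0.
  have : \forall l \near \oo, forall j, `|z ord0 j - y l ord0 j| <= e.
    by apply: filter_forall => j; move/(@cvgrPdist_le _ _ _ \oo): (yz j); exact.
  move=> Hl; apply: (filterS _ Hl) => l H; apply: norm_le_coord; first exact: ltW.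
  by move=> j; rewrite !mxE.
exact: (continuous_cvg _ bz yc).
Qed.

Variables (U : set 'rV[R]_n) (G : 'rV[R]_n -> R) (p : nat).
Hypotheses (oU : open U) (bU : bounded_set U).
Hypotheses (G1 : forall x, 1 <= G x).
Hypothesis iG : L1 (fun x => \1_U x * G x ^+ p.+1).

(** For smooth f this is the chain rule, integrated by parts. The functions f j are
mollified along a common sequence, and both sides pass to the limit by dominated
convergence. *)
Lemma weak_partial_comp (f : 'I_m -> 'rV[R]_n -> R) (v : 'I_m -> 'I_n -> 'rV[R]_n -> R)
    (b : 'rV[R]_m -> R) i :
  (forall j, growth U G 0 (f j)) -> (forall j i, growth U G 1 (v j i)) ->
  (forall j i, weak_partial U i (f j) (v j i)) -> test_function setT b ->
  weak_partial U i (fun x => \1_U x * b (\row_j f j x))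
    (fun x => \sum_(j < m) 'D_(@basis_vec R m j) b (\row_j' f j' x) * v j i x).
Proof.
move=> bf bv wp tb psi tpsi.
have [spsi [K [cK KU psiK]]] := tpsi.
have [M psiM] := test_bounded tpsi.
have M0 : 0 <= M by exact: le_trans (normr_ge0 _) (psiM 0).
have tdpsi := test_derive i tpsi; have [M' dpsiM] := test_bounded tdpsi.
have [B bB] := test_bounded tb.
pose db j := 'D_(@basis_vec R m j) b.
have tdb j : test_function setT (db j) by exact: test_derive.
have cb : continuous b by apply: smooth_continuous; case: tb.
have cdb j : continuous (db j) by apply: smooth_continuous; case: (tdb j).
have ex_dbB : forall j, exists B', forall y, `|db j y| <= B'.
  by move=> j; exact: test_bounded (tdb j).
have [B' dbB] := choice ex_dbB.
have iv j i' : L1 (v j i') by exact: (growth_L1 G1 iG (k := 1)).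
have if_ j : L1 (f j) by exact: (growth_L1 G1 iG (k := 0)).
have [w [S [sw iS wcvg wdom _]]] := @mollification_sequence R n 'I_m U K p
  f v oU bU cK KU if_ (fun j x => growth_off (bf j))
  iv (fun j i' x => growth_off (bv j i')) (fun j i' => growth_expr_L1 G1 iG (bv j i')) wp.
pose W l x : 'rV[R]_m := \row_j w j l x.
pose F x : 'rV[R]_m := \row_j f j x.
have Wd l i' x : is_derive x (e_ i') (fun y => b (W l y)) (\sum_(j < m) db j (W l x) * 'D_(e_ i') (w j l) x).
  apply: is_derive_comp_rV => //.
    by move=> j y; apply: smooth_is_derive; case: tb.
  move=> j; have -> : (fun y => W l y ord0 j) = w j l by apply/funext => y; rewrite mxE.
  exact: smooth_is_derive.
have Wc l : continuous (W l).
  move=> x; apply/(@cvgrPdist_le _ _ _ (nbhs x)) => e e0.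
  have Hj j : \forall y \near x, `|w j l x - w j l y| <= e.
    by move/(@cvgrPdist_le _ _ _ (nbhs x)): (smooth_continuous (sw j l) (x := x)); exact.
  have := @filter_forall _ _ (fun j y => is_true (`|w j l x - w j l y| <= e)) (nbhs x) (nbhs_filter x) Hj.
  move=> Hy; have {}Hy : nbhs x (fun y => forall j, is_true (`|w j l x - w j l y| <= e)) := Hy.
  change (nbhs x (fun y => is_true (`|W l x - W l y| <= e))).
  apply: filterS Hy => y H; apply: norm_le_coord; first exact: ltW.
  by move=> j; rewrite !mxE.
have bWc l : continuous (fun x => b (W l x)).
  by move=> x; apply: continuous_comp; [exact: Wc|exact: cb].
have dbWc l j : continuous (fun x => db j (W l x)).
  by move=> x; apply: continuous_comp; [exact: Wc|exact: cdb].
have cpsi : continuous psi by exact: smooth_continuous.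
have cdpsi : continuous ('D_(e_ i) psi) by apply: smooth_continuous; case: tdpsi.
have dpsiK x : ~ K x -> 'D_(e_ i) psi x = 0 by exact: derive_off_support.
pose a1 l x := b (W l x) * 'D_(e_ i) psi x.
pose a2 l x := (\sum_(j < m) db j (W l x) * 'D_(e_ i) (w j l) x) * psi x.
have ca1 l : continuous (a1 l) by move=> x; exact: (cvgM (bWc l x) (cdpsi x)).
have ca2 l : continuous (a2 l).
  move=> x; apply: (cvgM _ (cpsi x)).
  apply: (@cvg_sumr _ _ _ (nbhs x)) => j; apply: (cvgM (dbWc l j x)).
  exact: (smooth_continuous (smooth_derive i (sw j l)) (x := x)).
have a1K l x : ~ K x -> a1 l x = 0 by move=> Kx; rewrite /a1 dpsiK// mulr0.
have a2K l x : ~ K x -> a2 l x = 0 by move=> Kx; rewrite /a2 psiK// mulr0.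
(* the partial derivative of the test function (b o W l) psi has integral 0 *)
have parts l : Int (a2 l) = - Int (a1 l).
  have : Int (fun x => a1 l x + a2 l x) = 0.
    apply: (@Int_partial0 R n (fun x => b (W l x) * psi x) _ i K) => //.
    - by move=> x Kx; rewrite psiK// mulr0.
    - by move=> x; exact: (cvgM (bWc l x) (cpsi x)).
    - by move=> x; exact: (is_deriveM_rV (Wd l i x) (smooth_is_derive i x spsi)).
    - by move=> x; exact: (cvgD (ca1 l x) (ca2 l x)).
  rewrite IntD; [|exact: continuous_L1 (ca1 l) cK (a1K l)|exact: continuous_L1 (ca2 l) cK (a2K l)].
  by move/eqP; rewrite addrC addr_eq0 => /eqP.
have mF : measurable_fun setT (F : 'rV[R]_n -> 'rV[R]_m).
  apply/measurable_fun_rVP => j; under eq_fun do rewrite mxE.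
  by apply: L1_measurable.
have mcomp (h : 'rV[R]_m -> R) : continuous h -> measurable_fun setT (fun x => h (F x)).
  by move=> ch; exact: (measurableT_comp (measurable_continuous_rV ch) mF).
have WF x (h : 'rV[R]_m -> R) : continuous h ->
    (forall j, w j l x @[l --> \oo] --> f j x) -> h (W l x) @[l --> \oo] --> h (F x).
  move=> ch wf; apply: row_cvg; first exact: ch.
  move=> j; have -> : F x ord0 j = f j x by rewrite mxE.
  have -> : (fun l => W l x ord0 j) = (fun l => w j l x) by apply/funext => l; rewrite mxE.
  exact: wf.
have iK : L1 (\1_K : 'rV[R]_n -> R).
  by apply: indic_L1; [exact: compact_bounded|exact: measurable_compact_rV].
have lim1 : Int (a1 l) @[l --> \oo] --> Int (fun x => b (F x) * 'D_(e_ i) psi x).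
  have [_ _] : [/\ L1 (fun x => b (F x) * 'D_(e_ i) psi x),
      Int (fun x => `|a1 k x - b (F x) * 'D_(e_ i) psi x|) @[k --> \oo] --> (0 : R) &
      Int (a1 l) @[l --> \oo] --> Int (fun x => b (F x) * 'D_(e_ i) psi x)].
    apply: (@dominated_Int R n _ _ (fun x => B * `|'D_(e_ i) psi x|)).
    - by move=> l; apply: measurable_continuous_rV; exact: ca1.
    - by apply: measurable_funM; [exact: mcomp|exact: measurable_continuous_rV].
    - by apply: filterS wcvg => x [cx _]; apply: cvgM; [exact: WF|exact: cvg_cst].
    - by apply: L1Z; apply: L1_abs; exact: test_L1 tdpsi.
    - by apply: aeW => x l; rewrite normrM ler_wpM2r.
  by [].
have lim2 : Int (a2 l) @[l --> \oo] --> Int (fun x => (\sum_(j < m) db j (F x) * v j i x) * psi x).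
  have [_ _] : [/\ L1 (fun x => (\sum_(j < m) db j (F x) * v j i x) * psi x),
      Int (fun x => `|a2 k x - (\sum_(j < m) db j (F x) * v j i x) * psi x|) @[k --> \oo] --> (0 : R) &
      Int (a2 l) @[l --> \oo] --> Int (fun x => (\sum_(j < m) db j (F x) * v j i x) * psi x)].
    apply: (@dominated_Int R n _ _ (fun x => (\sum_(j < m) B' j) * M * (\1_K x + `|S x|))).
    - by move=> l; apply: measurable_continuous_rV; exact: ca2.
    - apply: measurable_funM; last exact: measurable_continuous_rV.
      apply: measurable_sum => j; apply: measurable_funM; first exact: mcomp.
      exact: L1_measurable.
    - apply: filterS wcvg => x [cx dx].
      have [Kx|Kx] := pselect (K x); last first.
        by rewrite /a2 psiK// mulr0; under eq_fun do rewrite mulr0; exact: cvg_cst.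
      apply: cvgM; last exact: cvg_cst.
      by apply: cvg_sumr => j; apply: cvgM; [exact: WF|exact: dx].
    - by apply: L1Z; apply: L1D => //; exact: L1_abs.
    - apply: filterS wdom => x dx l.
      have B'0 j : 0 <= B' j by exact: le_trans (normr_ge0 _) (dbB j 0).
      have [Kx|Kx] := pselect (K x); last first.
        by rewrite a2K// normr0 !mulr_ge0 ?addr_ge0 ?sumr_ge0// indicE ler0n.
      rewrite /a2 normrM mulrAC ler_pM// mulr_suml.
      apply: le_trans (ler_norm_sum _ _ _) _; apply: ler_sum => j _.
      rewrite normrM ler_pM// indicE mem_set//.
      set t := `|'D_(e_ i) (w j l) x|.
      have tS : t ^+ p.+1 <= `|S x| by rewrite (le_trans (dx Kx j i l))// ler_norm.
      have := @expr_mul_le R p 0 1 t (leq0n p) (lexx 1) (normr_ge0 _).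
      rewrite expr0 mul1r expr1n => /le_trans; apply.
      by rewrite lerD2l.
  by [].
have limN : Int (a2 l) @[l --> \oo] --> - Int (fun x => b (F x) * 'D_(e_ i) psi x).
  have -> : (fun l => Int (a2 l)) = _ := funext parts.
  exact: cvgN.
have E := cvg_unique (@norm_hausdorff _ _) lim2 limN.
rewrite [LHS]E; congr (- _); apply: eq_Int => x.
rewrite indicE; have [xU|/negP xU] := boolP (x \in U); first by rewrite mul1r.
by rewrite dpsiK ?mulr0// => /KU Ux; apply: xU; rewrite inE.
Qed.

End chain_rule.

(** * Wedge products of one-forms *)

Section wedge_algebra.
Local Close Scope classical_set_scope.
Context {R : realType} {n : nat}.
Implicit Types (a b c : ext R n) (I J K : {set 'I_n}) (i j : 'I_n).

Lemma sum_homog1 K (F : {set 'I_n} -> R) : (forall I, #|I| != 1%N -> F I = 0) ->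
  \sum_(I : {set 'I_n} | I \subset K) F I = \sum_(i in K) F [set i]%SET.
Proof.
move=> F1; pose S := [set [set i]%SET | i in K]%SET.
have -> : \sum_(i in K) F [set i]%SET = \sum_(I in S) F I.
  by rewrite big_imset//= => i j _ _; exact: set1_inj.
rewrite big_mkcond [RHS]big_mkcond; apply: eq_bigr => I _.
have [/cards1P[i ->]|cI] := boolP (#|I| == 1%N).
  by rewrite finset.sub1set (mem_imset _ _ set1_inj).
by rewrite F1// !if_same.
Qed.

Lemma wedge1E a b K : ext_homog 1 a ->
  wedge a b K = \sum_(i in K) eps i K * a [set i]%SET * b (K :\ i).
Proof.
move=> ha; rewrite ffunE sum_homog1//.
by move=> I /ha ->; rewrite mulr0 mul0r.
Qed.

Lemma dcoord_homog i : ext_homog 1 (dcoord i : ext R n).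
Proof.
by move=> I cI; rewrite ffunE; case: (I =P _) => // Ii; rewrite Ii cards1 in cI.
Qed.

Lemma wedge_homog1 k a b : ext_homog 1 a -> ext_homog k b -> ext_homog k.+1 (wedge a b).
Proof.
move=> ha hb K cK; rewrite wedge1E// big1// => i iK.
rewrite hb ?mulr0//; apply: contraNneq cK => <-.
by rewrite (cardsD1 i K) iK.
Qed.

Lemma wedgeZr a b (t : R) : wedge a [ffun I => t * b I] = [ffun I => t * wedge a b I].
Proof.
by apply/ffunP => K; rewrite !ffunE mulr_sumr; apply: eq_bigr => I _; rewrite ffunE mulrCA.
Qed.

Lemma wedge11E a b c K : ext_homog 1 a -> ext_homog 1 b ->
  wedge a (wedge b c) K = \sum_(i in K) \sum_(j in K | j != i)
    eps i K * eps j (K :\ i) * (a [set i]%SET * b [set j]%SET * c ((K :\ i) :\ j)).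
Proof.
move=> ha hb; rewrite wedge1E//; apply: eq_bigr => i iK.
rewrite wedge1E// mulr_sumr; apply: eq_big => [j|j _]; first by rewrite !inE andbC.
by ring.
Qed.

(** One-forms anticommute. A third factor c makes the rule applicable inside products
that are nested to the right, without using associativity. *)
Lemma wedge_swap a b c : ext_homog 1 a -> ext_homog 1 b ->
  wedge a (wedge b c) = - wedge b (wedge a c).
Proof.
move=> ha hb; apply/ffunP => K; rewrite wedge11E// [in RHS]ffunE wedge11E//.
rewrite [in RHS](exchange_big_dep (mem K))/=; last by move=> i j _ /andP[].
rewrite -sumrN; apply: eq_bigr => i iK; rewrite -sumrN.
apply: eq_big => [j|j /andP[jK ji]]; first by rewrite iK andTb eq_sym.
rewrite (eps_swap jK iK ji) mulNr opprK; congr (_ * _).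
have -> : (K :\ j) :\ i = (K :\ i) :\ j by apply/setP => x; rewrite !inE andbCA.
by rewrite [b _ * _]mulrC.
Qed.

Lemma wedge_self a c : ext_homog 1 a -> wedge a (wedge a c) = 0.
Proof.
move=> ha; apply/ffunP => K; rewrite [RHS]ffunE.
have /ffunP/(_ K) := wedge_swap c ha ha; rewrite [in RHS]ffunE => /eqP.
by rewrite -subr_eq0 opprK -mulr2n mulrn_eq0 => /eqP.
Qed.

End wedge_algebra.

Section wedge_products.
Local Close Scope classical_set_scope.
Context {R : realType} {n m : nat}.
Variable alpha : 'I_m -> ext R n.
Hypothesis alpha1 : forall j, ext_homog 1 (alpha j).
Implicit Types (I : {set 'I_m}) (i j : 'I_m) (s t : seq 'I_m).

Definition wprod s : ext R n := foldr wedge ext_one [seq alpha j | j <- s].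

Lemma wprod_cons j s : wprod (j :: s) = wedge (alpha j) (wprod s).
Proof. by []. Qed.

Lemma ext_one_homog : ext_homog 0 (ext_one : ext R n).
Proof. by move=> I cI; rewrite ffunE; case: (I =P _) => // Ii; rewrite Ii cards0 in cI. Qed.

Lemma wprod_homog s : ext_homog (size s) (wprod s).
Proof.
elim: s => [|j s IH]; first exact: ext_one_homog.
exact: wedge_homog1.
Qed.

Lemma wedge_wprod_mem i I t : i \in I -> i \in t ->
  wedge (alpha i) (wprod [seq j <- t | j \in I]) = 0.
Proof.
move=> iI; elim: t => [//|x t IH]; rewrite inE => /orP[/eqP <-|it] /=.
  by rewrite iI; exact: wedge_self.
case: ifP => _; last exact: IH.
rewrite wprod_cons wedge_swap// IH//.
by apply/ffunP => K; rewrite !ffunE big1 ?oppr0// => J _; rewrite ffunE mulr0.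
Qed.

(** The form [alpha i] moves to the right past the factors of index smaller than i,
each of which changes the sign. *)
Lemma wedge_wprod_insert i I t : i \notin I -> i \in t -> sorted ltn (map val t) ->
  wedge (alpha i) (wprod [seq j <- t | j \in I]) =
  [ffun K => (-1) ^+ count (fun b : 'I_m => (b < i)%N && (b \in I)) t *
     wprod [seq j <- t | j \in i |: I] K].
Proof.
move=> iI; elim: t => [//|x t IH]; rewrite inE.
rewrite [sorted _ _]/= (path_sortedE ltn_trans) => it /andP[/allP xt st].
have xt' y : y \in t -> (x < y)%N by move=> yt; apply: xt; exact: map_f.
have [xi|xi] := eqVneq i x.
  rewrite -xi in xt' * => {it}.
  have int : i \notin t by apply/negP => /xt'; rewrite ltnn.
  have -> : [seq j <- i :: t | j \in I] = [seq j <- t | j \in I] by rewrite /= (negPf iI).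
  have -> : count (fun b : 'I_m => (b < i)%N && (b \in I)) (i :: t) = 0%N.
    apply/eqP; rewrite /= ltnn/= add0n -leqn0 leqNgt -has_count.
    apply/negP => /hasP[b bt /andP[bi _]].
    by have := ltn_trans bi (xt' b bt); rewrite ltnn.
  have -> : [seq j <- i :: t | j \in i |: I] = i :: [seq j <- t | j \in I].
    rewrite /= !inE eqxx/=; congr (_ :: _); apply: eq_in_filter => b bt; rewrite !inE.
    by case: eqVneq => // E; rewrite E in bt; rewrite bt in int.
  by apply/ffunP => K; rewrite [in RHS]ffunE expr0 mul1r wprod_cons.
have {it}it : i \in t by move: it; rewrite (negPf xi).
have xi' : (x < i)%N by exact: xt'.
have -> : count (fun b : 'I_m => (b < i)%N && (b \in I)) (x :: t) =
    ((x \in I) + count (fun b : 'I_m => (b < i)%N && (b \in I)) t)%N by rewrite /= xi'.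
have -> : [seq j <- x :: t | j \in i |: I] =
    if x \in I then x :: [seq j <- t | j \in i |: I] else [seq j <- t | j \in i |: I].
  by rewrite /= !inE eq_sym (negPf xi).
have -> : [seq j <- x :: t | j \in I] =
    if x \in I then x :: [seq j <- t | j \in I] else [seq j <- t | j \in I] by [].
case xI: (x \in I); last by rewrite add0n IH.
rewrite !wprod_cons wedge_swap// IH// wedgeZr.
by apply/ffunP => K; rewrite !ffunE exprS mulN1r mulNr.
Qed.

Lemma enum_filter I : enum I = [seq j <- enum 'I_m | j \in I].
Proof. by rewrite {1}/enum_mem -enumT. Qed.

Lemma sorted_enum_ord : sorted ltn (map val (enum 'I_m)).
Proof. by rewrite val_enum_ord iota_ltn_sorted. Qed.

(** The rule dy^i /\ dy^I = eps i (i |: I) dy^(i |: I), with the one-forms alpha in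
place of the coordinate forms: sorting a product of one-forms uses nothing but
anticommutation. *)
Lemma wedge_wprod_enum i I :
  wedge (alpha i) (wprod (enum I)) =
  if i \in I then 0 else [ffun K => @eps R m i (i |: I) * wprod (enum (i |: I)) K].
Proof.
rewrite !enum_filter; case: ifPn => iI; first exact: (wedge_wprod_mem iI (mem_enum _ _)).
rewrite (wedge_wprod_insert iI (mem_enum _ _) sorted_enum_ord).
apply/ffunP => K; rewrite !ffunE; congr (_ ^+ _ * _).
rewrite inversions1l -size_filter cardE enum_filter; congr size; apply: eq_filter => b.
rewrite !inE; have [->|bi] := eqVneq b i; first by rewrite ltnn.
by rewrite andbC.
Qed.

End wedge_products.

(** * Weak differentials and their coefficients *)

Section top_degree.
Local Close Scope classical_set_scope.
Context {R : realType} {n : nat}.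
Implicit Types (a b : ext R n) (I J K : {set 'I_n}) (i j : 'I_n).

(** The sign in dx^J /\ dx^(~: J) = top_sign J dx^1 /\ ... /\ dx^n. *)
Definition top_sign J : R := (-1) ^+ inversions J (~: J).

Lemma wedge_top a b :
  wedge a b [set: 'I_n]%SET = \sum_(J : {set 'I_n}) top_sign J * a J * b (~: J).
Proof.
rewrite ffunE; apply: eq_big => [J|J _]; first by rewrite finset.subsetT.
by rewrite finset.setTD.
Qed.

Lemma extdE (w : 'rV[R]_n -> ext R n) x K :
  extd w x K = \sum_(i in K) eps i K * 'D_(basis_vec i) (fun y => w y (K :\ i)) x.
Proof.
rewrite /extd sum_ffunE [RHS]big_mkcond; apply: eq_bigr => i _.
rewrite wedge1E; last exact: dcoord_homog.
rewrite big_mkcond (bigD1 i)//= big1 ?addr0 => [|j ji]; last first.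
  by case: ifP => // _; rewrite ffunE (inj_eq set1_inj) (negPf ji) mulr0 mul0r.
by case: ifP => // _; rewrite !ffunE eqxx mulr1.
Qed.

(** Both sides compare dx^I /\ dx^i /\ dx^(rest) with the volume form. On the right,
dx^i has first been moved in front of dx^I, at the price of (-1)^#|I|. *)
Lemma top_sign_eps i I : i \notin I ->
  top_sign I * eps i (~: I) = (-1) ^+ #|I| * top_sign (i |: I) * eps i (i |: I).
Proof.
move=> iI; rewrite /top_sign /eps.
have E1 : ~: I = [set i] :|: ~: (i |: I).
  apply/setP => x; rewrite !inE; have [->|//] := eqVneq x i; by rewrite iI.
have E2 : (~: I) :\ i = ~: (i |: I).
  by apply/setP => x; rewrite !inE negb_or.
have E3 : (i |: I) :\ i = I.
  by apply/setP => x; rewrite !inE; have [->|//] := eqVneq x i; rewrite (negPf iI).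
rewrite E2 E3 {1}E1 inversionsUr; last by rewrite disjoints1 !inE eqxx.
rewrite inversionsUl; last by rewrite disjoints1.
rewrite -(inversions_flip iI) !exprD.
have := sqrr_sign R (inversions [set i] I); rewrite expr2.
move: ((-1) ^+ inversions [set i] I) ((-1) ^+ inversions I [set i]) => a b aa.
move: ((-1) ^+ inversions I (~: (i |: I))) ((-1) ^+ inversions [set i] (~: (i |: I))) => c d.
by transitivity ((a * a) * (b * c * d)); [rewrite aa mul1r|ring].
Qed.

(** Groups the terms by the coefficient of w that is differentiated. The factor
(-1)^k is the one that the definition of the weak differential compensates. *)
Lemma wedge_extd_top k a (w : 'rV[R]_n -> ext R n) x : ext_homog k a ->
  wedge a (extd w x) [set: 'I_n]%SET =
  (-1) ^+ k * \sum_(J : {set 'I_n}) top_sign J *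
    \sum_(i in J) eps i J * (a (J :\ i) * 'D_(basis_vec i) (fun y => w y (~: J)) x).
Proof.
move=> ha; rewrite wedge_top.
pose F i I := top_sign I * a I * (eps i (~: I) * 'D_(basis_vec i) (fun y => w y ((~: I) :\ i)) x).
transitivity (\sum_(i < n) \sum_(I : {set 'I_n} | i \notin I) F i I).
  rewrite (exchange_big_dep predT)//=; apply: eq_bigr => I _.
  rewrite extdE mulr_sumr; apply: eq_big => [i|i _]; first by rewrite inE.
  by rewrite /F.
rewrite mulr_sumr.
transitivity (\sum_(i < n) \sum_(J : {set 'I_n} | i \in J) (-1) ^+ k * (top_sign J *
    (eps i J * (a (J :\ i) * 'D_(basis_vec i) (fun y => w y (~: J)) x)))); last first.
  rewrite (exchange_big_dep predT)//=; apply: eq_bigr => J _.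
  by rewrite mulr_sumr mulr_sumr.
apply: eq_bigr => i _.
rewrite (reindex_onto (fun J => J :\ i) (fun I => i |: I)); last first.
  by move=> I iI; apply/setP => y; rewrite !inE; case: eqVneq => // ->; rewrite (negPf iI).
apply: eq_big => [J|J /andP[iJ' /eqP iJ]].
  rewrite !inE eqxx/=; apply/eqP/idP => [<-|iJ]; first by rewrite setU11.
  exact: finset.setD1K.
have iJJ : i \in J by rewrite -iJ setU11.
rewrite /F; have [ck|ck] := eqVneq #|J :\ i| k; last first.
  by rewrite (ha _ ck) !(mulr0, mul0r).
have -> : (~: (J :\ i)) :\ i = ~: J.
  apply/setP => y; rewrite !inE negb_and negbK; case: eqVneq => //= ->.
  by rewrite iJJ.
have := top_sign_eps iJ'; rewrite iJ ck => E.
move: ('D_(basis_vec i) _ x) => dw.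
transitivity ((top_sign (J :\ i) * eps i (~: (J :\ i))) * (a (J :\ i) * dw)); first by ring.
by rewrite E; ring.
Qed.

Lemma top_sign_sqr J : top_sign J * top_sign J = 1.
Proof. by rewrite /top_sign -expr2 sqrr_sign. Qed.

End top_degree.

Section weak_d_equivalence.
Context {R : realType} {n : nat}.
Local Notation e_ := (@basis_vec R n).
Implicit Types (U W : set 'rV[R]_n) (w phi theta : 'rV[R]_n -> ext R n).

(** Extension by 0 makes all integrals integrals over the whole space. *)
Definition restr U phi (x : 'rV[R]_n) : ext R n := [ffun I => \1_U x * phi x I].

Lemma restr_in U phi x I : U x -> restr U phi x I = phi x I.
Proof. by move=> Ux; rewrite ffunE indicE mem_set// mul1r. Qed.

Lemma restr_out U phi x I : ~ U x -> restr U phi x I = 0.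
Proof. by move=> Ux; rewrite ffunE indicE memNset// mul0r. Qed.

Lemma form_integral_Int W (o : 'rV[R]_n -> R) w (h : 'rV[R]_n -> R) : L1 h ->
  (forall x, W x -> o x * w x [set: 'I_n]%SET = h x) -> (forall x, ~ W x -> h x = 0) ->
  form_integral W o w = (Int h)%:E.
Proof.
move=> ih wh h0; rewrite EFin_Int// /form_integral integral_mkcond.
apply: eq_integral => x _; rewrite patchE; case: ifPn => xW.
  by rewrite wh//; rewrite inE in xW.
by rewrite h0// => /mem_set; apply/negP.
Qed.

Lemma L1_mul_test U g psi : L1 g -> test_function U psi -> L1 (fun x => g x * psi x).
Proof.
move=> ig tpsi; have [M psiM] := test_bounded tpsi.
have -> : (fun x => g x * psi x) = (fun x => psi x * g x) by apply/funext => x; rewrite mulrC.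
by apply: (L1_bounded_mul _ psiM ig); apply: smooth_measurable; case: tpsi.
Qed.

(** Tests against the forms psi dx^(~: J) on W = U with the standard orientation. *)
Lemma weak_d_coef U k phi theta : open U -> (k < n)%N ->
  (forall x, U x -> ext_homog k (phi x)) ->
  (forall I, L1 (fun x => restr U phi x I)) -> (forall J, L1 (fun x => restr U theta x J)) ->
  weak_d U k phi theta -> coef_weak_d U k (restr U phi) (restr U theta).
Proof.
move=> oU kn hphi iphi itheta [_ _ H] J psi cJ tpsi.
have [spsi [K [cK KU psiK]]] := tpsi.
pose w x : ext R n := [ffun I : {set 'I_n} => if I == (~: J)%SET then psi x else 0].
pose l := (n - k.+1)%N.
have kl : (k + l.+1)%N = n by rewrite addnS -addSn subnKC.
have cJc : #|(~: J)%SET| = l.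
  by have := cardsC J; rewrite cJ card_ord => E; rewrite /l -[X in (X - _)%N]E addKn.
have w0 x I : I != (~: J)%SET -> w x I = 0 by move=> IJ; rewrite ffunE (negPf IJ).
have sw : smooth_form_on setT l w.
  split=> [x _ I cI|I].
    by apply: w0; apply: contraNneq cI => ->; rewrite cJc.
  have [->|IJ] := eqVneq I (~: J)%SET.
    by have -> : (fun x => w x (~: J)%SET) = psi by apply/funext => x; rewrite ffunE eqxx.
  have -> : (fun x => w x I) = (fun=> 0) by apply/funext => x; exact: w0.
  by move=> r; exact (Cr_cst _ _ openT).
have csw : compact_support_in U w.
  exists K; split=> // x Kx; apply/ffunP => I; rewrite !ffunE; case: ifP => // _.
  exact: psiK.
have o1 : orientation U (fun=> 1 : R).
  by split=> [x _|x _]; [exact: cst_continuous|left].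
have := H U (fun=> 1) l w oU (@subset_refl _ U) o1 kl sw csw.
have ith : L1 (fun x => top_sign J * (restr U theta x J * psi x)).
  by apply: L1Z; exact: L1_mul_test tpsi.
have iph i : L1 (fun x => restr U phi x (J :\ i)%SET * 'D_(e_ i) psi x).
  by apply: L1_mul_test (test_derive i tpsi).
rewrite (form_integral_Int ith); last 2 first.
- move=> x Ux; rewrite mul1r wedge_top (bigD1 J)//= big1 ?addr0 => [|I IJ].
    by rewrite restr_in// ffunE eqxx mulrA.
  by rewrite w0 ?mulr0//; apply: contraNneq IJ => /finset.setC_inj ->.
- by move=> x Ux; rewrite restr_out// mul0r mulr0.
have ir : L1 (fun x => (-1) ^+ k * (top_sign J *
    \sum_(i in J) eps i J * (restr U phi x (J :\ i)%SET * 'D_(e_ i) psi x))).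
  by do 2 apply: L1Z; apply: L1_sum => i _; exact: L1Z.
rewrite (form_integral_Int ir); last 2 first.
- move=> x Ux; rewrite mul1r (wedge_extd_top _ _ (hphi x Ux)); congr (_ * _).
  rewrite (bigD1 J)//= [X in _ + X]big1 ?addr0 => [|I IJ].
    congr (_ * _); apply: eq_bigr => i _; rewrite restr_in//.
    by have -> : (fun y => w y (~: J)%SET) = psi by apply/funext => y; rewrite ffunE eqxx.
  rewrite big1 ?mulr0// => i _.
  have -> : (fun y => w y (~: I)%SET) = cst 0; last by rewrite derive_cst !mulr0.
  by apply/funext => y; rewrite w0//; apply: contraNneq IJ => /finset.setC_inj ->.
- move=> x Ux; rewrite big1 ?mulr0// => i _; by rewrite restr_out// mul0r mulr0.
rewrite -EFinM => /(congr1 fine)/=.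
rewrite IntZ; last by exact: L1_mul_test tpsi.
rewrite IntZ; last by apply: L1Z; apply: L1_sum => i _; exact: L1Z.
rewrite IntZ; last by apply: L1_sum => i _; exact: L1Z.
rewrite Int_sum; last by move=> i _; exact: L1Z.
have -> : \sum_(i in J) Int (fun x => eps i J * (restr U phi x (J :\ i)%SET * 'D_(e_ i) psi x))
   = \sum_(i in J) eps i J * Int (fun x => restr U phi x (J :\ i)%SET * 'D_(e_ i) psi x).
  by apply: eq_bigr => i _; rewrite IntZ.
have sgn : (-1) ^+ k.+1 * (-1) ^+ k = -1 :> R by rewrite exprS -mulrA -expr2 sqrr_sign mulr1.
rewrite [X in _ = X]mulrA sgn mulN1r => E.
by rewrite -[LHS]mul1r -(top_sign_sqr J) -mulrA E mulrN mulrA top_sign_sqr mul1r.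
Qed.

(** A test form w on W is the sum of its terms w_(~: J) dx^(~: J). An orientation o of W
is locally constant, so that o w_(~: J), extended by 0 off W, is a test function. *)
Lemma coef_weak_d_weak_d U k phi theta : open U ->
  L1loc_form U k phi -> L1loc_form U k.+1 theta ->
  (forall I, L1 (fun x => restr U phi x I)) -> (forall J, L1 (fun x => restr U theta x J)) ->
  coef_weak_d U k (restr U phi) (restr U theta) -> weak_d U k phi theta.
Proof.
move=> oU lphi ltheta iphi itheta H; split=> // W o l w oW WU [co o1] kl [hw sw] [K [cK KW wK]].
have hphi x : U x -> ext_homog k (phi x) by case: lphi => -[h _] _; exact: h.
have htheta x : U x -> ext_homog k.+1 (theta x) by case: ltheta => -[h _] _; exact: h.
(* the coefficient of dx^(~: J) in o w, extended by 0 off W *)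
pose psi J (x : 'rV[R]_n) : R := \1_W x * (o x * w x (~: J)%SET).
have psi_off J x : ~ K x -> psi J x = 0.
  by move=> Kx; rewrite /psi wK// ffunE !mulr0.
have near_o x : W x -> exists2 A : set 'rV[R]_n, open A /\ A x &
    forall y, A y -> W y /\ o y = o x.
  move=> Wx; have cox : o y @[y --> x] --> o x by apply: co; exact: mem_set.
  have /(@cvgrPdist_lt _ _ _ (nbhs x)) /(_ _ ltr01) := cox.
  rewrite nbhsE => -[A [oA Ax] AH]; exists (W `&` A); first by split; [exact: openI|].
  move=> y [Wy /AH oxy]; split=> //.
  by move: oxy; case: (o1 x Wx) => ->; case: (o1 y Wy) => -> //=; rewrite ltr_norml; lra.
have locA J x : W x -> exists2 A : set 'rV[R]_n, open A /\ A x &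
    forall y, A y -> psi J y = o x * w y (~: J)%SET.
  move=> /near_o[A Ax AH]; exists A => // y /AH[Wy oy].
  by rewrite /psi indicE mem_set// mul1r oy.
have local J x : W x -> \forall y \near x, psi J y = o x * w y (~: J)%SET.
  by move=> /(locA J)[A Ax AH]; apply: filterS (open_nbhs_nbhs Ax) => y /AH.
have oK : open (~` K) by apply: closed_openC; exact: compact_closed_rV.
have tpsi J : test_function U (psi J).
  split; last by exists K; split=> //; [exact: subset_trans WU|exact: psi_off].
  move=> r; apply: Cr_local => x _; have [Wx|Wx] := pselect (W x).
    have [A [oA Ax] Ah] := locA J x Wx.
    exists A, (fun y => o x * w y (~: J)%SET); split=> //.
      apply: CrM => //; first exact (Cr_cst _ _ oA).
      apply: Cr_local => y Ay; exists setT, (fun y => w y (~: J)%SET).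
      by split=> //; [exact: openT|exact: sw].
    by move=> y /set_mem Ay; exact: Ah.
  exists (~` K), (fun=> 0); split=> //.
  - by move=> /KW.
  - exact (Cr_cst _ _ oK).
  - by move=> y /set_mem; exact: psi_off.
have dpsi J i x : W x -> 'D_(e_ i) (psi J) x = o x * 'D_(e_ i) (fun y => w y (~: J)%SET) x.
  move=> Wx; rewrite (near_eq_derive _ (local J x Wx)).
  have [_ ->] : is_derive x (e_ i) (fun y => o x * w y (~: J)%SET)
     (o x * 'D_(e_ i) (fun y => w y (~: J)%SET) x).
    exact: (is_deriveZ (o x) (smooth_is_derive i x (sw _))).
  by [].
have dpsi0 J i x : ~ W x -> 'D_(e_ i) (psi J) x = 0.
  by move=> Wx; exact: (derive_off_support (e_ i) cK (fun y => @psi_off J y) (fun Kx => Wx (KW _ Kx))).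
have ith J : L1 (fun x => top_sign J * (restr U theta x J * psi J x)).
  by apply: L1Z; apply: L1_mul_test (tpsi J).
have iph J i : L1 (fun x => eps i J * (restr U phi x (J :\ i)%SET * 'D_(e_ i) (psi J) x)).
  by apply: L1Z; apply: L1_mul_test (test_derive i (tpsi J)).
have isum J : L1 (fun x => top_sign J *
    \sum_(i in J) eps i J * (restr U phi x (J :\ i)%SET * 'D_(e_ i) (psi J) x)).
  by apply: L1Z; apply: L1_sum => i _.
rewrite (@form_integral_Int W o _ (fun x => \sum_(J : {set 'I_n})
    top_sign J * (restr U theta x J * psi J x))); last 3 first.
- by apply: L1_sum.
- move=> x Wx; rewrite wedge_top mulr_sumr; apply: eq_bigr => J _.
  by rewrite restr_in; [rewrite /psi indicE mem_set// mul1r; ring|exact: WU].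
- by move=> x Wx; rewrite big1// => J _; rewrite /psi indicE memNset// mul0r !mulr0.
rewrite (@form_integral_Int W o _ (fun x => (-1) ^+ k * \sum_(J : {set 'I_n}) top_sign J *
    \sum_(i in J) eps i J * (restr U phi x (J :\ i)%SET * 'D_(e_ i) (psi J) x))); last 3 first.
- by apply: L1Z; apply: L1_sum.
- move=> x Wx; rewrite (wedge_extd_top _ _ (hphi x (WU _ Wx))) mulrCA; congr (_ * _).
  rewrite mulr_sumr; apply: eq_bigr => J _; rewrite mulrCA; congr (_ * _).
  rewrite mulr_sumr; apply: eq_bigr => i _; rewrite dpsi// restr_in; last exact: WU.
  by rewrite mulrCA; congr (_ * _); rewrite mulrCA.
- move=> x Wx; rewrite big1 ?mulr0// => J _; rewrite big1 ?mulr0// => i _.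
  by rewrite dpsi0// !mulr0.
rewrite -EFinM; congr EFin.
rewrite IntZ; last by apply: L1_sum.
have sgn : (-1) ^+ k.+1 * (-1) ^+ k = -1 :> R by rewrite exprS -mulrA -expr2 sqrr_sign mulr1.
rewrite mulrA sgn mulN1r !Int_sum// -sumrN; apply: eq_bigr => J _.
rewrite IntZ; last by apply: L1_mul_test (tpsi J).
rewrite IntZ; last by apply: L1_sum.
rewrite -mulrN; congr (_ * _).
rewrite Int_sum; last by move=> i _.
have -> : \sum_(i in J) Int (fun x => eps i J * (restr U phi x (J :\ i)%SET * 'D_(e_ i) (psi J) x))
   = \sum_(i in J) eps i J * Int (fun x => restr U phi x (J :\ i)%SET * 'D_(e_ i) (psi J) x).
  by apply: eq_bigr => i _; rewrite IntZ//; apply: L1_mul_test (test_derive i (tpsi J)).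
have [cJ|cJ] := eqVneq #|J| k.+1; first exact: H cJ (tpsi J).
have th0 x : restr U theta x J = 0.
  by have [Ux|Ux] := pselect (U x); [rewrite restr_in// htheta|rewrite restr_out].
have ph0 x i : i \in J -> restr U phi x (J :\ i)%SET = 0.
  move=> iJ; have [Ux|Ux] := pselect (U x); last by rewrite restr_out.
  rewrite restr_in// hphi//; apply: contraNneq cJ => ck.
  by rewrite (cardsD1 i J) iJ ck.
have -> : Int (fun x => restr U theta x J * psi J x) = 0.
  by rewrite -[RHS](@Int0 R n); apply: eq_Int => x; rewrite th0 mul0r.
rewrite big1 ?oppr0// => i iJ.
have -> : Int (fun x => restr U phi x (J :\ i)%SET * 'D_(e_ i) (psi J) x) = 0.
  by rewrite -[RHS](@Int0 R n); apply: eq_Int => x; rewrite ph0// mul0r.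
by rewrite mulr0.
Qed.

End weak_d_equivalence.

(** * Conformal integrability *)

Section ext_norms.
Context {R : realType} {n : nat}.
Implicit Types (a : ext R n) (U : set 'rV[R]_n) (w : 'rV[R]_n -> ext R n).

Lemma ext_norm_ge0 a : 0 <= ext_norm a. Proof. exact: sqrtr_ge0. Qed.

Lemma ext_norm0 : ext_norm (0 : ext R n) = 0.
Proof.
by rewrite /ext_norm big1 ?sqrtr0// => I _; rewrite ffunE expr0n.
Qed.

Lemma coef_le_ext_norm a I : `|a I| <= ext_norm a.
Proof.
rewrite -sqrtr_sqr ler_wsqrtr// (bigD1 I)//= lerDl.
by apply: sumr_ge0 => J _; exact: sqr_ge0.
Qed.

Lemma ext_norm_le_sum a : ext_norm a <= \sum_(I : {set 'I_n}) `|a I|.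
Proof.
have s0 : 0 <= \sum_(I : {set 'I_n}) `|a I| by exact: sumr_ge0.
rewrite -[leRHS]ger0_norm// -sqrtr_sqr ler_wsqrtr// expr2 mulr_suml.
apply: ler_sum => I _; rewrite -real_normK ?num_real// expr2 ler_wpM2l//.
by rewrite (bigD1 I)//= lerDl sumr_ge0.
Qed.

Lemma measurable_ext_norm w : (forall I, measurable_fun setT (fun x => w x I)) ->
  measurable_fun setT (fun x => ext_norm (w x)).
Proof.
move=> mw; apply: (measurableT_comp (continuous_measurable_fun (@sqrt_continuous R))).
by apply: measurable_sum => I; exact: measurable_funX.
Qed.

Lemma restr_off U w x : ~ U x -> restr U w x = 0.
Proof. by move=> Ux; apply/ffunP => I; rewrite restr_out// ffunE. Qed.

Lemma restr_on U w x : U x -> restr U w x = w x.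
Proof. by move=> Ux; apply/ffunP => I; rewrite restr_in. Qed.

Lemma restr_eq0 U w :
  (forall x, U x -> w x = 0) -> restr U w = fun=> [ffun=> 0].
Proof.
move=> w0; apply/funext => x; apply/ffunP => K; rewrite [RHS]ffunE.
have [Ux|Ux] := pselect (U x); first by rewrite restr_in// w0// ffunE.
by rewrite restr_out.
Qed.

Lemma patch_ext_norm U w :
  (fun x => (ext_norm (w x))%:E) \_ U = (fun x => (ext_norm (restr U w x))%:E).
Proof.
apply/funext => x; rewrite patchE; case: ifPn => xU.
  by rewrite restr_on//; rewrite inE in xU.
by rewrite notin_setE in xU; rewrite restr_off// ext_norm0.
Qed.

Lemma measurable_restr U w I : measurable U ->
  measurable_fun U (fun x => w x I) <-> measurable_fun setT (fun x => restr U w x I).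
Proof.
move=> mU.
have E : (fun x => restr U w x I) = ((fun x => w x I) \_ U).
  apply/funext => x; rewrite patchE; case: ifPn => xU.
    by rewrite restr_in//; rewrite inE in xU.
  by rewrite restr_out//; rewrite notin_setE in xU.
rewrite E; split=> [mw|mw].
  exact/(measurable_restrictT _ mU).
exact/(measurable_restrictT _ mU).
Qed.

End ext_norms.

Section integrability_classes.
Context {R : realType} {n : nat}.
Local Notation mu := (lebesgue_rV R n).
Variables (U : set 'rV[R]_n) (G : 'rV[R]_n -> R) (p : nat).
Hypotheses (np : n = p.+1) (oU : open U).
Hypothesis G1 : forall x, 1 <= G x.
Hypothesis iG : L1 (fun x => \1_U x * G x ^+ p.+1).
Implicit Types (w theta : 'rV[R]_n -> ext R n).

Definition growth_form k w := forall I, growth U G k (fun x => restr U w x I).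

Lemma growth_ext_norm k w : growth_form k w -> growth U G k (fun x => ext_norm (restr U w x)).
Proof.
move=> bw; have [_ [C C0 HC]] := @growth_sum R n U G k _ (index_enum _) predT _ (fun I _ => bw I).
have /choice[D HD] : forall I, exists D, 0 <= D /\ forall x, `|restr U w x I| <= D * (\1_U x * G x ^+ k).
  by move=> I; have [_ [D D0 HD]] := bw I; exists D.
split; first by apply: measurable_ext_norm => I; case: (bw I).
exists (\sum_I D I) => [|x]; first by apply: sumr_ge0 => I _; case: (HD I).
rewrite ger0_norm ?ext_norm_ge0// (le_trans (ext_norm_le_sum _))// mulr_suml.
by apply: ler_sum => I _; case: (HD I) => _; exact.
Qed.

Lemma growth_measurable_form k k' w : (forall x, U x -> ext_homog k (w x)) -> growth_form k' w ->
  measurable_form U k w.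
Proof.
move=> hw bw; split=> // I; apply/measurable_restr; last by case: (bw I).
exact: measurable_open_rV.
Qed.

Lemma growth_L1loc k k' w : (k' <= n)%N -> (forall x, U x -> ext_homog k (w x)) -> growth_form k' w ->
  L1loc_form U k w.
Proof.
move=> kn hw bw; split; first exact: growth_measurable_form bw.
move=> K cK KU; have bN := growth_ext_norm bw.
have iN : L1 (fun x => ext_norm (restr U w x)).
  by apply: (growth_L1 G1 iG _ bN); rewrite -np.
have mK := measurable_compact_rV cK.
have : (\int[mu]_x (ext_norm (restr U w x))%:E < +oo)%E.
  apply/L1_ge0P => //; first exact: L1_measurable.
  by move=> x; exact: ext_norm_ge0.
apply: le_lt_trans.
have -> : (\int[mu]_(x in K) (ext_norm (w x))%:E = \int[mu]_(x in K) (ext_norm (restr U w x))%:E)%E.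
  by apply: eq_integral => x /set_mem/KU Ux; rewrite restr_on.
apply: ge0_subset_integral => //.
  by apply/measurable_EFinP; exact: L1_measurable.
by move=> x _; rewrite lee_fin ext_norm_ge0.
Qed.

(** The n/k-th power of C G^k is a multiple of G^n. *)
Lemma growth_Lp k w : (k <= n)%N -> (forall x, U x -> ext_homog k (w x)) -> growth_form k w ->
  Lp_form U (conf_exponent (n := n) k : \bar R) k w.
Proof.
move=> kn hw bw; split; first exact: growth_measurable_form bw.
rewrite patch_ext_norm; have [mN [C C0 HC]] := growth_ext_norm bw.
rewrite /conf_exponent; case: eqVneq => [k0|k0].
  rewrite unlock; case: ifP => // mu0.
  apply: (@le_lt_trans _ _ C%:E); last exact: ltry.
  apply/ess_supP; apply: aeW => x /=; rewrite lee_fin.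
  apply: le_trans (HC x) _; rewrite k0 expr0 mulr1 -[leRHS]mulr1 ler_wpM2l//.
rewrite unlock; apply: poweR_lty.
have kR : 0 < k%:R :> R by rewrite ltr0n lt0n.
have nR : 0 < n%:R :> R by rewrite np ltr0n.
have q0 : n%:R / k%:R != 0 :> R by rewrite gt_eqF// divr_gt0.
have iB : L1 (fun x => C `^ (n%:R / k%:R) * (\1_U x * G x ^+ p.+1)) by exact: L1Z.
have G0 x : 0 <= G x by exact: le_trans ler01 (G1 x).
have bnonneg x : 0 <= C `^ (n%:R / k%:R) * (\1_U x * G x ^+ p.+1).
  by rewrite mulr_ge0 ?powR_ge0// mulr_ge0 ?exprn_ge0// indicE ler0n.
have : (\int[mu]_x (C `^ (n%:R / k%:R) * (\1_U x * G x ^+ p.+1))%:E < +oo)%E.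
  by apply/L1_ge0P => //; exact: L1_measurable.
apply: le_lt_trans; apply: ge0_le_integral => //.
- by move=> x _; exact: poweR_ge0.
- apply: (@measurableT_comp _ _ _ _ _ _ (fun t : \bar R => (t `^ (n%:R / k%:R))%E)).
    exact: measurable_poweR.
  by apply: measurableT_comp => //; exact/measurable_EFinP.
- by apply/measurable_EFinP; exact: L1_measurable.
move=> x _ /=; rewrite lee_fin.
apply: (@le_trans _ _ ((C * (\1_U x * G x ^+ k)) `^ (n%:R / k%:R))).
  apply: ge0_ler_powR; rewrite ?nnegrE ?divr_ge0 ?ler0n//.
  by rewrite mulr_ge0// mulr_ge0 ?exprn_ge0// indicE ler0n.
rewrite powRM//; last by rewrite mulr_ge0 ?exprn_ge0// indicE ler0n.
rewrite ler_wpM2l ?powR_ge0// indicE; case: (x \in U); last by rewrite !mul0r powR0.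
rewrite !mul1r -powR_mulrn// -powRrM mulrCA divff ?gt_eqF// mulr1.
by rewrite np powR_mulrn.
Qed.

Lemma Omega_conf_growth k w theta : (k <= n)%N ->
  (forall x, U x -> ext_homog k (w x)) -> growth_form k w ->
  (forall x, U x -> ext_homog k.+1 (theta x)) ->
  ((k < n)%N -> growth_form k.+1 theta /\ coef_weak_d U k (restr U w) (restr U theta)) ->
  Omega_conf U k w.
Proof.
move=> kn hw bw htheta H; split; first exact: growth_Lp.
move=> kn'; have [bt wt] := H kn'; exists theta; split; last exact: growth_Lp.
apply: coef_weak_d_weak_d => //.
- exact: growth_L1loc bw.
- exact: growth_L1loc bt.
- by move=> I; apply: (growth_L1 G1 iG _ (bw I)); rewrite -np.
- by move=> I; apply: (growth_L1 G1 iG _ (bt I)); rewrite -np.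
Qed.

End integrability_classes.

(** The pairs (i, J) with i in J correspond to the pairs (i, I) with i not in I, by
J = i |: I. *)
Lemma sum_setU1 {R : realType} {m : nat} (F : 'I_m -> {set 'I_m} -> R) :
  \sum_(J : {set 'I_m}) \sum_(i in J) F i J =
  \sum_(I : {set 'I_m}) \sum_(i | i \notin I) F i (i |: I)%SET.
Proof.
rewrite (exchange_big_dep predT)//= [RHS](exchange_big_dep predT)//=.
apply: eq_bigr => i _.
rewrite (reindex_onto (fun I => i |: I)%SET (fun J => J :\ i)%SET); last first.
  by move=> J iJ; exact: finset.setD1K.
apply: eq_bigl => I; rewrite setU11/=; apply/eqP/idP => [<-|iI].
  by rewrite !inE eqxx.
by rewrite setU1K.
Qed.

Section dominating_function.
Context {R : realType} {n : nat}.
Implicit Types (g h : 'rV[R]_n -> R).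

(** Indeed (g + h)^q is at most 2^q (g^q + h^q). *)
Lemma L1_exprD q g h : measurable_fun setT g -> measurable_fun setT h ->
  (forall x, 0 <= g x) -> (forall x, 0 <= h x) ->
  L1 (fun x => g x ^+ q.+1) -> L1 (fun x => h x ^+ q.+1) ->
  L1 (fun x => (g x + h x) ^+ q.+1).
Proof.
move=> mg mh g0 h0 ig ih.
apply: (L1_le (h := fun x => 2 ^+ q.+1 * (g x ^+ q.+1 + h x ^+ q.+1))).
- by apply: measurable_funX; exact: measurable_funD.
- move=> x; rewrite ger0_norm ?exprn_ge0 ?addr_ge0//.
  have gq : 0 <= g x ^+ q.+1 by rewrite exprn_ge0.
  have hq : 0 <= h x ^+ q.+1 by rewrite exprn_ge0.
  have [gh|/ltW hg] := leP (g x) (h x).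
    apply: (@le_trans _ _ ((2 * h x) ^+ q.+1)).
      by rewrite lerXn2r ?nnegrE ?addr_ge0 ?mulr_ge0// mulr_natl mulr2n lerD2r.
    by rewrite exprMn ler_wpM2l ?exprn_ge0// lerDr.
  apply: (@le_trans _ _ ((2 * g x) ^+ q.+1)).
    by rewrite lerXn2r ?nnegrE ?addr_ge0 ?mulr_ge0// mulr_natl mulr2n lerD2l.
  by rewrite exprMn ler_wpM2l ?exprn_ge0// lerDl.
- by apply: L1Z; exact: L1D.
Qed.

Lemma L1_expr_sum q (I : Type) (s : seq I) (g : I -> 'rV[R]_n -> R) :
  (forall i, measurable_fun setT (g i)) -> (forall i x, 0 <= g i x) ->
  (forall i, L1 (fun x => g i x ^+ q.+1)) ->
  L1 (fun x => (\sum_(i <- s) g i x) ^+ q.+1).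
Proof.
move=> mg g0 ig; elim: s => [|i s IH].
  under eq_fun do rewrite big_nil expr0n; exact: L10.
under eq_fun do rewrite big_cons.
apply: L1_exprD => //; first exact: measurable_sum.
by move=> x; exact: sumr_ge0.
Qed.

Lemma Lp_form_L1 (U : set 'rV[R]_n) k p (w : 'rV[R]_n -> ext R n) :
  n = p.+1 -> measurable U -> Lp_form U n%:R%:E k w ->
  (forall I, measurable_fun setT (fun x => restr U w x I)) /\
  L1 (fun x => ext_norm (restr U w x) ^+ p.+1).
Proof.
move=> np mU [[_ mw] Hw].
have mr I : measurable_fun setT (fun x => restr U w x I).
  by have [H _] := @measurable_restr R n U w I mU; exact: (H (mw I)).
split=> //; have mN := measurable_ext_norm mr.
apply/L1_ge0P => //; first exact: measurable_funX.
  by move=> x; rewrite exprn_ge0// ext_norm_ge0.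
move: Hw; rewrite patch_ext_norm => /(poweR_lty n%:R).
rewrite poweR_Lnorm; last by rewrite pnatr_eq0 -lt0n [leqRHS]np.
congr (_ < _)%E; apply: eq_integral => x _ /=.
rewrite ger0_norm ?ext_norm_ge0// powR_mulrn ?ext_norm_ge0//.
by congr (_%:E); congr (_ ^+ _); exact: np.
Qed.

End dominating_function.

Section coef_weak_d_linear.
Context {R : realType} {n : nat}.
Variables (U : set 'rV[R]_n).

Lemma coef_weak_d0 k :
  coef_weak_d U k (fun=> [ffun=> 0] : ext R n) (fun=> [ffun=> 0]).
Proof.
have I0 J (h : 'rV[R]_n -> R) : Int (fun x => ([ffun=> 0] : ext R n) J * h x) = 0.
  by rewrite -[RHS](@Int0 R n); apply: eq_Int => x; rewrite ffunE mul0r.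
by move=> J psi _ _; rewrite I0 big1 ?oppr0// => i _; rewrite I0 mulr0.
Qed.

Lemma coef_weak_d_sum k (A : finType) (P : pred A) (phi theta : A -> 'rV[R]_n -> ext R n) :
  (forall a I, P a -> L1 (fun x => phi a x I)) -> (forall a I, P a -> L1 (fun x => theta a x I)) ->
  (forall a, P a -> coef_weak_d U k (phi a) (theta a)) ->
  coef_weak_d U k (fun x => \sum_(a | P a) phi a x) (fun x => \sum_(a | P a) theta a x).
Proof.
move=> iphi itheta H J psi cJ tpsi.
transitivity (Int (fun x => \sum_(a | P a) theta a x J * psi x)).
  by apply: eq_Int => x; rewrite sum_ffunE mulr_suml.
rewrite Int_sum; last by move=> a Pa; apply: L1_mul_test tpsi; exact: itheta.
transitivity (\sum_(a | P a) - \sum_(i in J) eps i J *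
    Int (fun x => phi a x (J :\ i)%SET * 'D_(basis_vec i) psi x)).
  by apply: eq_bigr => a Pa; exact: H.
rewrite sumrN exchange_big/=; congr (- _); apply: eq_bigr => i _.
rewrite -mulr_sumr; congr (_ * _).
rewrite -Int_sum; last by move=> a Pa; apply: L1_mul_test (test_derive i tpsi); exact: iphi.
by apply: eq_Int => x; rewrite sum_ffunE mulr_suml.
Qed.

End coef_weak_d_linear.

(** * Pull-back of smooth forms *)

(** On the open set O, a coefficient of the wrong degree vanishes identically, and so
do its derivatives. *)
Lemma smooth_form_extd {R : realType} {m : nat} (O : set 'rV[R]_m) k w :
  open O -> smooth_form_on O k w -> smooth_form_on O k.+1 (extd w).
Proof.
move=> oO [hw sw]; split=> [x Ox K cK|K].
  rewrite extdE big1// => i iK; rewrite (derive_vanish (O := O)) ?mulr0// => y Oy.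
  apply: hw => //; apply: contraNneq cK => cK.
  by rewrite (cardsD1 i) iK cK.
move=> r; have -> : (fun x => extd w x K) = fun x => \sum_(i in K) @eps R m i K *
    'D_(basis_vec i) (fun y => w y (K :\ i)%SET) x.
  by apply/funext => x; exact: extdE.
apply: Cr_sum => // i; apply: CrM => //; first exact: Cr_cst.
exact: smooth_derive.
Qed.

Section pullback_theory.
Context {R : realType} {n m : nat}.
Variables (U : set 'rV[R]_n) (G : 'rV[R]_n -> R) (p : nat).
Hypotheses (np : n = p.+1) (oU : open U) (bU : bounded_set U).
Hypothesis G1 : forall x, 1 <= G x.
Hypothesis iG : L1 (fun x => \1_U x * G x ^+ p.+1).
Variables (f : 'rV[R]_n -> 'rV[R]_m) (df : 'I_m -> 'rV[R]_n -> ext R n).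
Local Notation alpha j := (restr U (df j)).
Hypothesis hdf : forall j x, U x -> ext_homog 1 (df j x).
Hypothesis bdf : forall j, growth_form U G 1 (df j).
Hypothesis bf : forall j, growth U G 0 (fun x => \1_U x * f x ord0 j).
Hypothesis wf : forall j i,
  weak_partial U i (fun x => \1_U x * f x ord0 j) (fun x => alpha j x [set i]%SET).
Variables (C O : set 'rV[R]_m).
Hypotheses (cC : compact C) (oO : open O) (CO : C `<=` O).
Hypothesis fC : forall x, U x -> C (f x).

(** The form df^(s_1) /\ ... /\ df^(s_k), which for the empty list is the indicator
of U. *)
Definition diff_prod (s : seq 'I_m) : 'rV[R]_n -> ext R n :=
  restr U (fun x => wprod (fun j => df j x) s).

Lemma diff_prod_nil x K : diff_prod [::] x K = \1_U x * ext_one K.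
Proof. by rewrite ffunE. Qed.

Lemma diff_prod_cons j s x K : diff_prod (j :: s) x K =
  \sum_(i in K) @eps R n i K * (alpha j x [set i]%SET * diff_prod s x (K :\ i)%SET).
Proof.
have [Ux|Ux] := pselect (U x); last first.
  rewrite restr_out// big1// => i _; rewrite [alpha _ _ _]restr_out//.
  by rewrite mul0r mulr0.
rewrite restr_in// wprod_cons wedge1E; last exact: hdf.
by apply: eq_bigr => i _; rewrite !restr_in// mulrA.
Qed.

Lemma growth_indic : growth U G 0 (\1_U : 'rV[R]_n -> R).
Proof.
split; first by apply: measurable_indic; exact: measurable_open_rV.
by exists 1 => // x; rewrite expr0 mul1r mulr1 ger0_norm// indicE ler0n.
Qed.

Lemma growth_diff_prod s K : growth U G (size s) (fun x => diff_prod s x K).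
Proof.
elim: s K => [|j s IH] K.
  under eq_fun do rewrite diff_prod_nil mulrC.
  by apply: growthZ; exact: growth_indic.
under eq_fun do rewrite diff_prod_cons.
apply: growth_sum => i _; apply: growthZ.
exact: (@growthM R n U G 1 (size s) _ _ (bdf j _) (IH _)).
Qed.

(** By induction on s: df^j /\ df^s is the differential of f^j df^s by the Leibniz
rule, as df^s is closed, and d d = 0. The empty product is constant on U, and the
integral of a partial derivative of a test function is 0. *)
Lemma coef_weak_d_diff_prod s : (size s <= n)%N -> coef_weak_d U (size s) (diff_prod s) (fun=> [ffun=> 0]).
Proof.
elim: s => [|j s IH] /= sn.
  move=> J psi _ tpsi.
  have -> : Int (fun x => ([ffun=> 0] : ext R n) J * psi x) = 0.
    by rewrite -[RHS](@Int0 R n); apply: eq_Int => x; rewrite ffunE mul0r.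
  rewrite big1 ?oppr0// => i _.
  have -> : Int (fun x => diff_prod [::] x (J :\ i)%SET * 'D_(basis_vec i) psi x) =
      Int (fun x => ext_one (J :\ i)%SET * 'D_(basis_vec i) psi x).
    apply: eq_Int => x; rewrite diff_prod_nil indicE.
    have [xU|/negP xU] := boolP (x \in U); first by rewrite mul1r.
    have [_ [K [_ KU dK]]] := test_derive i tpsi.
    by rewrite dK ?mulr0// => /KU Ux; apply: xU; rewrite inE.
  by rewrite IntZ ?(Int_derive_test _ tpsi) ?mulr0//; apply: test_L1 (test_derive i tpsi).
have sp : (size s <= p)%N by rewrite -ltnS -np.
have := @coef_weak_d_mul R n U G p oU bU G1 iG (size s) (diff_prod s) (fun=> [ffun=> 0])
  (fun x => \1_U x * f x ord0 j) (fun i x => alpha j x [set i]%SET) sp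
  (growth_diff_prod s) _ (bf j) (fun i => bdf j [set i]%SET) (wf j) (IH (ltnW sn)).
move=> /(_ _)/coef_weak_d_closed; rewrite (_ : (fun x => [ffun J => _]) = diff_prod (j :: s)).
  apply => J; under eq_fun do rewrite ffunE; exact: growth0.
apply/funext => x; apply/ffunP => J; rewrite diff_prod_cons ffunE.
by rewrite [X in _ + _ * X]ffunE mulr0 addr0.
Qed.

Let F x : 'rV[R]_m := \row_j (\1_U x * f x ord0 j).

Let FE x : U x -> F x = f x.
Proof. by move=> Ux; apply/rowP => j; rewrite mxE indicE mem_set// mul1r. Qed.

Lemma growth_comp_test b : test_function [set: 'rV[R]_m] b -> growth U G 0 (fun x => \1_U x * b (F x)).
Proof.
move=> tb; have [M Mb] := test_bounded tb; case: tb => sb _; split.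
  apply: measurable_funM; first by apply: measurable_indic; exact: measurable_open_rV.
  apply: (measurableT_comp (measurable_continuous_rV (smooth_continuous sb))).
  apply/measurable_fun_rVP => j; under eq_fun do rewrite mxE.
  by case: (bf j).
exists M => [|x]; first exact: le_trans (normr_ge0 _) (Mb 0).
  by rewrite expr0 mulr1 normrM mulrC; apply: ler_pM => //; rewrite ?ger0_norm ?indicE ?ler0n.
Qed.

(** As f takes its values in C on U, nothing changes if g is replaced by a compactly
supported function that agrees with g to first order on C. The chain rule applies
to the latter. *)
Lemma comp_smooth g : smooth_on O g ->
  let v i x := \sum_(j < m) 'D_(basis_vec j) g (f x) * alpha j x [set i]%SET in
  [/\ growth U G 0 (fun x => \1_U x * g (f x)),
      forall i, growth U G 1 (v i) &
      forall i, weak_partial U i (fun x => \1_U x * g (f x)) (v i)].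
Proof.
move=> sg v; have [b [tb bE dbE]] := smooth_extension cC oO CO sg.
have {}tb : test_function [set: 'rV[R]_m] b by exact: testS tb.
have gE : (fun x => \1_U x * g (f x)) = (fun x => \1_U x * b (F x)).
  apply/funext => x; have [Ux|Ux] := pselect (U x).
    by rewrite FE// bE//; exact: fC.
  by rewrite indicE memNset// !mul0r.
have vE i : v i = fun x => \sum_(j < m) 'D_(basis_vec j) b (F x) * alpha j x [set i]%SET.
  apply/funext => x; apply: eq_bigr => j _; have [Ux|Ux] := pselect (U x).
    by rewrite FE// dbE//; exact: fC.
  by rewrite restr_out// !mulr0.
split=> [|i|i]; first by rewrite gE; exact: growth_comp_test.
  have -> : v i = fun x => \sum_(j < m)
      (\1_U x * 'D_(basis_vec j) b (F x)) * alpha j x [set i]%SET.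
    rewrite vE; apply/funext => x; apply: eq_bigr => j _; have [Ux|Ux] := pselect (U x).
      by rewrite indicE mem_set// mul1r.
    by rewrite restr_out// !mulr0.
  apply: growth_sum => j _; exact: (@growthM R n U G 0 1 _ _ (growth_comp_test (test_derive j tb)) (bdf j [set i]%SET)).
rewrite gE vE.
exact: (weak_partial_comp (v := fun j i x => alpha j x [set i]%SET) oU bU G1 iG i bf
  (fun j i => bdf j [set i]%SET) wf tb).
Qed.

Implicit Types (w : 'rV[R]_m -> ext R m).

Let fO x : U x -> O (f x). Proof. by move=> /fC/CO. Qed.

Lemma pullback_homog k w : smooth_form_on O k w ->
  forall x, U x -> ext_homog k (pullback f df w x).
Proof.
move=> [hw _] x Ux K cK; rewrite ffunE big1// => I _.
have [cI|cI] := eqVneq #|I| k; last by rewrite (hw _ (fO Ux))// mul0r.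
have := @wprod_homog R n m (fun j => df j x) (fun j => hdf j Ux) (enum I) K.
by rewrite -cardE cI => ->//; rewrite mulr0.
Qed.

Lemma restr_pullback w x K : restr U (pullback f df w) x K =
  \sum_I (\1_U x * w (f x) I) * diff_prod (enum I) x K.
Proof.
rewrite ffunE indicE; have [xU|/negP xU] := boolP (x \in U).
  rewrite mul1r ffunE; apply: eq_bigr => I _.
  by rewrite mul1r /diff_prod restr_in//; rewrite inE in xU.
by rewrite mul0r big1// => I _; rewrite !mul0r.
Qed.

Lemma growth_pullback k w : smooth_form_on O k w -> growth_form U G k (pullback f df w).
Proof.
move=> [hw sw] K; under eq_fun do rewrite restr_pullback.
apply: growth_sum => I _; have [cI|cI] := eqVneq #|I| k.
  have [bw _ _] := comp_smooth (sw I).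
  apply: (@growthM R n U G 0 k _ _ bw).
  by have := growth_diff_prod (enum I) K; rewrite -cardE cI.
rewrite (_ : (fun _ => _) = fun=> 0); first exact: growth0.
apply/funext => x; have [Ux|Ux] := pselect (U x).
  by rewrite (hw _ (fO Ux))// mulr0 mul0r.
by rewrite indicE memNset// !mul0r.
Qed.

(** The Leibniz rule for each term (b_I o f) df^I of the pull-back, where df^I is
closed and d (b_I o f) is given by the chain rule. *)
Lemma coef_weak_d_pullback k w : (k <= p)%N -> smooth_form_on O k w ->
  coef_weak_d U k (restr U (pullback f df w)) (restr U (pullback f df (extd w))).
Proof.
move=> kp [hw sw].
pose v (I : {set 'I_m}) (i : 'I_n) x : R := \sum_(j < m) 'D_(basis_vec j) (fun y => w y I) (f x) * alpha j x [set i]%SET.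
pose phi (I : {set 'I_m}) x : ext R n := [ffun K : {set 'I_n} => (\1_U x * w (f x) I) * diff_prod (enum I) x K].
(* the Leibniz rule for phi I; the last summand is the differential of df^I *)
pose theta (I : {set 'I_m}) x : ext R n := [ffun J : {set 'I_n} => \sum_(i in J) @eps R n i J *
  (v I i x * diff_prod (enum I) x (J :\ i)%SET) + (\1_U x * w (f x) I) * ([ffun=> 0] : ext R n) J].
have phiE I x K : phi I x K = (\1_U x * w (f x) I) * diff_prod (enum I) x K.
  by rewrite [LHS]ffunE.
have thetaE I x J : theta I x J = \sum_(i in J) @eps R n i J *
    (v I i x * diff_prod (enum I) x (J :\ i)%SET).
  by rewrite [LHS]ffunE [X in _ + _ * X]ffunE mulr0 addr0.
have comp I := comp_smooth (sw I).
have bD (I : {set 'I_m}) K : #|I| == k -> growth U G k (fun x => diff_prod (enum I) x K).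
  by move=> /eqP cI; have := growth_diff_prod (enum I) K; rewrite -cardE cI.
have -> : restr U (pullback f df w) = fun x => \sum_(I : {set 'I_m} | #|I| == k) phi I x.
  apply/funext => x; apply/ffunP => K; rewrite restr_pullback sum_ffunE.
  rewrite [LHS](bigID (fun I : {set 'I_m} => #|I| == k))/= [X in _ + X]big1 ?addr0.
    by apply: eq_bigr => I _; rewrite phiE.
  move=> I cI; have [Ux|Ux] := pselect (U x).
    by rewrite (hw _ (fO Ux))// mulr0 mul0r.
  by rewrite indicE memNset// !mul0r.
have -> : restr U (pullback f df (extd w)) = fun x => \sum_(I : {set 'I_m} | #|I| == k) theta I x.
  apply/funext => x; apply/ffunP => J; rewrite sum_ffunE.
  have [Ux|Ux] := pselect (U x); last first.
    rewrite restr_out// big1// => I _; rewrite thetaE big1// => i _.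
    by rewrite /diff_prod restr_out// !mulr0.
  rewrite restr_in// ffunE.
  pose W (L : {set 'I_m}) := wprod (fun j => df j x) (enum L).
  transitivity (\sum_(L : {set 'I_m}) \sum_(j in L)
      @eps R m j L * 'D_(basis_vec j) (fun y => w y (L :\ j)%SET) (f x) * W L J).
    by apply: eq_bigr => L _; rewrite extdE mulr_suml.
  rewrite sum_setU1 [LHS](bigID (fun I : {set 'I_m} => #|I| == k))/= [X in _ + X]big1 ?addr0.
    apply: eq_bigr => I cI; rewrite thetaE.
    transitivity (\sum_(j < m) 'D_(basis_vec j) (fun y => w y I) (f x) *
        wedge (df j x) (W I) J).
      rewrite [RHS](bigID (fun j => j \in I))/= [X in _ = X + _]big1 ?add0r.
        apply: eq_bigr => j jI; rewrite finset.setU1K//.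
        rewrite (@wedge_wprod_enum R n m _ (fun j => hdf j Ux)) (negPf jI) ffunE.
        by rewrite -mulrA mulrCA.
      move=> j jI; rewrite (@wedge_wprod_enum R n m _ (fun j => hdf j Ux)) jI.
      by rewrite ffunE mulr0.
    under eq_bigr do rewrite (wedge1E _ _ (hdf _ Ux)) mulr_sumr.
    rewrite exchange_big/=; apply: eq_bigr => i _.
    rewrite /diff_prod restr_in// mulr_suml mulr_sumr; apply: eq_bigr => j _.
    by rewrite restr_in// -!mulrA mulrCA.
  move=> I cI; apply: big1 => j jI; rewrite finset.setU1K//.
  rewrite (derive_vanish (O := O)) ?mulr0 ?mul0r//; last exact: fO.
  by move=> y Oy; exact: hw.
have bphi (I : {set 'I_m}) K : #|I| == k -> growth U G k (fun x => phi I x K).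
  move=> cI; have [bw _ _] := comp I.
  under eq_fun do rewrite phiE.
  by apply: (@growthM R n U G 0 k _ _ bw); exact: bD.
have btheta (I : {set 'I_m}) J : #|I| == k -> growth U G k.+1 (fun x => theta I x J).
  move=> cI; have [_ bv _] := comp I.
  under eq_fun do rewrite thetaE.
  apply: growth_sum => i _; apply: growthZ.
  by apply: (@growthM R n U G 1 k _ _ (bv i)); exact: bD.
apply: coef_weak_d_sum => [I K cI|I K cI|I cI].
- by apply: (growth_L1 G1 iG _ (bphi _ _ cI)); rewrite (leq_trans kp).
- by apply: (growth_L1 G1 iG _ (btheta _ _ cI)); rewrite ltnS.
have [bw bv wv] := comp I.
apply: (coef_weak_d_mul oU bU G1 iG kp _ _ bw bv wv) => [K|J|].
- exact: bD.
- under eq_fun do rewrite ffunE; exact: growth0.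
have sn : (size (enum I) <= n)%N by rewrite -cardE (eqP cI) np ltnW.
by have := coef_weak_d_diff_prod sn; rewrite -cardE (eqP cI).
Qed.

End pullback_theory.

(** * Sobolev maps and the differential of the pull-back *)

Section sobolev_maps.
Context {R : realType} {n m : nat}.

(** The function G is 1 + |df^1| + ... + |df^m|. *)
Lemma W1n_growth p (U : set 'rV[R]_n) (V : set 'rV[R]_m)
    (f : 'rV[R]_n -> 'rV[R]_m) (df : 'I_m -> 'rV[R]_n -> ext R n) :
  n = p.+1 -> open U -> bounded_set U -> bounded_set V -> W1n U V f df ->
  exists G : 'rV[R]_n -> R,
    [/\ forall x, 1 <= G x, L1 (fun x => \1_U x * G x ^+ p.+1),
        forall j, growth_form U G 1 (df j),
        forall j, growth U G 0 (fun x => \1_U x * f x ord0 j) &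
        forall j i, weak_partial U i (fun x => \1_U x * f x ord0 j)
          (fun x => restr U (df j) x [set i]%SET)].
Proof.
move=> np oU bU bV [_ UV Hf]; have mU := measurable_open_rV oU.
pose N j x := ext_norm (restr U (df j) x).
pose G x := 1 + \sum_(j < m) N j x.
have N0 j x : 0 <= N j x by exact: ext_norm_ge0.
have G1 x : 1 <= G x by rewrite lerDl sumr_ge0.
have LN j : (forall I, measurable_fun setT (fun x => restr U (df j) x I)) /\
    L1 (fun x => N j x ^+ p.+1).
  by have [_ _ H] := Hf j; exact: Lp_form_L1 np mU H.
have mN j : measurable_fun setT (N j) by apply: measurable_ext_norm; case: (LN j).
have iG : L1 (fun x => \1_U x * G x ^+ p.+1).
  have i1 : L1 (\1_U : 'rV[R]_n -> R) by exact: indic_L1.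
  have -> : (fun x => \1_U x * G x ^+ p.+1) =
      fun x => (\1_U x + \sum_(j < m) N j x) ^+ p.+1.
    apply/funext => x; have [Ux|Ux] := pselect (U x).
      by rewrite indicE mem_set// mul1r.
    rewrite indicE memNset// mul0r big1 ?addr0 ?expr0n// => j _.
    by rewrite /N restr_off// ext_norm0.
  apply: L1_exprD.
  - exact: L1_measurable i1.
  - exact: measurable_sum.
  - by move=> x; rewrite indicE ler0n.
  - by move=> x; exact: sumr_ge0.
  - have -> : (fun x => \1_U x ^+ p.+1) = (\1_U : 'rV[R]_n -> R) => //.
    by apply/funext => x; rewrite indicE; case: (x \in U); rewrite ?expr1n// expr0n.
  - by apply: L1_expr_sum => // j; case: (LN j).
have bdf j : growth_form U G 1 (df j).
  move=> I; split; first by case: (LN j).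
  exists 1 => // x; rewrite mul1r expr1; have [Ux|Ux] := pselect (U x); last first.
    by rewrite restr_out// normr0 indicE memNset// mul0r.
  rewrite indicE mem_set// mul1r (le_trans (coef_le_ext_norm _ I))//.
  rewrite /G (bigD1 j)//= -/(N j x) addrCA lerDl addr_ge0//; exact: sumr_ge0.
have f0E j x I : restr U (form0 (fun x => f x ord0 j)) x I =
    (I == finset.set0)%:R * (\1_U x * f x ord0 j).
  by rewrite !ffunE; case: (I == _); rewrite ?mul1r// mul0r mulr0.
have bf j : growth U G 0 (fun x => \1_U x * f x ord0 j).
  split.
    have [H _ _] := Hf j; have [/(_ finset.set0) + _] := Lp_form_L1 np mU H.
    by under eq_fun do rewrite f0E eqxx mul1r.
  have [M [_ /(_ (M + 1))VM]] := bV.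
  exists `|M + 1| => // x; rewrite expr0 mulr1 normrM mulrC.
  have [Ux|Ux] := pselect (U x); last by rewrite indicE memNset// normr0 !mulr0.
  rewrite indicE mem_set// normr1 !mulr1 (le_trans (le_coord_norm _ _))//.
  apply: le_trans (ler_norm _); apply: VM; first by rewrite ltrDl.
  exact: UV.
exists G; split=> // j i psi tpsi; have [_ wdf _] := Hf j.
have H0 x : U x -> ext_homog 0 (form0 (fun x => f x ord0 j) x).
  by move=> _ I; rewrite cards_eq0 ffunE => /negPf ->.
have i0 I : L1 (fun x => restr U (form0 (fun x => f x ord0 j)) x I).
  by under eq_fun do rewrite f0E; apply: (growth_L1 G1 iG _ (growthZ _ (bf j))).
have i1 I : L1 (fun x => restr U (df j) x I).
  exact: (growth_L1 G1 iG _ (bdf j I)).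
have n0 : (0 < n)%N by rewrite np.
have := weak_d_coef oU n0 H0 i0 i1 wdf; move=> /(_ [set i]%SET psi).
rewrite cards1 => /(_ erefl tpsi) ->; rewrite finset.big_set1 eps_set1 mul1r.
congr (- _); apply: eq_Int => x.
by rewrite f0E finset.setDv eqxx mul1r.
Qed.

End sobolev_maps.

Theorem proposition4p1 (R : realType) (n m : nat) (n_gt0 : (0 < n)%N)
    (U : set 'rV[R]_n) (V : set 'rV[R]_m)
    (domU : bounded_domain U) (domV : bounded_domain V)
    (f : 'rV[R]_n -> 'rV[R]_m) (df : 'I_m -> 'rV[R]_n -> ext R n)
    (fW : W1n U V f df)
    (O : set 'rV[R]_m) (openO : open O) (VO : closure V `<=` O)
    (k : nat) (beta : 'rV[R]_m -> ext R m) (sbeta : smooth_form_on O k beta) :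
  Omega_conf_sum U (pullback f df beta) /\
  weak_d U k (pullback f df beta) (pullback f df (extd beta)).
Proof.
have [oU _ _ bU] := domU; have [_ _ _ bV] := domV; have [_ UV Hf] := fW.
have [p np] : exists p, n = p.+1 by exists n.-1; rewrite prednK.
have [G [G1 iG bdf bf wf]] := W1n_growth np oU bU bV fW.
have hdf j x : U x -> ext_homog 1 (df j x).
  by have [_ [_ [[H _] _] _] _] := Hf j; exact: H.
have cC := compact_closure_bounded bV.
have fC x : U x -> closure V (f x) by move=> /UV; exact: subset_closure.
have sd := smooth_form_extd openO sbeta.
have hpb := @pullback_homog _ _ _ U f df hdf (closure V) O VO fC.
have bpb := @growth_pullback R n m U G p oU bU G1 iG f df hdf bdf bf wf (closure V) O cC openO VO fC.
have wpb := @coef_weak_d_pullback R n m U G p np oU bU G1 iG f df hdf bdf bf wf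
  (closure V) O cC openO VO fC.
have high l w : smooth_form_on O l w -> (n < l)%N -> forall x, U x -> pullback f df w x = 0.
  move=> sw nl x Ux; apply/ffunP => K; rewrite [RHS]ffunE; apply: (hpb l w sw x Ux).
  by rewrite ltn_eqF// (leq_ltn_trans _ nl)// -[leqRHS]card_ord max_card.
have L1loc_pb l w : smooth_form_on O l w -> L1loc_form U l (pullback f df w).
  move=> sw; have [ln|nl] := leqP l n.
    exact: (growth_L1loc np oU G1 iG ln (hpb l w sw) (bpb l w sw)).
  apply: (growth_L1loc np oU G1 iG (leq0n n) (hpb l w sw)) => K.
  rewrite (restr_eq0 (high l w sw nl)); under eq_fun do rewrite ffunE.
  exact: growth0.
split.
  move=> l ln; have hl x : ext_homog l (ext_comp l (pullback f df beta x)).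
    by move=> K /negPf cK; rewrite ffunE cK.
  have [kl|kl] := eqVneq k l.
    have rE : restr U (fun x => ext_comp l (pullback f df beta x)) =
        restr U (pullback f df beta).
      apply/funext => x; have [Ux|Ux] := pselect (U x); last by rewrite !restr_off.
      rewrite !restr_on//; apply/ffunP => K; rewrite [LHS]ffunE; case: eqP => // /eqP cK.
      by rewrite (hpb k beta sbeta x Ux) ?kl.
    apply: (Omega_conf_growth (theta := pullback f df (extd beta)) np oU G1 iG ln).
    - by move=> x _; exact: hl.
    - by move=> K; rewrite rE -kl; exact: bpb.
    - by rewrite -kl; exact: hpb.
    - move=> ltln; rewrite rE -kl; split; first exact: bpb.
      by apply: wpb => //; rewrite -ltnS -np kl.
  (* the components of degree other than k vanish on U *)
  have r0 : restr U (fun x => ext_comp l (pullback f df beta x)) = fun=> [ffun=> 0].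
    apply: restr_eq0 => x Ux; apply/ffunP => K; rewrite [LHS]ffunE [RHS]ffunE.
    case: eqP => // cK; apply: (hpb k beta sbeta x Ux); by rewrite cK eq_sym.
  have b0 q : forall K, growth U G q (fun x => ([ffun=> 0] : ext R n) K).
    by move=> K; under eq_fun do rewrite ffunE; exact: growth0.
  have z0 : restr U (fun=> [ffun=> 0] : ext R n) = fun=> [ffun=> 0].
    exact: restr_eq0.
  apply: (Omega_conf_growth (theta := fun=> [ffun=> 0]) np oU G1 iG ln).
  - by move=> x _; exact: hl.
  - by move=> K; rewrite r0; exact: b0.
  - by move=> x _ K _; rewrite ffunE.
  - move=> _; rewrite r0 z0; split; last exact: coef_weak_d0.
    by move=> K; rewrite z0; exact: b0.
(* for k >= n there is no test form, as its degree would be negative *)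
have [kn|nk] := ltnP k n; last first.
  split; [exact: L1loc_pb|exact: L1loc_pb|].
  move=> W o l w _ _ _ kl; have kn : (k < n)%N by rewrite -kl addnS ltnS leq_addr.
  by rewrite leqNgt kn in nk.
apply: coef_weak_d_weak_d => //.
- exact: L1loc_pb.
- exact: L1loc_pb.
- by move=> K; apply: (growth_L1 G1 iG _ (bpb k _ sbeta K)); rewrite -np ltnW.
- by move=> K; apply: (growth_L1 G1 iG _ (bpb _ _ sd K)); rewrite -np.
- by apply: wpb => //; rewrite -ltnS -np.
Qed.
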